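(* Let $(a_k)_{k\in\mathbb{N}}$ be a sequence with $a_k>0$ for all $k$, let $\mu=\mu_{ac}+\mu_{disc}$ with $\mu_{ac}=x^2\mathbf 1_{(0,1)}\,dx$ and $\mu_{disc}=\sum_{k=1}^\infty a_k\delta_k$, and let $\check{\mathcal{E}}$ be the trace of the Bessel Dirichlet form $\mathcal{E}$ (case $n=3$) with respect to $\mu$. Then $\check{\mathcal{E}}$ is transient and irreducible.
   Context: $\mathbb{N}=\{1,2,\dots\}$ and $I=(0,\infty)$; $AC(I)$ denotes the (locally) absolutely continuous functions on $I$. Let $dm=2x^2\,dx$ on $I$. The Bessel Dirichlet form (case $n=3$) is the form in $L^2(I,m)$ with $$\mathcal{D}=\{u\in AC(I)\cap L^2(I,m):\ \int_0^\infty (u')^2x^2\,dx<\infty\},\qquad \mathcal{E}[u]=\int_0^\infty (u'(x))^2x^2\,dx .$$ For $\lambda>0$, $\mathcal{E}_\lambda[u]=\mathcal{E}[u]+\lambda\int_I u^2\,dm$. Trace with respect to $\mu$: let $F=[0,1]\cup\mathbb{N}$ be the support of $\mu$, $D(J)=\{u\in\mathcal{D}:u|_F\in L^2(F,\mu)\}$ and $J:D(J)\to L^2(F,\mu)$, $Ju=u|_F$ (the point $0$ is $\mu$-null). For $\lambda>0$ let $P_\lambda$ be the orthogonal projection in $(\mathcal{D},\mathcal{E}_\lambda)$ onto the $\mathcal{E}_\lambda$-orthogonal complement of $\ker J=\{u\in\mathcal{D}:u|_{(0,1)}=0,\ u(k)=0\ \forall k\in\mathbb{N}\}$, and set $\check{\mathcal{E}}_\lambda[Ju]:=\mathcal{E}_\lambda[P_\lambda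 u]$ for $u\in D(J)$. Each $\check{\mathcal{E}}_\lambda$ is a closed form in $L^2(F,\mu)$ with domain $\operatorname{ran}J$, and the family is monotone increasing in $\lambda$. The trace form $\check{\mathcal{E}}$, with domain $\check{\mathcal{D}}$, is by definition the Mosco limit of $\check{\mathcal{E}}_\lambda$ as $\lambda\downarrow0$; it is a Dirichlet form in $L^2(F,\mu)$ with semigroup $\check T_t$. Irreducible: if a measurable $A\subset F$ is invariant (i.e. $\check T_t(\mathbf 1_Af)=\mathbf 1_A\check T_tf$ for all $f\in L^2(F,\mu)$, $t>0$), then $\mu(A)=0$ or $\mu(F\setminus A)=0$. Transient: there is a bounded $g\in L^1(F,\mu)$, $g>0$ $\mu$-a.e., with $\int_F|u|g\,d\mu\le\sqrt{\check{\mathcal{E}}[u]}$ for all $u\in\check{\mathcal{D}}$. *)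

(* Defs.v *)
From HB Require Import structures.
From mathcomp Require Import all_boot all_order all_algebra.
From mathcomp Require Import all_classical all_reals all_analysis.
From mathcomp Require Import measurable_realfun.

Set Implicit Arguments.
Unset Strict Implicit.
Unset Printing Implicit Defensive.

Import Order.TTheory GRing.Theory Num.Theory.
Import numFieldNormedType.Exports.

Local Open Scope classical_set_scope.
Local Open Scope ring_scope.

(** Quadratic forms on a real L^2 space.

    Elements of L^2(mu) are represented by functions [f \in Lfun mu 2%:E];
    equality in L^2(mu) is equality [mu]-almost everywhere.  A quadratic form is
    represented by an extended-real-valued functional on functions, whose
    domain consists of the elements of L^2(mu) at which it is [< +oo]. *)

Section L2_forms.
Context {d : measure_display} {T : measurableType d} {R : realType}.
Variable mu : {measure set T -> \bar R}.
Implicit Types (f g h : T -> R) (E : (T -> R) -> \bar R).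

Definition L2 : set (T -> R) := [set f | f \in Lfun mu 2%:E].

Definition L2norm f : \bar R := ('N[mu]_2%:E[EFin \o f])%E.

Definition L2dot f g : R := \int[mu]_x (f x * g x).

Definition strong_cvg (f_ : nat -> T -> R) f :=
  L2norm (f_ n - f) @[n --> \oo] --> 0%E.

Definition weak_cvg (f_ : nat -> T -> R) f :=
  forall g, L2 g -> L2dot (f_ n) g @[n --> \oo] --> L2dot f g.

(* Mosco convergence of the family [El l] to [E] as [l] decreases to 0, along
   every sequence of positive parameters tending to 0. *)
Definition mosco_limit (El : R -> (T -> R) -> \bar R) E :=
  forall l : nat -> R, (forall n, 0 < l n) -> l n @[n --> \oo] --> (0 : R) ->
  (forall (f_ : nat -> T -> R) f, (forall n, L2 (f_ n)) -> L2 f -> weak_cvg f_ f ->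
     (E f <= limn_einf (fun n => El (l n) (f_ n)))%E) /\
  (forall f, L2 f -> exists f_ : nat -> T -> R, [/\ forall n, L2 (f_ n), strong_cvg f_ f &
     (limn_esup (fun n => El (l n) (f_ n)) <= E f)%E]).

Definition form_dom E : set (T -> R) := [set f | L2 f /\ (E f < +oo)%E].

(* The bilinear form obtained from the quadratic form by polarization; used for
   [f] and [g] in the domain of [E]. *)
Definition form_bilin E f g : R := (fine (E (f + g)) - fine (E (f - g))) / 4.

(* [S] is a strongly continuous semigroup of symmetric contractions on
   L^2(mu). *)
Record L2_semigroup (S : R -> (T -> R) -> (T -> R)) : Prop := {
  sg_L2 : forall (t : R) f, 0 <= t -> L2 f -> L2 (S t f) ;
  sg_ae : forall (t : R) f g, 0 <= t -> L2 f -> L2 g ->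
    f = g %[ae mu] -> S t f = S t g %[ae mu] ;
  sg_linear : forall (t c : R) f g, 0 <= t -> L2 f -> L2 g ->
    S t (c *: f + g) = c *: S t f + S t g %[ae mu] ;
  sg_contraction : forall (t : R) f, 0 <= t -> L2 f ->
    (L2norm (S t f) <= L2norm f)%E ;
  sg_symmetric : forall (t : R) f g, 0 <= t -> L2 f -> L2 g ->
    L2dot (S t f) g = L2dot f (S t g) ;
  sg_zero : forall f, L2 f -> S 0 f = f %[ae mu] ;
  sg_add : forall (s t : R) f, 0 <= s -> 0 <= t -> L2 f ->
    S (s + t) f = S s (S t f) %[ae mu] ;
  sg_continuous : forall f, L2 f ->
    L2norm (S t f - f) @[t --> 0^'+] --> 0%E }.

(* [h] is the value at [f] of the infinitesimal generator of [S]. *)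
Definition generator_at (S : R -> (T -> R) -> (T -> R)) f h :=
  L2norm (t^-1 *: (S t f - f) - h) @[t --> 0^'+] --> 0%E.

(* [S] is the semigroup of the form [E]: its generator [A] is the operator
   associated with [E], i.e. [A f = h] iff [f] is in the domain of [E] and
   [E(f, g) = - <h, g>] for all [g] in the domain of [E]. *)
Definition semigroup_of_form E (S : R -> (T -> R) -> (T -> R)) :=
  L2_semigroup S /\
  forall f h, L2 f -> L2 h ->
    (generator_at S f h <->
     (form_dom E f /\
      forall g, form_dom E g -> form_bilin E f g = - L2dot h g)).

Definition invariant_set (S : R -> (T -> R) -> (T -> R)) (A : set T) :=
  forall f (t : R), L2 f -> 0 < t ->
    S t ((\1_A : T -> R) * f) = (\1_A : T -> R) * S t f %[ae mu].

(* [F] is the state space, a measurable set with [mu]-null complement. *)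
Definition irreducible (F : set T) E :=
  forall S, semigroup_of_form E S ->
  forall A, measurable A -> A `<=` F -> invariant_set S A ->
    mu A = 0%E \/ mu (F `\` A) = 0%E.

Definition transient (F : set T) E :=
  exists g : T -> R,
    [/\ mu.-integrable F (EFin \o g),
        exists M : R, forall x, F x -> `|g x| <= M,
        {ae mu, forall x, F x -> 0 < g x} &
        forall u, form_dom E u ->
          (\int[mu]_(x in F) (`|u x| * g x)%:E
             <= (Num.sqrt (fine (E u)))%:E)%E].

End L2_forms.

Section absolute_continuity.
Variable R : realType.

Definition abs_continuous (a b : R) (u : R -> R) :=
  forall e : R, 0 < e -> exists2 d : R, 0 < d &
    forall n (s t : 'I_n -> R),
      (forall i, a <= s i /\ s i <= t i /\ t i <= b) ->
      trivIset setT (fun i => [set` `]s i, t i[]) ->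
      \sum_(i < n) (t i - s i) < d ->
      \sum_(i < n) `|u (t i) - u (s i)| < e.

(* Local absolute continuity on (0, oo). *)
Definition AC_loc (u : R -> R) :=
  forall a b : R, 0 < a -> a <= b -> abs_continuous a b u.

End absolute_continuity.

(** The measure x^2 dx on the real line. *)
Section sqr_measure.
Variable R : realType.

Definition sqr_measure (A : set R) : \bar R :=
  (\int[lebesgue_measure]_(x in A) (x ^+ 2)%:E)%E.

Let sqr_measure0 : sqr_measure set0 = 0%E.
Proof. exact: integral_set0. Qed.

Let sqr_measure_ge0 A : (0 <= sqr_measure A)%E.
Proof. by apply: integral_ge0 => x _; rewrite lee_fin sqr_ge0. Qed.

Let sqr_measure_sigma_additive : semi_sigma_additive sqr_measure.
Proof.
apply: (@semi_sigma_additive_nng_induced _ _ _ lebesgue_measure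
  (fun x : R => (x ^+ 2)%:E)) => [|x]; last by rewrite lee_fin sqr_ge0.
by apply/measurable_EFinP; exact: exprn_measurable.
Qed.

HB.instance Definition _ := isMeasure.Build _ _ _ sqr_measure
  sqr_measure0 sqr_measure_ge0 sqr_measure_sigma_additive.

End sqr_measure.

(** The Bessel Dirichlet form, n = 3.

    Functions on I = (0, oo) are represented by functions on the whole line,
    whose values outside I are irrelevant. *)
Section bessel.
Variable R : realType.
Implicit Types (l : R) (u v w p f : R -> R).

Definition halfline : set R := `]0, +oo[%classic.

Lemma measurable_halfline : measurable halfline.
Proof. exact: measurable_itv. Qed.

Definition bessel_m : {measure set R -> \bar R} :=
  mscale 2%:nng (mrestr (@sqr_measure R) measurable_halfline).

Definition bessel_dom u :=
  [/\ AC_loc u, L2 bessel_m (u \_ halfline) &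
    (\int[lebesgue_measure]_(x in halfline)
        (u^`()%classic x ^+ 2 * x ^+ 2)%:E < +oo)%E].

Definition bessel u v : R :=
  \int[lebesgue_measure]_(x in halfline)
    (u^`()%classic x * v^`()%classic x * x ^+ 2).

Definition bessel_lambda l u v : R :=
  bessel u v + l * \int[bessel_m]_(x in halfline) (u x * v x).

(** The trace with respect to
    [mu = x^2 1_(0,1) dx + \sum_(k >= 1) a_k delta_k]; the value [a 0] is
    not used. *)

Definition trace_mu_ac : {measure set R -> \bar R} :=
  mrestr (@sqr_measure R) (measurable_itv `]0, 1[).

Definition trace_mu_disc (a : nat -> {posnum R}) : {measure set R -> \bar R} :=
  mseries (fun k => mscale (a k)%:num%:nng (dirac (k%:R : R))) 1.

Definition trace_mu (a : nat -> {posnum R}) : {measure set R -> \bar R} :=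
  measure_add trace_mu_ac (trace_mu_disc a).

Definition trace_F : set R :=
  `[0, 1]%classic `|` [set k%:R | k in [set k : nat | (0 < k)%N]].

(* [Ju = u|_F].  Elements of L^2(F, mu) are represented on the whole line, the
   complement of F being mu-null, and the value at the mu-null point 0 does not
   matter. *)
Definition trace_J u : R -> R := u \_ trace_F.

Definition trace_DJ (a : nat -> {posnum R}) u :=
  bessel_dom u /\ L2 (trace_mu a) (trace_J u).

Definition trace_kerJ u :=
  [/\ bessel_dom u, forall x : R, 0 < x < 1 -> u x = 0 &
    forall k : nat, (0 < k)%N -> u k%:R = 0].

Definition trace_compl l w :=
  bessel_dom w /\ forall v, trace_kerJ v -> bessel_lambda l w v = 0.

(* [p] is the orthogonal projection [P_l u]. *)
Definition trace_proj l u p :=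
  trace_compl l p /\
  forall w, trace_compl l w -> bessel_lambda l (u - p) w = 0.

(* The infimum is over the single value [E_l[P_l u]] if [f = Ju] with [u] in
   D(J), and over the empty set, hence equal to +oo, if [f] is not in the range
   of [J]. *)
Definition trace_lambda (a : nat -> {posnum R}) l f : \bar R :=
  ereal_inf [set (bessel_lambda l p p)%:E | p in
    [set p | exists u, [/\ trace_DJ a u, trace_J u = f %[ae trace_mu a] &
      trace_proj l u p]]].

Definition is_trace_form (a : nat -> {posnum R}) (E : (R -> R) -> \bar R) :=
  mosco_limit (trace_mu a) (trace_lambda a) E.

End bessel.

(* Main.v *)
Require Import Defs.
From HB Require Import structures.
From mathcomp Require Import all_boot all_order all_algebra.
From mathcomp Require Import all_classical all_reals all_analysis.
From mathcomp Require Import measurable_realfun ring lra.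

Set Implicit Arguments.
Unset Strict Implicit.
Unset Printing Implicit Defensive.

Import Order.TTheory GRing.Theory Num.Theory.
Import numFieldNormedType.Exports.

Local Open Scope classical_set_scope.
Local Open Scope ring_scope.

(** Transience. By the Hardy type bound [u(x)^2 <= E[u] / x] ([bessel_decay]), which
    is Cauchy-Schwarz for [u(y) - u(x)] together with square integrability at
    infinity, functions of finite energy are controlled pointwise by their energy.
    A function [u] in the domain of the trace form is the strong limit of traces of
    functions on the half-line whose energies are at most [E[u] + o(1)]
    ([form_recovery]), so by Chebyshev's inequality it obeys the same bound almost
    everywhere ([form_decay]). Any bounded weight that is small enough to be
    integrable against [x^(-1/2)] and [mu] then proves transience.

    Irreducibility. Cut the support into the cells [(0, 1]], [{2}], [{3}], and so
    on. The indicator of a cell is the trace of an explicit function [phi n 0] that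
    is harmonic (of the form [A + B / x]) off the support. Integration by parts
    ([hat_bessel]) shows that the energy of [phi n 0] against any [v] is a
    combination [flux_form n v] of the values of [v] at the integers [n], [n+1] and
    [n+2] only. This survives the Mosco limit ([form_bilin_cell]): one inequality
    comes from adding a multiple of [phi n l] to a recovery sequence, and it can be
    inverted. Since [flux_form n] is given by an [L^2] density supported by atoms,
    the indicator of a cell lies in the domain of the generator, which sends mass to
    the neighbouring integers. Hence an invariant set that contains a cell contains
    the adjacent atoms ([flux_density_invariant]), and an invariant set contains
    either all or none of the integers, provided that it contains all of [(0, 1]], up
    to a null set, as soon as it contains 1.

    It remains to exclude that an invariant set divides [(0, 1]]. The indicator of
    its part in [(0, 1]] is in the domain of the form, because the domain of the
    generator is stable under multiplication by the indicator of an invariant set.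
    Functions of bounded energy are uniformly Hoelder continuous away from 0
    ([bessel_holder]), so that a two-valued function in the domain is almost
    everywhere constant on [(0, 1]], and equal to its value at the atom 1
    ([form_dom_two_valued]).

    These arguments need the following about absolutely continuous functions and
    about projections. Locally absolutely continuous functions have a density
    ([AC_loc_density]), through the Jordan decomposition and the Radon-Nikodym
    theorem for Stieltjes measures. The projection onto the orthogonal complement
    of the kernel of the trace does not change the values on the support
    ([trace_proj_node]), since this complement contains functions that
    approximate the Green functions of the points of the support. *)

(** * Absolute continuity and variation *)

Section interval_families.
Variable R : realType.
Implicit Types (a b c x y e d : R) (u v : R -> R) (L : seq (R * R)).

(** Lists of intervals are easier to concatenate and refine than the indexed
    families of the epsilon-delta definition, so absolute continuity is restated
    for lists. Intervals are allowed to share endpoints and to be degenerate. *)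
Definition apart (p q : R * R) := (p.2 <= q.1) || (q.2 <= p.1).

Definition nonoverlapping a b L :=
  all (fun p => [&& a <= p.1, p.1 <= p.2 & p.2 <= b]) L && pairwise apart L.

Definition len L : R := \sum_(p <- L) (p.2 - p.1).

Definition osc u L : R := \sum_(p <- L) `|u p.2 - u p.1|.

Definition abs_cont_list a b u := forall e, 0 < e -> exists2 d, 0 < d &
  forall L, nonoverlapping a b L -> len L < d -> osc u L <= e.

Lemma abs_continuous_list a b u : abs_continuous a b u -> abs_cont_list a b u.
Proof.
move=> ac e e0; have [d d0 H] := ac e e0; exists d => // L /andP[Lab Ld] Llen.
pose s (i : 'I_(size L)) := (nth (0, 0) L i).1.
pose t (i : 'I_(size L)) := (nth (0, 0) L i).2.
have bn F : \sum_(p <- L) F p = \sum_(i < size L) F (nth (0, 0) L i) :> R.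
  by rewrite (big_nth (0, 0)) big_mkord.
rewrite /osc bn; apply/ltW; apply: (H _ s t) => //; last first.
- by move: Llen; rewrite /len bn.
- apply/trivIsetP => i j _ _ ij.
  have /(pairwiseP (0, 0)) P := Ld.
  have A : apart (s i, t i) (s j, t j).
    have [ltij|ltji|/val_inj eqij] := ltngtP i j; last by rewrite eqij eqxx in ij.
    + by rewrite /s /t -!surjective_pairing; apply: P; rewrite ?inE ?ltn_ord.
    + rewrite /apart orbC -[_ || _]/(apart (s j, t j) (s i, t i)).
      by rewrite /s /t -!surjective_pairing; apply: P; rewrite ?inE ?ltn_ord.
  apply/seteqP; split => // x []; rewrite /= !in_itv/= => /andP[h1 h2] /andP[h3 h4].
  by move: A; rewrite /apart /= => /orP[]; lra.
- move=> i; have /allP/(_ (nth (0, 0) L i)) := Lab.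
  by rewrite mem_nth ?ltn_ord// => /(_ isT)/and3P[].
Qed.

Lemma nonoverlapping_cat a b L1 L2 : nonoverlapping a b (L1 ++ L2) =
  [&& nonoverlapping a b L1, nonoverlapping a b L2 & allrel apart L1 L2].
Proof.
rewrite /nonoverlapping all_cat pairwise_cat.
by case: (all _ L1); case: (all _ L2); case: (pairwise _ L1);
  case: (pairwise _ L2); case: (allrel _ L1 L2).
Qed.

Lemma apartC p q : apart p q = apart q p.
Proof. by rewrite /apart orbC. Qed.

(** The consecutive intervals cut out by a subdivision with initial point [x]. *)
Fixpoint cells x (s : seq R) :=
  if s is y :: s' then (x, y) :: cells y s' else [::].

Lemma cells_itv a b s : itv_partition a b s ->
  all (fun p => [&& a <= p.1, p.1 <= p.2 & p.2 <= b]) (cells a s).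
Proof.
elim: s a => [//|y s IH] a abs /=.
have [/= /andP[ay _] _] := abs; have yb := itv_partition_cons abs.
rewrite lexx ltW// (itv_partition_le yb)/=.
apply: sub_all (IH _ yb) => p /and3P[h1 -> ->].
by rewrite (le_trans (ltW ay) h1).
Qed.

Lemma nonoverlapping_cells a b s : itv_partition a b s ->
  nonoverlapping a b (cells a s).
Proof.
move=> abs; rewrite /nonoverlapping (cells_itv abs) /=.
elim: s a abs => [//|y s IH] a abs /=; have yb := itv_partition_cons abs.
rewrite IH// andbT; apply: sub_all (cells_itv yb) => p /and3P[h1 _ _].
by rewrite /apart h1.
Qed.

Lemma len_cells a b s : itv_partition a b s -> len (cells a s) = b - a.
Proof.
elim: s a => [|y s IH] a abs.
  by rewrite (itv_partition_nil abs) /len big_nil subrr.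
rewrite /len big_cons /= -/(len _) (IH _ (itv_partition_cons abs)); ring.
Qed.

Lemma osc_cells a b s u : itv_partition a b s ->
  variation a b u s = osc u (cells a s).
Proof.
move=> abs; rewrite (variation_zip _ abs).
elim: s a abs => [|y s IH] a abs; rewrite /osc ?big_nil// !big_cons.
by rewrite /= (IH _ (itv_partition_cons abs)).
Qed.

(** The variation of [u] over the intervals of a family cannot exceed the bound
    that holds for all oscillations over families of the same total length,
    because partitioning the intervals does not change their total length. *)
Lemma sum_total_variation_le a b u e d :
  (forall L, nonoverlapping a b L -> len L < d -> osc u L <= e) ->
  forall L1 L2, nonoverlapping a b (L1 ++ L2) -> len (L1 ++ L2) < d ->
  (\sum_(p <- L1) total_variation p.1 p.2 u + (osc u L2)%:E <= e%:E)%E.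
Proof.
move=> H; elim => [|p L1 IH] L2 no lt.
  by rewrite big_nil add0e lee_fin H.
have /andP[/= /andP[/and3P[ap pp pb] aL] /andP[pL pwL]] := no.
have nneg L : all (fun p => [&& a <= p.1, p.1 <= p.2 & p.2 <= b]) L ->
    (0 <= \sum_(p <- L) total_variation p.1 p.2 u)%E.
  move=> /allP aL'; rewrite big_seq sume_ge0// => q qL.
  by apply: total_variation_ge0; have /and3P[] := aL' _ qL.
have aL1 : all (fun p => [&& a <= p.1, p.1 <= p.2 & p.2 <= b]) L1.
  by move: aL; rewrite all_cat => /andP[].
have noL : nonoverlapping a b (L1 ++ L2) by rewrite /nonoverlapping aL pwL.
have ltL : len (L1 ++ L2) < d.
  by apply: le_lt_trans lt; rewrite /len /= big_cons lerDr subr_ge0.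
have L1fin : (\sum_(q <- L1) total_variation q.1 q.2 u)%E \is a fin_num.
  rewrite ge0_fin_numE ?nneg//; apply: (@le_lt_trans _ _ e%:E); last exact: ltry.
  apply: le_trans (IH _ noL ltL); rewrite leeDl// lee_fin.
  by apply: sumr_ge0.
rewrite big_cons -addeA -leeBrDr ?fin_numD ?L1fin//.
apply: ge_ereal_sup => _ [_ [s ps <-] <-].
rewrite leeBrDr ?fin_numD ?L1fin// (osc_cells _ ps) [leLHS]addeC -addeA -EFinD.
have -> : osc u L2 + osc u (cells p.1 s) = osc u (cells p.1 s ++ L2).
  by rewrite /osc big_cat addrC.
have inp q : q \in cells p.1 s -> [&& p.1 <= q.1, q.1 <= q.2 & q.2 <= p.2].
  by move=> qs; have /allP := cells_itv ps; apply.
have sep q r : q \in cells p.1 s -> apart p r -> apart q r.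
  move=> /inp /and3P[h1 h2 h3] /orP[h|h]; rewrite /apart.
    by rewrite (le_trans h3 h).
  by rewrite (le_trans h h1) orbT.
apply: IH.
- move: noL; rewrite !nonoverlapping_cat => /and3P[-> -> rel12] /=.
  rewrite allrel_catr rel12 andbT -andbA; apply/and3P; split.
  + have /andP[no1 no2] := nonoverlapping_cells ps.
    apply/andP; split=> //; apply: sub_all no1 => q /and3P[h1 -> h2].
    by rewrite (le_trans ap h1) (le_trans h2 pb).
  + apply/allrelP => q r qs rL2; apply: sep => //.
    by have /allP := pL; apply; rewrite mem_cat rL2 orbT.
  + apply/allrelP => q r qL1 rs; rewrite apartC; apply: sep => //.
    by have /allP := pL; apply; rewrite mem_cat qL1.
- move: lt; rewrite /len /= big_cons !big_cat /=.
  by rewrite -/(len (cells _ _)) (len_cells ps); lra.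
Qed.

End interval_families.

Section absolute_continuity.
Variable R : realType.
Implicit Types (a b c x y e d : R) (u v : R -> R) (L : seq (R * R)).

Lemma nonoverlapping1 a b x y : a <= x -> x <= y -> y <= b ->
  nonoverlapping a b [:: (x, y)].
Proof. by move=> ax xy yb; rewrite /nonoverlapping /= ax xy yb. Qed.

Lemma abs_cont_list_osc a b u e : abs_cont_list a b u -> 0 < e ->
  exists2 d, 0 < d & forall x y, a <= x -> x <= y -> y <= b -> y - x < d ->
    `|u y - u x| <= e.
Proof.
move=> ac e0; have [d d0 H] := ac e e0; exists d => // x y ax xy yb xyd.
have := H _ (nonoverlapping1 ax xy yb); rewrite /len /osc !big_seq1/=; exact.
Qed.

(** Over an interval shorter than the [d] that belongs to the bound 1, the
    variation is at most 1; finitely many such intervals cover [[a, b]]. *)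
Lemma abs_cont_list_BV a b u : a <= b -> abs_cont_list a b u ->
  total_variation a b u \is a fin_num.
Proof.
move=> ab ac; have [d d0 H] := ac 1 ltr01.
have TV1 x y : a <= x -> x <= y -> y <= b -> y - x < d ->
    (total_variation x y u <= 1)%E.
  move=> ax xy yb xyd.
  have := @sum_total_variation_le _ a b u 1 d H [:: (x, y)] [::].
  rewrite cats0 /len /osc !big_seq1 big_nil adde0; apply => //.
  exact: nonoverlapping1.
have [n nd] : exists n : nat, (b - a) / n.+1%:R < d.
  exists (Num.truncn ((b - a) / d)).
  rewrite ltr_pdivrMr// mulrC -ltr_pdivrMr//.
  have ba0 : 0 <= b - a by rewrite subr_ge0.
  by have /andP[] := truncn_itv (divr_ge0 ba0 (ltW d0)).
pose h := (b - a) / n.+1%:R.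
have h0 : 0 <= h by rewrite divr_ge0 ?subr_ge0.
have bE : b = a + h *+ n.+1 by rewrite -mulr_natr /h divfK ?pnatr_eq0//; ring.
have hd : h < d by [].
move: h h0 bE hd => h h0 bE hd {nd}.
suff P k : (k <= n.+1)%N -> (total_variation a (a + h *+ k) u < +oo)%E.
  by rewrite ge0_fin_numE ?total_variation_ge0// bE P.
elim: k => [_|k IH kn]; first by rewrite mulr0n addr0 total_variationxx.
have kb : a + h *+ k.+1 <= b by rewrite bE lerD2l ler_wpMn2l.
have kk : a + h *+ k <= a + h *+ k.+1 by rewrite lerD2l ler_wpMn2l.
have ak : a <= a + h *+ k by rewrite lerDl mulrn_wge0.
rewrite (@total_variationD _ _ _ (a + h *+ k))// lte_add_pinfty ?IH ?(ltnW kn)//.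
apply: le_lt_trans (ltry 1); apply: TV1 => //.
by rewrite opprD addrACA subrr add0r mulrS addrK.
Qed.

(** The variation function inherits absolute continuity because its oscillation
    over an interval is the variation of [u] there, which [sum_total_variation_le]
    controls. With [TVB_nondecreasing] this yields the Jordan decomposition of
    [u] into nondecreasing absolutely continuous functions. *)
Lemma abs_cont_list_TV a b u : a <= b -> abs_cont_list a b u ->
  abs_cont_list a b (fun x => fine (total_variation a x u)).
Proof.
move=> ab ac e e0; have [d d0 H] := ac e e0; exists d => // L no lt.
have := @sum_total_variation_le _ a b u e d H L [::].
rewrite cats0 /(osc _ [::]) big_nil adde0 => /(_ no lt).
rewrite -[in X in _ -> X]lee_fin; apply: le_trans.
have TVf := abs_cont_list_BV ab ac.
have TVx x y : a <= x -> x <= y -> y <= b -> total_variation x y u \is a fin_num.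
  move=> ax xy yb; apply/(bounded_variationP _ xy).
  apply: (bounded_variationr ax xy); apply: (bounded_variationl _ yb).
    exact: le_trans xy.
  exact/bounded_variationP.
have /andP[/allP aL _] := no.
rewrite /osc -sumEFin big_seq [leRHS]big_seq; apply: lee_sum => p pL.
have /and3P[h1 h2 h3] := aL _ pL.
have f1 := TVx _ _ (lexx a) h1 (le_trans h2 h3).
have f2 := TVx _ _ h1 h2 h3.
rewrite (total_variationD _ h1 h2) fineD// addrC addKr.
by rewrite ger0_norm ?fine_ge0 ?total_variation_ge0// fineK.
Qed.

Lemma abs_cont_listB a b u v : abs_cont_list a b u -> abs_cont_list a b v ->
  abs_cont_list a b (u \- v).
Proof.
move=> au av e e0; have e20 : 0 < e / 2 by lra.
have [d d0 H] := au _ e20; have [d' d0' H'] := av _ e20.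
exists (Num.min d d') => [|L no]; first by rewrite lt_min d0.
rewrite lt_min => /andP[/(H _ no) h /(H' _ no) h'].
have -> : e = e / 2 + e / 2 by lra.
apply: le_trans (lerD h h'); rewrite /osc -big_split /=.
apply: ler_sum => p _ /=; rewrite (_ : _ - _ - _ = u p.2 - u p.1 - (v p.2 - v p.1)); last by ring.
exact: ler_normB.
Qed.

Lemma TVB_nondecreasing a b u : a <= b -> abs_cont_list a b u ->
  {in `[a, b] &, nondecreasing_fun
     (fun x => fine (total_variation a x u) - u x)}.
Proof.
move=> ab ac x y; rewrite !in_itv/= => /andP[ax xb] /andP[ay yb] xy.
have TVf := abs_cont_list_BV ab ac.
have TVx z t : a <= z -> z <= t -> t <= b -> total_variation z t u \is a fin_num.
  move=> az zt tb; apply/(bounded_variationP _ zt).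
  apply: (bounded_variationr az zt); apply: (bounded_variationl _ tb).
    exact: le_trans zt.
  exact/bounded_variationP.
rewrite (total_variationD _ ax xy) fineD ?TVx//.
have := total_variation_ge u xy; rewrite -[total_variation x y u]fineK ?TVx//=.
rewrite lee_fin; have := ler_norm (u y - u x); lra.
Qed.

Lemma TV_nondecreasing a b u : a <= b -> abs_cont_list a b u ->
  {in `[a, b] &, nondecreasing_fun (fun x => fine (total_variation a x u))}.
Proof.
move=> ab ac x y xab yab xy; have := xab; have := yab.
rewrite !in_itv/= => /andP[ay yb] /andP[ax xb].
have TVf := abs_cont_list_BV ab ac.
have BV := (bounded_variationP u ab).2 TVf.
apply: fine_le; last exact: (total_variation_nondecreasing u xab yab).
- by apply/bounded_variationP => //; apply: bounded_variationl BV.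
- by apply/bounded_variationP => //; apply: bounded_variationl BV.
Qed.

End absolute_continuity.

(** * Densities of absolutely continuous functions *)

Section monotone.
Variable R : realType.
Implicit Types (a b c x y e d : R) (u v : R -> R) (L : seq (R * R)).

(** Freezing a function outside of [[a, b]] by precomposition with [clamp] keeps
    monotonicity and continuity, and makes it globally defined. *)
Definition clamp a b x := Num.max a (Num.min x b).

Lemma clamp_itv a b x : a <= b -> a <= clamp a b x <= b.
Proof.
move=> ab; rewrite /clamp; case: (leP x b) => ?;
  [case: (leP a x) => ?|case: (leP a b) => ?]; apply/andP; split; lra.
Qed.

Lemma clamp_id a b x : a <= x <= b -> clamp a b x = x.
Proof. by move=> /andP[? ?]; rewrite /clamp; case: (leP x b) => ?;
  [case: (leP a x) => ?|case: (leP a b) => ?]; lra. Qed.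

Lemma clamp_le a b x y : x <= y -> clamp a b x <= clamp a b y.
Proof.
rewrite /clamp; case: (leP x b) => ?; case: (leP y b) => ?;
  case: (leP a x) => ?; case: (leP a y) => ?; case: (leP a b) => ?; lra.
Qed.

Lemma clampB_le a b x y : a <= b -> x <= y -> clamp a b y - clamp a b x <= y - x.
Proof.
rewrite /clamp; case: (leP x b) => ?; case: (leP y b) => ?;
  case: (leP a x) => ?; case: (leP a y) => ?; case: (leP a b) => ?; lra.
Qed.

Section stieltjes.
Variables (a b : R) (G : R -> R).
Hypotheses (ab : a <= b) (ndG : {in `[a, b] &, nondecreasing_fun G}).
Hypothesis acG : abs_cont_list a b G.

(* The nondecreasing continuous extension of [G] whose Stieltjes measure is taken. *)
Let C x := G (clamp a b x).

Let cin x : clamp a b x \in `[a, b].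
Proof. by rewrite in_itv/=; exact: clamp_itv. Qed.

Let ndC : nondecreasing C.
Proof. by move=> x y xy; apply: ndG => //; exact: clamp_le. Qed.

Let rcC : forall x, C @ at_right x --> C x.
Proof.
move=> x; apply/cvgrPdist_le => e e0.
have [d d0 H] := abs_cont_list_osc acG e0.
near=> y; have xy : x <= y by apply: ltW; near: y; exact: nbhs_right_gt.
rewrite distrC; apply: H.
- by case/andP : (clamp_itv x ab).
- exact: clamp_le.
- by case/andP : (clamp_itv y ab).
- apply: le_lt_trans (clampB_le ab xy) _; rewrite ltrBlDl.
  by near: y; apply: nbhs_right_lt; rewrite ltrDl.
Unshelve. all: by end_near. Qed.

HB.instance Definition _ := isCumulative.Build R _ R C ndC rcC.

Let mu : {measure set (measurableTypeR R) -> \bar R} := lebesgue_stieltjes_measure C.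

Let mu_itv x y : x <= y -> mu `]x, y]%classic = (C y - C x)%:E.
Proof.
move=> xy; rewrite /mu/= /lebesgue_stieltjes_measure /measure_extension.
by rewrite measurable_mu_extE/=; [rewrite wlength_itv_bnd|exact: is_ocitv].
Qed.

Lemma bounded_open_interval (A : set R) : open A -> is_interval A ->
  A `<=` `]a - 1, b + 1[%classic -> A = `]inf A, sup A[%classic.
Proof.
move=> oA iA Aab; rewrite [LHS](_ : A = A°); last exact/esym/interior_id.
apply: interval_bounded_interior => //.
- by exists (a - 1) => x /Aab /=; rewrite in_itv/= => /andP[/ltW].
- by exists (b + 1) => x /Aab /=; rewrite in_itv/= => /andP[_ /ltW].
Qed.

Let apart_of_disjoint (A B : set R) : A !=set0 -> B !=set0 ->
  A = `]inf A, sup A[%classic -> B = `]inf B, sup B[%classic -> A `&` B = set0 ->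
  apart (clamp a b (inf A), clamp a b (sup A)) (clamp a b (inf B), clamp a b (sup B)).
Proof.
move=> [x xA] [y yB] AE BE AB; rewrite /apart/=.
have [|BA] := leP (sup A) (inf B); first by move/(clamp_le a b) => ->.
have [|AB'] := leP (sup B) (inf A); first by move/(clamp_le a b) => ->; rewrite orbT.
move: xA yB; rewrite AE BE/= !in_itv/= => /andP[Ax xA] /andP[By yB].
exfalso; pose z := (Num.max (inf A) (inf B) + Num.min (sup A) (sup B)) / 2.
have : (A `&` B) z.
  split; [rewrite AE|rewrite BE]; rewrite /= in_itv/= /z.
    by case: (leP (inf A) (inf B)) => ?; case: (leP (sup A) (sup B)) => ?; apply/andP; split; lra.
  by case: (leP (inf A) (inf B)) => ?; case: (leP (sup A) (sup B)) => ?; apply/andP; split; lra.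
by rewrite AB.
Qed.

(** A Lebesgue-null set has open neighbourhoods of arbitrarily small length. Such
    a neighbourhood is a disjoint union of intervals, and absolute continuity
    bounds the increments of [G] over finitely many of them, hence the Stieltjes
    measure of the union. *)
Let mu_dominated (N : set (measurableTypeR R)) : measurable N -> N `<=` `]a, b]%classic ->
  lebesgue_measure N = 0%E -> mu N = 0%E.
Proof.
move=> mN Nab N0; apply/eqP; rewrite eq_le measure_ge0 andbT.
apply/lee_addgt0Pr => e e0; rewrite add0e.
have [d d0 H] := acG e0.
have N_lty : (lebesgue_measure N < +oo)%E by rewrite N0 ltry.
have [U [oU NU Ud]] := @lebesgue_regularity_outer R N d mN N_lty d0.
have Nmeas : lebesgue_measure U = lebesgue_measure (U `\` N).
  rewrite -{1}(setDUK NU) measureU//.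
  - by rewrite [X in (X + _)%E](_ : _ = 0%E) ?add0e//; exact: N0.
  - apply: measurableD => //; exact: open_measurable.
  - by rewrite setDE setICA setICr setI0.
pose U' := U `&` `]a - 1, b + 1[%classic.
have oU' : open U' by apply: openI => //; exact: interval_open.
have NU' : N `<=` U'.
  move=> x Nx; split; first exact: NU.
  by have := Nab _ Nx; rewrite /= !in_itv/= => /andP[? ?]; apply/andP; split; lra.
have U'd : (lebesgue_measure U' < d%:E)%E.
  have Ud' : (lebesgue_measure U < d%:E)%E by rewrite Nmeas; exact: Ud.
  apply: le_lt_trans Ud'; apply: le_measure.
  - by rewrite inE; exact: open_measurable.
  - by rewrite inE; exact: open_measurable.
  - by apply: subIsetl.
pose I := open_disjoint_itv oU'.
have oI i : open (I i) by exact: open_disjoint_itv_open.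
have mI i : measurable (I i : set (measurableTypeR R)) by exact: open_measurable.
have tI : trivIset setT I by exact: open_disjoint_itv_trivIset.
have UI : U' = \bigcup_i I i by exact: open_disjoint_itv_bigcup.
have IE i : I i = `]inf (I i), sup (I i)[%classic.
  apply: bounded_open_interval => //; first exact: open_disjoint_itv_is_interval.
  by move=> x Ix; have : U' x by [rewrite UI; exists i]; case.
have isle i : I i !=set0 -> inf (I i) <= sup (I i).
  by case=> x; rewrite {1}IE/= in_itv/= => /andP[h1 h2]; apply: ltW; exact: lt_trans h2.
suff muU' : (mu U' <= e%:E)%E.
  apply: le_trans muU'; apply: le_measure => //; rewrite inE//.
  exact: open_measurable.
rewrite UI measure_bigcup//.
apply: lime_le; first by apply: is_cvg_nneseries_cond => *; exact: measure_ge0.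
apply: nearW => n.
under eq_bigl do rewrite in_setT.
pose L := [seq (clamp a b (inf (I i)), clamp a b (sup (I i))) |
  i <- [seq i <- iota 0 n | I i != set0]].
have bL (F : R * R -> R) : \sum_(p <- L) F p =
   \sum_(i < n | I i != set0) F (clamp a b (inf (I i)), clamp a b (sup (I i))).
  by rewrite /L big_map big_filter -(big_mkord (fun i => I i != set0)
    (fun i => F (clamp a b (inf (I i)), clamp a b (sup (I i))))) /index_iota subn0.
have noL : nonoverlapping a b L.
  apply/andP; split.
    apply/allP => q /mapP[i] + ->/=; rewrite mem_filter => /andP[/set0P Ii _].
    have /andP[-> _] := clamp_itv (inf (I i)) ab.
    have /andP[_ ->] := clamp_itv (sup (I i)) ab.
    by rewrite clamp_le//; exact: isle.
  rewrite /L pairwise_map.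
  apply: (@sub_in_pairwise _ [pred i | I i != set0] (fun i j => i != j)).
  - move=> i j; rewrite !inE => /set0P Ii /set0P Ij ij /=.
    apply: apart_of_disjoint => //.
    by move/trivIsetP : tI; exact.
  - by apply/allP => i; rewrite mem_filter inE => /andP[].
  - by rewrite -uniq_pairwise filter_uniq// iota_uniq.
have lenL : len L < d.
  rewrite /len bL -lte_fin; apply: le_lt_trans U'd.
  rewrite UI measure_bigcup//; apply: le_trans (nneseries_lim_ge n _); last first.
    by move=> *; exact: measure_ge0.
  under [leRHS]eq_bigl do rewrite in_setT.
  rewrite big_mkord -sumEFin big_mkcond /=; apply: lee_sum => i _.
  case: ifPn => [/set0P Ii|_]; last exact: measure_ge0.
  rewrite [in leRHS]IE lebesgue_measure_itv /= lte_fin.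
  case: ifPn => [_|]; first by rewrite -EFinB lee_fin; apply: clampB_le => //; exact: isle.
  have [x] := Ii; rewrite {1}IE/= in_itv/= => /andP[h1 h2]; rewrite ?lte_fin.
  by have := lt_trans h1 h2; rewrite /= => ->.
have := H L noL lenL; rewrite /osc bL -lee_fin; apply: le_trans.
rewrite big_mkord -sumEFin [leRHS]big_mkcond /=; apply: lee_sum => i _.
case: ifPn => [/set0P Ii|]; last by rewrite negbK => /eqP ->; rewrite measure0.
rewrite ger0_norm ?subr_ge0; last by apply: ndC; exact: isle.
rewrite -mu_itv; last exact: isle.
apply: le_measure; rewrite ?inE//.
by rewrite {1}IE; apply: subset_itv_oo_oc.
Qed.

(** Radon-Nikodym derivative of the Stieltjes measure of [G]. *)
Lemma monotone_density : exists2 g : R -> R,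
  lebesgue_measure.-integrable setT (EFin \o g) &
  forall x, x \in `[a, b] -> G x - G a = (\int[lebesgue_measure]_(t in `]a, x]) g t)%R.
Proof.
have mab : measurable (`]a, b]%classic : set (measurableTypeR R)) by [].
have muab : (mu `]a, b]%classic < +oo)%E by rewrite mu_itv ?ltry.
pose nu : {finite_measure set (measurableTypeR R) -> \bar R} := mfrestr mab muab.
have dom : nu `<< (@lebesgue_measure R).
  apply/null_content_dominatesP => A mA A0.
  rewrite /nu/= /mfrestr /mrestr; apply: mu_dominated => //.
  - exact: measurableI.
  - apply/eqP; rewrite eq_le measure_ge0 andbT -A0; apply: le_measure; rewrite ?inE//.
    exact: measurableI.
have [f [f0 ffin fint fE]] := radon_nikodym_sigma_finite dom.
exists (fine \o f).
  by apply: eq_integrable fint => // x _ /=; rewrite fineK.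
move=> x; rewrite in_itv/= => /andP[ax xb].
rewrite /Rintegral; under eq_integral do rewrite /= fineK//.
rewrite -fE// /nu/= /mfrestr /mrestr setIidl; last first.
  by apply: subset_itvl; rewrite bnd_simp.
rewrite mu_itv//= /C !clamp_id ?lexx ?ab ?ax ?xb//.
Qed.

End stieltjes.
End monotone.

Section ae.
Context d (T : measurableType d) (R : realType) (mu : {measure set T -> \bar R}).

Lemma ae_imply (P Q : T -> Prop) : (forall x, P x -> Q x) ->
  {ae mu, forall x, P x} -> {ae mu, forall x, Q x}.
Proof.
move=> PQ [N [mN N0 PN]]; exists N; split => // x /= nQ.
by apply: PN => /= /PQ.
Qed.

Lemma ae_imply2 (P1 P2 Q : T -> Prop) : (forall x, P1 x -> P2 x -> Q x) ->
  {ae mu, forall x, P1 x} -> {ae mu, forall x, P2 x} -> {ae mu, forall x, Q x}.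
Proof.
move=> PQ [N1 [mN1 N10 PN1]] [N2 [mN2 N20 PN2]]; exists (N1 `|` N2); split => //.
- exact: measurableU.
- by apply/eqP; rewrite eq_le measure_ge0 andbT -[leRHS](adde0 0%E) -{1}N10 -N20 measureU2.
- move=> x /= nQ; have [P1x|] := pselect (P1 x); last by move=> nP; left; apply: PN1.
  by right; apply: PN2 => /= P2x; apply: nQ; apply: PQ.
Qed.

End ae.

Section density.
Variable R : realType.
Implicit Types (a b c x y e d : R) (u v f g : R -> R).
Notation leb := (@lebesgue_measure R).

Lemma abs_continuous_local_density a b u : a < b -> abs_continuous a b u ->
  exists2 g : R -> R, leb.-integrable setT (EFin \o g) &
  forall x, a <= x -> x <= b -> u x - u a = \int[leb]_(t in `]a, x]) g t.
Proof.
move=> /ltW ab /abs_continuous_list ac.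
have acV := abs_cont_list_TV ab ac.
have [g1 ig1 g1E] := monotone_density ab (TV_nondecreasing ab ac) acV.
have [g2 ig2 g2E] := monotone_density ab (TVB_nondecreasing ab ac) (abs_cont_listB acV ac).
exists (g1 \- g2); first exact: (integrableB measurableT ig1 ig2).
move=> x ax xb; rewrite RintegralB//=; try exact: integrableS (_ : leb.-integrable setT _).
have xab : x \in `[a, b] by rewrite in_itv/= ax.
by rewrite -g1E// -g2E//; ring.
Qed.

Lemma integrable_locally_integrable g : leb.-integrable setT (EFin \o g) ->
  locally_integrable setT g.
Proof.
move=> ig; have /integrableP[/measurable_EFinP mg _] := ig.
split => //; first exact: openT.
move=> K _ cK; have mK : measurable (K : set (measurableTypeR R)) by exact: compact_measurable.
have /integrableP[_] := integrableS measurableT mK (@subsetT _ K) ig.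
exact.
Qed.

(** Lebesgue's differentiation theorem, in the form of the fundamental theorem of
    calculus. *)
Lemma density_is_derive a b u g : leb.-integrable setT (EFin \o g) ->
  (forall x, a <= x -> x <= b -> u x - u a = \int[leb]_(t in `]a, x]) g t) ->
  {ae leb, forall x, a < x < b -> is_derive x 1 u (g x)}.
Proof.
move=> ig ugE.
have ia y : leb.-integrable [set` Interval (BRight a) (BRight y)] (EFin \o g).
  by apply: integrableS ig.
have := FTC1 ia (integrable_locally_integrable ig).
apply: ae_imply => x /= H /andP[ax xb]; have [|dF F'] := H; first by rewrite ?bnd_simp.
have dF' : is_derive x 1 (fun y => u a + \int[leb]_(t in `]a, y]) g t) (g x).
  rewrite -[g x]add0r -F' derive1E; apply: is_deriveD.
  exact: derivableP.
apply: near_eq_is_derive dF'.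
near=> y; rewrite -ugE//; first by ring.
- by apply: ltW; near: y; exact: lt_nbhsr.
- by apply: ltW; near: y; exact: lt_nbhsl.
Unshelve. all: by end_near. Qed.

Lemma abs_continuous_continuous u x : 0 < x -> AC_loc u -> {for x, continuous u}.
Proof.
move=> x0 ac.
have acx : abs_continuous (x / 2) (x + 1) u by apply: ac; lra.
apply/cvgrPdist_le => e e0.
have [d d0 H] := abs_cont_list_osc (abs_continuous_list acx) e0.
near=> y.
have yl : x / 2 < y by near: y; apply: lt_nbhsr; lra.
have yr : y < x + 1 by near: y; apply: lt_nbhsl; lra.
have yd : `|x - y| < d by near: y; apply/nbhs_ballP; exists d.
have [xy|/ltW yx] := leP y x.
  by apply: H; rewrite ?(ltW yl)//; [lra|rewrite (le_lt_trans _ yd)// ler_norm].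
rewrite distrC; apply: H; rewrite ?(ltW yr)//; first lra.
by rewrite (le_lt_trans _ yd)// distrC ler_norm.
Unshelve. all: by end_near. Qed.

Lemma measurable_AC_loc u : AC_loc u ->
  measurable_fun setT ((u \_ (@halfline R)) : measurableTypeR R -> measurableTypeR R).
Proof.
move=> ac; apply/(measurable_restrictT _ _).1; first exact: measurable_halfline.
apply: open_continuous_measurable_fun; first exact: interval_open.
by move=> x; rewrite inE /halfline/= in_itv/= andbT => x0; exact: abs_continuous_continuous.
Qed.

Definition dquot u (n : nat) x : R := n.+1%:R * (u (x + n.+1%:R^-1) - u x).

Lemma cvg_dquot u x l : is_derive x 1 u l -> dquot u n x @[n --> \oo] --> l.
Proof.
move=> [du <-].
have hn : n.+1%:R^-1 @[n --> \oo] --> (0 : R)^'.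
  move=> A A0; have A0' : nbhs (0 : R) [set y | y != 0 -> A y] by exact: A0.
  have H : \forall n \near \oo, ((harmonic n : R) != 0 -> A (harmonic n)).
    exact: (@cvg_harmonic R _ A0').
  change (\forall n \near \oo, A (n.+1%:R^-1)); apply: filterS H => n /=.
  by apply; rewrite invr_eq0 pnatr_eq0.
have := cvg_comp _ _ hn du.
apply: cvg_trans; apply: near_eq_cvg; near=> n.
rewrite /dquot /= invrK; congr (_ * (u _ - _)).
by rewrite /GRing.scale/= mulr1 addrC.
Unshelve. all: by end_near. Qed.

(** The pointwise derivative is not known to be measurable where it does not
    exist, so the density is taken to be an upper limit of difference quotients,
    which is measurable everywhere and equals the derivative where there is one. *)
Definition limsup_dquot u x : R := fine (limn_esup (fun n => (dquot (u \_ (@halfline R)) n x)%:E)).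

Lemma measurable_limsup_dquot u : AC_loc u ->
  measurable_fun setT (limsup_dquot u : measurableTypeR R -> measurableTypeR R).
Proof.
move=> ac; apply: measurableT_comp => //; apply: measurable_fun_limn_esup => n.
apply/measurable_EFinP; apply: measurable_funM => //.
apply: measurable_funB; last exact: measurable_AC_loc.
by apply: measurableT_comp; [exact: measurable_AC_loc|exact: measurable_funD].
Qed.

Lemma limsup_dquotE u x l : 0 < x -> is_derive x 1 u l -> limsup_dquot u x = l.
Proof.
move=> x0 dul; rewrite /limsup_dquot.
have H : dquot (u \_ (@halfline R)) n x @[n --> \oo] --> l.
  apply: cvg_trans (cvg_dquot dul); apply: near_eq_cvg; near=> n.
  have pos y : 0 < y -> y \in @halfline R.
    by move=> y0; rewrite inE /halfline/= in_itv/= y0.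
  by rewrite /dquot /patch !pos// addr_gt0// invr_gt0.
have /cvg_limn_einf_sup[_ ->] : (fun n => (dquot (u \_ (@halfline R)) n x)%:E) @ \oo --> l%:E.
  by apply/fine_cvgP; split => //; exact: nearW.
by [].
Unshelve. all: by end_near. Qed.

(** [f] is the derivative of [u] on the half-line in the two senses needed: almost
    everywhere, and as a density whose integrals recover [u]. *)
Record density u f : Prop := Density {
  density_measurable : measurable_fun setT (f : measurableTypeR R -> measurableTypeR R) ;
  density_ae : {ae leb, forall x, 0 < x -> is_derive x 1 u (f x)} ;
  density_int : forall a b, 0 < a -> a <= b -> leb.-integrable `[a, b] (EFin \o f) /\
    u b - u a = \int[leb]_(t in `[a, b]) f t }.

(** The densities on the intervals [[1/(n+2), n+2]] are all equal almost everywhere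
    to the same global function, since each is almost everywhere the derivative. *)
Lemma AC_loc_density u : AC_loc u -> density u (limsup_dquot u).
Proof.
move=> ac.
have loc n : exists g : R -> R, leb.-integrable setT (EFin \o g) /\
    forall x, n.+2%:R^-1 <= x -> x <= n.+2%:R ->
      u x - u n.+2%:R^-1 = \int[leb]_(t in `]n.+2%:R^-1, x]) g t.
  have [| |g ig gE] := @abs_continuous_local_density n.+2%:R^-1 n.+2%:R u; last by exists g.
    by rewrite (@lt_trans _ _ 1)// ?ltr1n// invf_lt1// ltr1n.
  apply: ac; first by rewrite invr_gt0.
  by rewrite (@le_trans _ _ 1)// ?ler1n// invf_le1// ler1n.
pose g n := sval (cid (loc n)).
have ig n : leb.-integrable setT (EFin \o g n) by rewrite /g; case: cid => ? [].
have gE n x : n.+2%:R^-1 <= x -> x <= n.+2%:R ->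
    u x - u n.+2%:R^-1 = \int[leb]_(t in `]n.+2%:R^-1, x]) g n t.
  by rewrite /g; case: cid => ? []/= _; exact.
have aeD : {ae leb, forall x, forall n, n.+2%:R^-1 < x < n.+2%:R -> is_derive x 1 u (g n x)}.
  by apply/ae_foralln => n; apply: density_is_derive (ig n) (gE n).
have invS n : (n.+2%:R^-1 : R) <= n.+2%:R.
  by rewrite (@le_trans _ _ 1)// ?ler1n// invf_le1// ler1n.
have big x : 0 < x -> exists n, forall m, (n <= m)%N -> m.+2%:R^-1 < x < m.+2%:R.
  move=> x0; exists (maxn (Num.truncn x) (Num.truncn x^-1)) => m.
  rewrite geq_max => /andP[h1 h2]; apply/andP; split.
    rewrite invf_plt ?posrE//; apply: lt_le_trans (truncnS_gt _) _.
    by rewrite ler_nat ltnS (leq_trans h2).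
  by apply: lt_le_trans (truncnS_gt _) _; rewrite ler_nat ltnS (leq_trans h1).
split; first exact: measurable_limsup_dquot.
- apply: ae_imply aeD => x H x0; have [n /(_ n (leqnn n)) nx] := big x x0.
  by have dx := H n nx; rewrite (limsup_dquotE x0 dx).
- move=> a b a0 ab; have b0 : 0 < b by exact: lt_le_trans ab.
  have [n1 h1] := big a a0; have [n2 h2] := big b b0.
  pose n := maxn n1 n2.
  have /andP[na _] := h1 n (leq_maxl _ _); have /andP[_ bn] := h2 n (leq_maxr _ _).
  have igab : leb.-integrable `[a, b] (EFin \o g n) by exact: integrableS (ig n).
  have mf : measurable_fun setT (EFin \o limsup_dquot u : measurableTypeR R -> \bar R).
    by apply/measurable_EFinP; exact: measurable_limsup_dquot.
  have fg : ae_eq leb `[a, b]%classic (EFin \o g n) (EFin \o limsup_dquot u).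
    apply: ae_imply aeD => x H /=; rewrite in_itv/= => /andP[ax xb].
    have x0 : 0 < x by exact: lt_le_trans ax.
    congr EFin; apply/esym/limsup_dquotE => //; apply: H.
    by rewrite (lt_le_trans na ax) (le_lt_trans xb bn).
  have mg : measurable_fun `[a, b]%classic (EFin \o g n : measurableTypeR R -> \bar R).
    by case/integrableP : igab.
  split.
    apply/integrableP; split; first exact: measurable_funTS.
    rewrite (_ : (\int[leb]_(x in `[a, b]) `|(EFin \o limsup_dquot u) x| =
      \int[leb]_(x in `[a, b]) `|(EFin \o g n) x|)%E); first by have /integrableP[_] := igab.
    apply/esym/ae_eq_integral => //.
    - exact: measurableT_comp.
    - by apply: measurable_funTS; exact: measurableT_comp.
    - exact: ae_eq_abse.
  have -> : \int[leb]_(t in `[a, b]) limsup_dquot u t = \int[leb]_(t in `[a, b]) g n t.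
    by congr fine; apply/esym/ae_eq_integral => //; exact: measurable_funTS.
  have an := ltW na; have nb := ltW bn.
  rewrite -Rintegral_itv_obnd_cbnd; last by exact: integrableS (ig n).
  rewrite -(@Rintegral_itvB _ _ (BRight n.+2%:R^-1) (BRight b) a)//; last first.
    by exact: integrableS (ig n).
  by rewrite -!gE//; [ring|exact: le_trans nb|exact: le_trans ab].
Qed.

End density.

(** * Integrals and L^2 spaces *)

Section integrals.
Context d (T : measurableType d) (R : realType).
Implicit Types mu nu : {measure set T -> \bar R}.

Import HBNNSimple.

Lemma le_integral_off_null mu (N : set T) (f g : T -> \bar R) :
  measurable N -> mu N = 0%E -> (forall x, 0 <= f x)%E -> (forall x, 0 <= g x)%E ->
  (forall x, ~ N x -> f x = g x) -> (\int[mu]_x f x <= \int[mu]_x g x)%E.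
Proof.
move=> mN N0 f0 g0 fg; rewrite ge0_integralTE// [leRHS]ge0_integralTE//.
apply: ge_ereal_sup => _ [h /= hf <-]; apply: ereal_sup_ubound.
exists (proj_nnsfun h (measurableC mN)) => /=.
  move=> x; rewrite mindicE; case: (boolP (x \in ~` N)) => [|_].
    by rewrite inE => Nx; rewrite mulr1 -fg.
  by rewrite mulr0.
rewrite -!integralT_nnsfun; apply: ge0_ae_eq_integral => //.
- by apply/measurable_EFinP; exact: measurable_funPT.
- by apply/measurable_EFinP; exact: measurable_funPT.
- by move=> x _; rewrite lee_fin.
- by move=> x _; rewrite lee_fin.
exists N; split => // x /= /not_implyP[_]; apply: contra_notP => Nx.
by rewrite /= mindicE mem_set// mulr1.
Qed.

(** Serves for the pointwise derivative, which may fail to be measurable. A simple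
    function below [f] may be set to 0 on [N] without changing its integral. *)
Lemma eq_integral_off_null mu (D N : set T) (f g : T -> \bar R) :
  measurable N -> mu N = 0%E -> (forall x, D x -> ~ N x -> f x = g x) ->
  (\int[mu]_(x in D) f x = \int[mu]_(x in D) g x)%E.
Proof.
move=> mN N0 fg.
have fgD x : ~ N x -> (f \_ D) x = (g \_ D) x.
  by move=> Nx; rewrite !patchE; case: ifPn => //; rewrite inE => Dx; rewrite fg.
rewrite integral_mkcond [RHS]integral_mkcond.
rewrite integralE [RHS]integralE; congr (_ - _)%E.
- by apply/eqP; rewrite eq_le; apply/andP; split; apply: (le_integral_off_null mN) => //;
    move=> x Nx; rewrite !funeposE fgD.
- by apply/eqP; rewrite eq_le; apply/andP; split; apply: (le_integral_off_null mN) => //;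
    move=> x Nx; rewrite !funenegE fgD.
Qed.

(** Stated with a map [phi] so that it also compares measures that live on the
    same set with two different measurable structures, as Lebesgue measure and
    the measures [x^2 dx] do; there [phi] is the identity. *)
Lemma ge0_integral_image_density d' (T' : measurableType d') mu
    (nu : {measure set T' -> \bar R}) (phi : T -> T') (rho : T -> R) (f : T' -> \bar R) :
  measurable_fun setT phi -> measurable_fun setT rho -> (forall x, 0 <= rho x) ->
  (forall A, measurable A -> nu A = \int[mu]_(x in phi @^-1` A) (rho x)%:E)%E ->
  measurable_fun setT f -> (forall x, 0 <= f x)%E ->
  (\int[nu]_x f x = \int[mu]_x (f (phi x) * (rho x)%:E))%E.
Proof.
move=> mphi mrho rho0 nuE mf f0; pose h := nnsfun_approx measurableT mf.
have hf x : (h n x)%:E @[n --> \oo] --> f x by exact: cvg_nnsfun_approx.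
have mh n : measurable_fun setT (EFin \o h n).
  by apply/measurable_EFinP; exact: measurable_funPT.
have mhphi n : measurable_fun setT (fun x => (h n (phi x))%:E).
  exact: (measurableT_comp (mh n) mphi).
have mrhoE : measurable_fun setT (EFin \o rho) by exact/measurable_EFinP.
have ndh x : {homo (fun n => (h n x)%:E) : m n / (m <= n)%N >-> (m <= n)%E}.
  by move=> m n mn; rewrite lee_fin; exact/lefP/nd_nnsfun_approx.
have mlevel n y : measurable (phi @^-1` (h n @^-1` [set y])).
  by rewrite -[X in measurable X]setTI; exact: mphi.
have nuh n : (\int[nu]_x (h n x)%:E = \int[mu]_x ((h n (phi x))%:E * (rho x)%:E))%E.
  transitivity (\sum_(y \in range (h n)) (y%:E * \int[mu]_(x in phi @^-1` (h n @^-1` [set y])) (rho x)%:E))%E.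
    rewrite integralT_nnsfun sintegralE; apply: eq_fsbigr => y _.
    by rewrite nuE.
  transitivity (\int[mu]_x \sum_(y \in range (h n)) (y%:E * ((\1_(h n @^-1` [set y]) (phi x))%:E * (rho x)%:E)))%E.
    have mind y : measurable_fun setT (fun x => (\1_(h n @^-1` [set y]) (phi x))%:E : \bar R).
      apply/measurable_EFinP; apply: (measurableT_comp _ mphi).
      exact: measurable_indic.
    rewrite ge0_integral_fsum//.
    - apply: eq_fsbigr => y; rewrite inE => -[t _ <-].
      rewrite ge0_integralZl//.
      + rewrite integral_mkcond; congr (_ * _)%E; apply: eq_integral => x _.
        rewrite patchE indicE; case: ifPn => [/set_mem xh|/negP xh].
          by rewrite mem_set// mul1e.
        by rewrite memNset ?mul0e// => xh'; apply: xh; exact: mem_set.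
      + by apply: emeasurable_funM; [exact: mind|exact: mrhoE].
      + by move=> x _; rewrite mule_ge0 ?lee_fin.
      + by rewrite lee_fin.
    - move=> y; apply: emeasurable_funM => //.
      by apply: emeasurable_funM; [exact: mind|exact: mrhoE].
    - move=> y x _; rewrite muleA mule_ge0 ?lee_fin// -lee_fin.
      exact: nnfun_muleindic_ge0.
  apply: eq_integral => x _; rewrite [in RHS](fimfunE (h n) (phi x)) -fsumEFin//.
  rewrite ge0_mule_fsuml; last by move=> y; exact: nnfun_muleindic_ge0.
  by apply: eq_fsbigr => y _; rewrite EFinM muleA.
have -> : (\int[nu]_x f x = limn (fun n => \int[nu]_x (h n x)%:E))%E.
  under eq_integral => x _ do rewrite -(cvg_lim _ (hf x))//.
  by apply: monotone_convergence => // n x _; rewrite lee_fin.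
have -> : (\int[mu]_x (f (phi x) * (rho x)%:E) =
    limn (fun n => \int[mu]_x ((h n (phi x))%:E * (rho x)%:E)))%E.
  have hr x : ((h n (phi x))%:E * (rho x)%:E)%E @[n --> \oo] --> (f (phi x) * (rho x)%:E)%E.
    by apply: cvgeZr => //; exact: hf.
  under eq_integral => x _ do rewrite -(cvg_lim _ (hr x))//.
  apply: monotone_convergence => //.
  - by move=> n; apply: emeasurable_funM; [exact: mhphi|exact: mrhoE].
  - by move=> n x _; rewrite mule_ge0 ?lee_fin.
  - by move=> x _ m n mn; rewrite lee_wpmul2r ?lee_fin//; exact/lefP/nd_nnsfun_approx.
by under eq_fun do rewrite nuh.
Qed.

End integrals.

Section L2_theory.
Context d (T : measurableType d) (R : realType) (mu : {measure set T -> \bar R}).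
Implicit Types f g h : T -> R.
Local Notation L2 := (L2 mu).
Local Notation L2dot := (L2dot mu).
Local Notation L2norm := (L2norm mu).

Lemma L2_measurable f : L2 f -> measurable_fun setT f.
Proof. by rewrite /Defs.L2/= => /andP[]; rewrite inE. Qed.

Lemma L2P f : L2 f <-> measurable_fun setT f /\ (\int[mu]_x (f x ^+ 2)%:E < +oo)%E.
Proof.
split=> [L2f|[mf foo]].
  split; first exact: L2_measurable.
  by have := @Lfun2_integrable_sqr _ _ _ mu f L2f => /integrableP[_];
    under eq_integral do rewrite /= ger0_norm ?sqr_ge0//.
rewrite /Defs.L2/= inE; apply/andP; split; first by rewrite inE.
rewrite inE/= /finite_norm unlock /Lnorm.
apply: poweR_lty; under eq_integral => x _ do rewrite /= powR_mulrn// real_normK ?num_real//.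
exact: foo.
Qed.

Lemma L2_0 : L2 0.
Proof.
apply/L2P; split; first exact: measurable_cst.
by under eq_integral do rewrite /= expr0n/=; rewrite integral0.
Qed.

Lemma L2_lin (c : R) f g : L2 f -> L2 g -> L2 (c *: f + g).
Proof.
move=> fL gL; have [_] := @Lfun_submod_closed _ _ _ mu 2%:E (lee1n 2).
exact.
Qed.

Lemma L2_Z c f : L2 f -> L2 (c *: f).
Proof. by move=> fL; rewrite -[_ *: _]addr0; apply: L2_lin => //; exact: L2_0. Qed.

Lemma L2_D f g : L2 f -> L2 g -> L2 (f + g).
Proof. by move=> fL gL; rewrite -[f]scale1r; exact: L2_lin. Qed.

Lemma L2_B f g : L2 f -> L2 g -> L2 (f - g).
Proof. by move=> fL gL; rewrite addrC -scaleN1r; exact: L2_lin. Qed.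

Lemma L2_le f g : measurable_fun setT f -> L2 g -> (forall x, `|f x| <= `|g x|) -> L2 f.
Proof.
move=> mf /L2P[mg goo] fg; apply/L2P; split => //.
apply: le_lt_trans goo; apply: ge0_le_integral => //.
- by move=> x _; rewrite lee_fin sqr_ge0.
- by apply/measurable_EFinP; exact: measurable_funX.
- by apply/measurable_EFinP; exact: measurable_funX.
- move=> x _; rewrite lee_fin -[f x ^+ 2]real_normK ?num_real//.
  by rewrite -[g x ^+ 2]real_normK ?num_real// ler_sqr ?nnegrE.
Qed.

Lemma L2_indic f (A : set T) : measurable A -> L2 f -> L2 (\1_A * f).
Proof.
move=> mA fL; apply: L2_le (fL) _; first by apply: measurable_funM => //; exact: L2_measurable.
move=> x; rewrite [(_ * _) x]/(\1_A x * f x) indicE normrM.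
by case: (x \in A); rewrite ?normr1 ?mul1r ?normr0 ?mul0r.
Qed.

Lemma L2_integrableM f g : L2 f -> L2 g -> mu.-integrable setT (EFin \o (f \* g)).
Proof. by move=> fL gL; apply/Lfun1_integrable; exact: Lfun2_mul_Lfun1. Qed.

Lemma L2dotC f g : L2dot f g = L2dot g f.
Proof. by rewrite /Defs.L2dot; under eq_Rintegral do rewrite mulrC. Qed.

Lemma L2dotDl f g h : L2 f -> L2 g -> L2 h -> L2dot (f + g) h = L2dot f h + L2dot g h.
Proof.
move=> fL gL hL; rewrite /Defs.L2dot -RintegralD//; last 2 first.
  exact: L2_integrableM.
  exact: L2_integrableM.
by apply: eq_Rintegral => x _; rewrite -mulrDl.
Qed.

Lemma L2dotZl c f g : L2 f -> L2 g -> L2dot (c *: f) g = c * L2dot f g.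
Proof.
move=> fL gL; rewrite /Defs.L2dot -RintegralZl//; last exact: L2_integrableM.
by apply: eq_Rintegral => x _; rewrite mulrA.
Qed.

Lemma L2dotBl f g h : L2 f -> L2 g -> L2 h -> L2dot (f - g) h = L2dot f h - L2dot g h.
Proof.
move=> fL gL hL; rewrite -scaleN1r L2dotDl ?L2dotZl ?mulN1r//.
exact: L2_Z.
Qed.

Lemma L2dotDr f g h : L2 f -> L2 g -> L2 h -> L2dot h (f + g) = L2dot h f + L2dot h g.
Proof. by move=> *; rewrite L2dotC L2dotDl// L2dotC (L2dotC g). Qed.

Lemma L2dotBr f g h : L2 f -> L2 g -> L2 h -> L2dot h (f - g) = L2dot h f - L2dot h g.
Proof. by move=> *; rewrite L2dotC L2dotBl// L2dotC (L2dotC g). Qed.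

Lemma L2dotZr c f g : L2 f -> L2 g -> L2dot f (c *: g) = c * L2dot f g.
Proof. by move=> *; rewrite L2dotC L2dotZl// L2dotC. Qed.

Lemma L2dot_ge0 f : 0 <= L2dot f f.
Proof. by apply: Rintegral_ge0 => x _; rewrite -expr2 sqr_ge0. Qed.

(** Cauchy-Schwarz, from the nonnegativity of the quadratic polynomial
    [t |-> |f - t g|^2]. *)
Lemma L2dot_CS f g : L2 f -> L2 g -> L2dot f g ^+ 2 <= L2dot f f * L2dot g g.
Proof.
move=> fL gL.
have P (t : R) : 0 <= L2dot f f - 2 * t * L2dot f g + t ^+ 2 * L2dot g g.
  have := L2dot_ge0 (f - t *: g); have gt := L2_Z t gL.
  rewrite (L2dotBl fL gt (L2_B fL gt)) (L2dotBr fL gt fL) (L2dotBr fL gt gt).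
  rewrite (L2dotZl t gL fL) (L2dotZr t fL gL) (L2dotZl t gL gt) (L2dotZr t gL gL).
  by rewrite (L2dotC g f); congr (_ <= _); ring.
have := L2dot_ge0 g; rewrite le_eqVlt => /predU1P[g0|g0].
  have [->|fg0] := eqVneq (L2dot f g) 0; first by rewrite expr0n/= -g0 mulr0.
  have := P ((L2dot f f + 1) / (2 * L2dot f g)); rewrite -g0 mulr0 addr0.
  rewrite (_ : 2 * _ * _ = L2dot f f + 1); first lra.
  by field.
have := P (L2dot f g / L2dot g g).
rewrite (_ : _ - _ + _ = L2dot f f - L2dot f g ^+ 2 / L2dot g g); last first.
  by field; rewrite gt_eqF.
by rewrite subr_ge0 ler_pdivrMr.
Qed.

Lemma L2dot_sqrE f : L2 f -> (\int[mu]_x (f x ^+ 2)%:E = (L2dot f f)%:E)%E.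
Proof.
move=> /L2P[mf foo]; rewrite /Defs.L2dot /Rintegral fineK.
  by under [RHS]eq_integral do rewrite -expr2.
rewrite ge0_fin_numE; first by under eq_integral do rewrite -expr2.
by apply: integral_ge0 => x _; rewrite lee_fin -expr2 sqr_ge0.
Qed.

Lemma L2normE f : L2 f -> L2norm f = (Num.sqrt (L2dot f f))%:E.
Proof.
move=> fL; rewrite /Defs.L2norm unlock /Lnorm.
under eq_integral => x _ do rewrite /= powR_mulrn// real_normK ?num_real//.
by rewrite L2dot_sqrE// poweR_EFin powR12_sqrt// L2dot_ge0.
Qed.

Lemma strong_cvgP (f_ : nat -> T -> R) f : (forall n, L2 (f_ n)) -> L2 f ->
  strong_cvg mu f_ f <-> (L2dot (f_ n - f) (f_ n - f) @[n --> \oo] --> (0 : R)).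
Proof.
move=> fnL fL; rewrite /strong_cvg.
have -> : (fun n => L2norm (f_ n - f)) =
    (fun n => (Num.sqrt (L2dot (f_ n - f) (f_ n - f)))%:E).
  by apply/funext => n; rewrite L2normE//; exact: L2_B.
split=> [/fine_cvgP[_ H]|H].
  rewrite [X in X @ _](_ : _ = (fun n => Num.sqrt (L2dot (f_ n - f) (f_ n - f))) \*
      (fun n => Num.sqrt (L2dot (f_ n - f) (f_ n - f)))).
    by rewrite -[X in _ --> X](mulr0 0); exact: cvgM.
  by apply/funext => n /=; rewrite -expr2 sqr_sqrtr// L2dot_ge0.
apply/fine_cvgP; split; first exact: nearW.
rewrite -[X in _ --> X](@sqrtr0 R).
apply: (@cvg_comp _ _ _ _ (@Num.sqrt R)); first exact: H.
exact: sqrt_continuous.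
Qed.

Lemma L2dot_cvg (f_ : nat -> T -> R) f g : (forall n, L2 (f_ n)) -> L2 f -> L2 g ->
  strong_cvg mu f_ f -> L2dot (f_ n) g @[n --> \oo] --> L2dot f g.
Proof.
move=> fnL fL gL /(strong_cvgP fnL fL) H.
apply/cvgrPdist_lt => e e0.
have g0 := L2dot_ge0 g.
have e1 : 0 < e ^+ 2 / (L2dot g g + 1) by rewrite divr_gt0// ?exprn_gt0// ltr_wpDl.
have := H; move/cvgrPdist_lt => /(_ _ e1); apply: filterS => n.
rewrite sub0r normrN ger0_norm ?L2dot_ge0// => Hn.
rewrite distrC -L2dotBl//.
rewrite -ltr_sqr ?nnegrE ?(ltW e0)// real_normK ?num_real//.
apply: le_lt_trans (L2dot_CS (L2_B (fnL n) fL) gL) _.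
move: Hn; rewrite ltr_pdivlMr ?ltr_wpDl//; have := L2dot_ge0 (f_ n - f); nra.
Qed.

End L2_theory.

(** * The Bessel form *)

Section bessel_space.
Variable R : realType.
Implicit Types (a b c x y e d l : R) (u v f g : R -> R).
Notation leb := (@lebesgue_measure R).
Notation I := (@halfline R).
Notation BR := (measurableTypeR R).

Lemma halflineE x : (x \in I) = (0 < x).
Proof. by apply/idP/idP; rewrite inE /halfline/= in_itv/= andbT. Qed.

(** Multiplication by [x] maps the space [L^2(x^2 dx)] on the half-line
    isometrically into [L^2(dx)]. It turns both the energy and the [bessel_m]
    inner product into Lebesgue inner products. *)
Definition xmul f : R -> R := (fun x => x * f x) \_ I.

Lemma xmul_gt0 f x : 0 < x -> xmul f x = x * f x.
Proof. by move=> x0; rewrite /xmul patchE halflineE x0. Qed.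

Lemma xmul_le0 f x : x <= 0 -> xmul f x = 0.
Proof. by move=> x0; rewrite /xmul patchE halflineE ltNge x0. Qed.

Lemma xmul_lin c f g : xmul (c *: f + g) = c *: xmul f + xmul g.
Proof.
apply/funext => x; have [x0|x0] := ltP 0 x.
  rewrite [RHS]/(c * xmul f x + xmul g x) !xmul_gt0//.
  by change (x * (c * f x + g x) = c * (x * f x) + x * g x); ring.
change (xmul (c *: f + g) x = c * xmul f x + xmul g x).
by rewrite !xmul_le0// mulr0 addr0.
Qed.

Lemma xmulE f : xmul f = (fun x => x * (f \_ I) x).
Proof. by apply/funext => x; rewrite /xmul !patchE; case: ifPn; rewrite ?mulr0. Qed.

Lemma measurable_xmul f : measurable_fun setT (f \_ I : BR -> BR) ->
  measurable_fun setT (xmul f : BR -> BR).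
Proof. by move=> mf; rewrite xmulE; apply: measurable_funM. Qed.

Lemma measurable_restrict_halfline f : measurable_fun setT (f : BR -> BR) ->
  measurable_fun setT (f \_ I : BR -> BR).
Proof.
move=> mf; apply/(measurable_restrictT _ _).1; first exact: measurable_halfline.
exact: measurable_funTS.
Qed.

Lemma ge0_integral_lebesgue_density (nu : {measure set R -> \bar R}) (rho f : R -> R) :
  measurable_fun setT rho -> (forall x, 0 <= rho x) ->
  (forall A : set R, measurable A -> nu A = \int[leb]_(x in A) (rho x)%:E)%E ->
  measurable_fun setT f -> (forall x, 0 <= f x) ->
  (\int[nu]_x (f x)%:E = \int[leb]_x (f x * rho x)%:E)%E.
Proof.
move=> mrho rho0 nuE mf f0.
rewrite (@ge0_integral_image_density _ BR R _ R leb nu idfun rho)//.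
- exact: measurable_id.
- exact/measurable_EFinP.
Qed.

Lemma ge0_integral_bessel_m (f : R -> R) : measurable_fun setT (f : BR -> BR) ->
  (forall x, 0 <= f x) ->
  (\int[bessel_m R]_x (f x)%:E = \int[leb]_x (2 * (x ^+ 2 * \1_I x * f x))%:E)%E.
Proof.
move=> mf f0.
rewrite (@ge0_integral_lebesgue_density _ (fun x => 2 * (x ^+ 2 * \1_I x)))//.
- by apply: eq_integral => x _; congr EFin; ring.
- apply: measurable_funM => //; apply: measurable_funM; first exact: exprn_measurable.
  by apply: measurable_indic; exact: measurable_halfline.
- by move=> x; rewrite mulr_ge0// mulr_ge0 ?sqr_ge0// indicE ler0n.
- move=> A mA; rewrite /bessel_m/= /mscale/= /mrestr /sqr_measure.
  rewrite integral_mkcondr -ge0_integralZl//=.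
  + apply: eq_integral => x _; rewrite patchE indicE; case: ifPn => _.
      by rewrite mulr1 EFinM.
    by rewrite !mulr0 mule0.
  + apply/measurable_restrict => //; first exact: measurable_halfline.
    by apply: measurable_funTS; apply/measurable_EFinP; exact: exprn_measurable.
  + by move=> x _; rewrite patchE; case: ifPn => // _; rewrite lee_fin sqr_ge0.
Qed.

Lemma L2_bessel_m u : L2 (bessel_m R) (u \_ I) -> L2 leb (xmul u).
Proof.
move=> /L2P[mu foo]; apply/L2P; split; first exact: measurable_xmul.
move: foo; rewrite ge0_integral_bessel_m; first last.
- by move=> x; exact: sqr_ge0.
- exact: measurable_funX.
apply: le_lt_trans; apply: ge0_le_integral => //.
- by move=> x _; rewrite lee_fin sqr_ge0.
- by apply/measurable_EFinP; apply: measurable_funX; exact: measurable_xmul.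
- apply/measurable_EFinP; apply: measurable_funM => //; apply: measurable_funM; last exact: measurable_funX.
  apply: measurable_funM; first exact: exprn_measurable.
  by apply: measurable_indic; exact: measurable_halfline.
- move=> x _; rewrite lee_fin /xmul !patchE indicE; case: ifPn => _.
    by have := mulr_ge0 (sqr_ge0 x) (sqr_ge0 (u x)); rewrite exprMn mulr1; lra.
  by rewrite expr0n/= !mulr0.
Qed.

Lemma bessel_m_L2 u : measurable_fun setT (u \_ I : BR -> BR) ->
  L2 leb (xmul u) -> L2 (bessel_m R) (u \_ I).
Proof.
move=> mu xL; apply/L2P; split => //.
rewrite ge0_integral_bessel_m; first last.
- by move=> x; exact: sqr_ge0.
- exact: measurable_funX.
have := L2_Z (Num.sqrt 2) xL => /L2P[_]; apply: le_lt_trans.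
rewrite le_eqVlt; apply/orP; left; apply/eqP; apply: eq_integral => x _; congr EFin.
rewrite [X in _ = X ^+ 2]/(Num.sqrt 2 * xmul u x) exprMn sqr_sqrtr//.
rewrite /xmul !patchE indicE; case: ifPn => _; first by rewrite exprMn mulr1.
by rewrite expr0n/= !mulr0.
Qed.

Lemma integral_bessel_m u v : L2 (bessel_m R) (u \_ I) -> L2 (bessel_m R) (v \_ I) ->
  \int[bessel_m R]_(x in I) (u x * v x) = 2 * L2dot leb (xmul u) (xmul v).
Proof.
move=> uL vL.
have -> : \int[bessel_m R]_(x in I) (u x * v x) = L2dot (bessel_m R) (u \_ I) (v \_ I).
  rewrite Rintegral_mkcond; apply: eq_Rintegral => x _.
  by rewrite !patchE; case: ifPn => _ //; rewrite mulr0.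
have sq w : L2 (bessel_m R) (w \_ I) ->
    L2dot (bessel_m R) (w \_ I) (w \_ I) = 2 * L2dot leb (xmul w) (xmul w).
  move=> wL; have xwL := L2_bessel_m wL.
  apply: EFin_inj; rewrite -L2dot_sqrE// EFinM -L2dot_sqrE// -ge0_integralZl//=; last 2 first.
  - by apply/measurable_EFinP; apply: measurable_funX; exact: L2_measurable xwL.
  - by move=> x _; rewrite lee_fin sqr_ge0.
  rewrite ge0_integral_bessel_m; first last.
  - by move=> x; exact: sqr_ge0.
  - by apply: measurable_funX; exact: L2_measurable wL.
  apply: eq_integral => x _; rewrite -EFinM; congr EFin; congr (_ * _).
  rewrite /xmul !patchE indicE; case: ifPn => _; first by rewrite exprMn mulr1.
  by rewrite expr0n/= !mulr0.
have xuL := L2_bessel_m uL; have xvL := L2_bessel_m vL.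
have uvE : (u + v) \_ I = u \_ I + v \_ I.
  apply/funext => x; rewrite [RHS]/((u \_ I) x + (v \_ I) x) !patchE.
  by case: ifPn => _; [|exact/esym/addr0].
have uvL : L2 (bessel_m R) ((u + v) \_ I) by rewrite uvE; exact: L2_D.
have := sq _ uvL; have := sq _ uL; have := sq _ vL.
have -> : xmul (u + v) = xmul u + xmul v by rewrite -[u in LHS]scale1r xmul_lin scale1r.
rewrite uvE (L2dotDl uL vL (L2_D uL vL)) (L2dotDr uL vL uL) (L2dotDr uL vL vL).
rewrite (L2dotDl xuL xvL (L2_D xuL xvL)) (L2dotDr xuL xvL xuL) (L2dotDr xuL xvL xvL).
rewrite (L2dotC _ (v \_ I) (u \_ I)) (L2dotC leb (xmul v) (xmul u)); lra.
Qed.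

End bessel_space.

Section bessel_domain.
Variable R : realType.
Implicit Types (a b c x y e d l : R) (u v w f g : R -> R).
Notation leb := (@lebesgue_measure R).
Notation I := (@halfline R).
Notation BR := (measurableTypeR R).

Lemma xmulM_restrict f g x : xmul f x * xmul g x = ((fun t => f t * g t * t ^+ 2) \_ I) x.
Proof. by rewrite /xmul !patchE; case: ifPn => _; [ring|exact: mulr0]. Qed.

(** The form is defined by the pointwise derivative, which may fail to be
    measurable on a null set; [eq_integral_off_null] replaces it by a density. *)
Lemma besselE u v f g : density u f -> density v g ->
  bessel u v = L2dot leb (xmul f) (xmul g).
Proof.
move=> [_ [N [mN N0 uN]] _] [_ [M [mM M0 vM]] _].
rewrite /bessel /L2dot; under [RHS]eq_Rintegral do rewrite xmulM_restrict.
rewrite -Rintegral_mkcond; congr fine.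
apply: (@eq_integral_off_null _ _ _ _ _ (N `|` M)).
- exact: measurableU.
- by apply/eqP; rewrite eq_le measure_ge0 andbT -[leRHS](adde0 0%E) -{1}N0 -M0 measureU2.
- move=> x; rewrite /halfline/= in_itv/= andbT => x0 NM; congr EFin.
  have [|uN'] := pselect (is_derive x 1 u (f x)); last first.
    by exfalso; apply: NM; left; apply: uN => /= /(_ x0).
  have [|vM'] := pselect (is_derive x 1 v (g x)); last first.
    by move=> _; exfalso; apply: NM; right; apply: vM => /= /(_ x0).
  by move=> [_ vg] [_ uf]; rewrite !derive1E vg uf.
Qed.

Lemma energyE u f : density u f ->
  (\int[leb]_(x in I) (u^`()%classic x ^+ 2 * x ^+ 2)%:E =
   \int[leb]_x (xmul f x ^+ 2)%:E)%E.
Proof.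
move=> [_ [N [mN N0 uN]] _].
under [RHS]eq_integral do rewrite expr2 xmulM_restrict.
rewrite [RHS](_ : _ = \int[leb]_x ((EFin \o (fun t => (f t * f t * t ^+ 2)%R)) \_ I) x)%E; last first.
  by apply: eq_integral => x _; rewrite !patchE /=; case: ifPn.
rewrite -integral_mkcond; apply: (@eq_integral_off_null _ _ _ _ _ N) => //.
move=> x; rewrite /halfline/= in_itv/= andbT => x0 NM; congr EFin.
have [|uN'] := pselect (is_derive x 1 u (f x)); last first.
  by exfalso; apply: NM; apply: uN => /= /(_ x0).
by move=> [_ uf]; rewrite derive1E uf expr2.
Qed.

Lemma density_lin c u v f g : density u f -> density v g ->
  density (c *: u + v) (c *: f + g).
Proof.
move=> [mf uf fi] [mg vg gi]; split.
- by apply: measurable_funD => //; exact: measurable_funM.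
- apply: ae_imply2 uf vg => x uf vg x0.
  exact: is_deriveD (is_deriveZ c (uf x0)) (vg x0).
- move=> a b a0 ab; have [if_ uE] := fi a b a0 ab; have [ig vE] := gi a b a0 ab.
  have icf : leb.-integrable `[a, b] (EFin \o (c *: f)).
    exact: (integrableZl _ _ if_).
  split; first exact: (integrableD _ icf ig).
  change (c * u b + v b - (c * u a + v a) =
    \int[leb]_(t in `[a, b]) (c * f t + g t)).
  rewrite RintegralD// RintegralZl// -uE -vE; ring.
Qed.

Lemma AC_loc_lin c u v : AC_loc u -> AC_loc v -> AC_loc (c *: u + v).
Proof.
move=> uac vac a b a0 ab e e0.
have c1 : 0 < `|c| + 1 by rewrite ltr_wpDl.
have e1 : 0 < e / 2 / (`|c| + 1) by rewrite divr_gt0// divr_gt0.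
have [d d0 H] := uac a b a0 ab _ e1.
have e2 : 0 < e / 2 by lra.
have [d' d0' H'] := vac a b a0 ab _ e2.
exists (Num.min d d') => [|n s t st dis]; first by rewrite lt_min d0.
rewrite lt_min => /andP[/(H n s t st dis) h /(H' n s t st dis) h'].
apply: (@le_lt_trans _ _ (`|c| * \sum_(i < n) `|u (t i) - u (s i)| +
    \sum_(i < n) `|v (t i) - v (s i)|)).
  rewrite mulr_sumr -big_split/=; apply: ler_sum => i _.
  rewrite -normrM; apply: le_trans (ler_normD _ _).
  rewrite le_eqVlt; apply/orP; left; apply/eqP; congr `|_|.
  by change (c * u (t i) + v (t i) - (c * u (s i) + v (s i)) =
    c * (u (t i) - u (s i)) + (v (t i) - v (s i))); ring.
have -> : e = e / 2 + e / 2 by lra.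
rewrite ler_ltD//; move: h; rewrite ltr_pdivlMr// => /ltW; apply: le_trans.
by rewrite mulrC ler_wpM2l ?sumr_ge0// lerDl.
Qed.

Definition bessel_density u f := [/\ density u f, L2 leb (xmul u) & L2 leb (xmul f)].

Lemma bessel_dom_density u : bessel_dom u -> bessel_density u (limsup_dquot u).
Proof.
move=> [ac uL en]; have dens := AC_loc_density ac; split => //.
  exact: L2_bessel_m.
apply/L2P; split; last by rewrite -(energyE dens).
by apply: measurable_xmul; apply: measurable_restrict_halfline; case: dens.
Qed.

Lemma bessel_density_dom u f : AC_loc u -> bessel_density u f -> bessel_dom u.
Proof.
move=> ac [df uL fL]; split => //.
  by apply: bessel_m_L2 uL; exact: measurable_AC_loc.
by rewrite (energyE df); case/L2P : fL.
Qed.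

Lemma bessel_dom_lin c u v : bessel_dom u -> bessel_dom v -> bessel_dom (c *: u + v).
Proof.
move=> uD vD; have [du xu fu] := bessel_dom_density uD.
have [dv xv fv] := bessel_dom_density vD.
apply: (@bessel_density_dom _ (c *: limsup_dquot u + limsup_dquot v)).
  by apply: AC_loc_lin; [case: uD|case: vD].
by split; [exact: density_lin|rewrite xmul_lin; exact: L2_lin|rewrite xmul_lin; exact: L2_lin].
Qed.

Lemma bessel_domZ c u : bessel_dom u -> bessel_dom (c *: u).
Proof.
move=> uD; have -> : c *: u = (c - 1) *: u + u by rewrite scalerBl scale1r subrK.
exact: bessel_dom_lin.
Qed.

Lemma bessel_domB u v : bessel_dom u -> bessel_dom v -> bessel_dom (u - v).
Proof. by move=> uD vD; rewrite addrC -scaleN1r; exact: bessel_dom_lin. Qed.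

Lemma bessel_lambdaE l u v : bessel_dom u -> bessel_dom v ->
  bessel_lambda l u v = L2dot leb (xmul (limsup_dquot u)) (xmul (limsup_dquot v)) +
    2 * l * L2dot leb (xmul u) (xmul v).
Proof.
move=> uD vD; have [du _ _] := bessel_dom_density uD.
have [dv _ _] := bessel_dom_density vD.
rewrite /bessel_lambda (besselE du dv); have [_ uL _] := uD; have [_ vL _] := vD.
by rewrite (integral_bessel_m uL vL); ring.
Qed.

Lemma bessel_lambdaC l u v : bessel_dom u -> bessel_dom v ->
  bessel_lambda l u v = bessel_lambda l v u.
Proof.
move=> uD vD; rewrite !bessel_lambdaE// (L2dotC leb).
by rewrite (L2dotC leb (xmul u)).
Qed.

Lemma bessel_lambda_linl l c u v w : bessel_dom u -> bessel_dom v -> bessel_dom w ->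
  bessel_lambda l (c *: u + v) w = c * bessel_lambda l u w + bessel_lambda l v w.
Proof.
move=> uD vD wD; rewrite (bessel_lambdaE _ uD wD) (bessel_lambdaE _ vD wD).
have [du xu fu] := bessel_dom_density uD.
have [dv xv fv] := bessel_dom_density vD.
have [dw xw fw] := bessel_dom_density wD.
have sD := bessel_dom_lin c uD vD; have [_ sL _] := sD; have [_ wL _] := wD.
rewrite /bessel_lambda (besselE (density_lin c du dv) dw).
rewrite (integral_bessel_m sL wL) !xmul_lin.
rewrite (L2dotDl (L2_Z c fu) fv fw) (L2dotZl c fu fw).
rewrite (L2dotDl (L2_Z c xu) xv xw) (L2dotZl c xu xw).
move: (L2dot leb (xmul (limsup_dquot u)) _) (L2dot leb (xmul (limsup_dquot v)) _).
move: (L2dot leb (xmul u) _) (L2dot leb (xmul v) _) => C D A B.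
ring.
Qed.

Lemma bessel_lambda_linr l c u v w : bessel_dom u -> bessel_dom v -> bessel_dom w ->
  bessel_lambda l w (c *: u + v) = c * bessel_lambda l w u + bessel_lambda l w v.
Proof.
move=> uD vD wD; rewrite (bessel_lambdaC l wD (bessel_dom_lin c uD vD)).
by rewrite (bessel_lambda_linl l c uD vD wD) (bessel_lambdaC l uD wD) (bessel_lambdaC l vD wD).
Qed.

Lemma bessel_lambdaZl l c u w : bessel_dom u -> bessel_dom w ->
  bessel_lambda l (c *: u) w = c * bessel_lambda l u w.
Proof.
move=> uD wD; have -> : c *: u = (c - 1) *: u + u by rewrite scalerBl scale1r subrK.
by rewrite (bessel_lambda_linl l (c - 1) uD uD wD) mulrBl mul1r subrK.
Qed.

Lemma bessel_lambdaBl l u v w : bessel_dom u -> bessel_dom v -> bessel_dom w ->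
  bessel_lambda l (u - v) w = bessel_lambda l u w - bessel_lambda l v w.
Proof.
move=> uD vD wD; rewrite addrC -scaleN1r (bessel_lambda_linl l _ vD uD wD).
by rewrite mulN1r addrC.
Qed.

Lemma bessel_ge0 u : bessel_dom u -> 0 <= bessel u u.
Proof.
by move=> uD; have [du _ _] := bessel_dom_density uD; rewrite (besselE du du) L2dot_ge0.
Qed.

Lemma bessel_le_lambda l u : 0 <= l -> bessel_dom u -> bessel u u <= bessel_lambda l u u.
Proof.
move=> l0 [_ uL _]; rewrite /bessel_lambda lerDl mulr_ge0//.
by rewrite (integral_bessel_m uL uL) mulr_ge0// L2dot_ge0.
Qed.

Lemma bessel_lambda_ge0 l u : 0 <= l -> bessel_dom u -> 0 <= bessel_lambda l u u.
Proof. by move=> l0 uD; apply: le_trans (bessel_le_lambda l0 uD); exact: bessel_ge0. Qed.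

End bessel_domain.

Section pointwise.
Variable R : realType.
Implicit Types (a b c x y e d l : R) (u v w f g : R -> R).
Notation leb := (@lebesgue_measure R).

Lemma integral_inv_sqr x y : 0 < x -> x <= y ->
  (\int[leb]_(t in `[x, y]) (t ^- 2)%:E = (x^-1 - y^-1)%:E)%E.
Proof.
move=> x0; rewrite le_eqVlt => /predU1P[<-|xy].
  by rewrite set_itv1 integral_set1 subrr.
have der (t : R) : 0 < t -> is_derive t 1 (fun s : R => - s^-1) (t ^- 2).
  move=> t0; have t0' : t != 0 by rewrite gt_eqF.
  have := is_deriveV t0' (is_derive_id t (1 : R)).
  move/is_deriveN; rewrite -scaleNr opprK /GRing.scale/= mulr1; exact.
rewrite (@continuous_FTC2 _ _ (fun s => - s^-1)) => //.
- by rewrite -EFinB; congr EFin; ring.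
- apply: continuous_in_subspaceT => t; rewrite inE/= in_itv/= => /andP[xt _].
  have t0 : t ^+ 2 != 0 by rewrite expf_eq0/= gt_eqF// (lt_le_trans x0).
  by apply: cvgV => //; exact: exprn_continuous.
- have cont (t : R) : 0 < t -> {for t, continuous (fun s : R => - s^-1)}.
    by move=> /der[/derivable1_diffP/differentiable_continuous].
  split.
  + move=> t; rewrite in_itv/= => /andP[xt _].
    by have [] := der t (lt_trans x0 xt).
  + by apply: cvg_at_right_filter; exact: cont.
  + by apply: cvg_at_left_filter; apply: cont; exact: lt_trans xy.
- move=> t; rewrite in_itv/= => /andP[xt _].
  by have [_ <-] := der t (lt_trans x0 xt); rewrite derive1E.
Qed.

(** The increment is the inner product of [t u'(t)] with the function [1/t] on
    [[x, y]], whose square norm is [1/x - 1/y]. *)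
Lemma bessel_holder u x y : bessel_dom u -> 0 < x -> x <= y ->
  (u y - u x) ^+ 2 <= bessel u u * (x^-1 - y^-1).
Proof.
move=> uD x0 xy; have [du xu fu] := bessel_dom_density uD.
set f := limsup_dquot u in du fu.
pose k : R -> R := (fun t => t^-1) \_ `[x, y].
have kE t : k t ^+ 2 = ((fun t => t ^- 2) \_ `[x, y]) t.
  by rewrite /k !patchE; case: ifPn => _; rewrite ?exprVn// /point/= expr0n.
have kint : (\int[leb]_t (k t ^+ 2)%:E = (x^-1 - y^-1)%:E)%E.
  rewrite -integral_inv_sqr// [RHS]integral_mkcond; apply: eq_integral => t _.
  by rewrite kE !patchE/=; case: ifPn.
have mk : measurable_fun setT (k : measurableTypeR R -> measurableTypeR R).
  apply/(measurable_restrictT _ _).1 => //.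
  apply: subspace_continuous_measurable_fun => //.
  apply: continuous_in_subspaceT => t; rewrite inE/= in_itv/= => /andP[xt _].
  by apply: cvgV; [rewrite gt_eqF// (lt_le_trans x0)|exact: cvg_id].
have kL : L2 leb k by apply/L2P; split => //; rewrite kint ltry.
have [_ /(_ x y x0 xy)[_ uE]] := (density_ae du, density_int du).
have -> : u y - u x = L2dot leb (xmul f) k.
  rewrite uE Rintegral_mkcond; apply: eq_Rintegral => t _.
  rewrite /k !patchE; case: ifPn => [|_]; last by rewrite mulr0.
  rewrite inE/= in_itv/= => /andP[xt _]; have t0 : 0 < t by exact: lt_le_trans xt.
  by rewrite xmul_gt0// mulrAC divff ?mul1r// gt_eqF.
apply: le_trans (L2dot_CS fu kL) _; rewrite (besselE du du).
have -> // : L2dot leb k k = x^-1 - y^-1.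
by apply: EFin_inj; rewrite -L2dot_sqrE.
Qed.

(** A function of finite energy that is not bounded by [sqrt (E / x)] at [x]
    stays away from 0 on [x, oo[, hence is not square integrable. *)
Lemma bessel_decay u x : bessel_dom u -> 0 < x -> u x ^+ 2 <= bessel u u * x^-1.
Proof.
move=> uD x0; rewrite leNgt; apply/negP => big.
have [du xu fu] := bessel_dom_density uD.
pose q := Num.sqrt (bessel u u * x^-1).
have E0 : 0 <= bessel u u * x^-1 by rewrite mulr_ge0 ?bessel_ge0// invr_ge0 ltW.
have q0 : 0 <= q by exact: sqrtr_ge0.
have qu : q < `|u x|.
  by rewrite -ltr_sqr ?nnegrE// real_normK ?num_real// /q sqr_sqrtr.
pose h := `|u x| - q; have h0 : 0 < h by rewrite subr_gt0.
have hu y : x <= y -> h <= `|u y|.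
  move=> xy; rewrite lerBlDr.
  have yq : `|u y - u x| <= q.
    rewrite -ler_sqr ?nnegrE// real_normK ?num_real// /q sqr_sqrtr//.
    apply: le_trans (bessel_holder uD x0 xy) _.
    by rewrite ler_wpM2l ?bessel_ge0// lerBlDr lerDl invr_ge0 (le_trans (ltW x0)).
  have := ler_normB (u y) (u y - u x); rewrite opprB addrC subrK => H.
  lra.
pose n := Num.truncn (L2dot leb (xmul u) (xmul u) / (h * x) ^+ 2).
have hx0 : 0 < (h * x) ^+ 2 by rewrite exprn_gt0// mulr_gt0.
have n1 : L2dot leb (xmul u) (xmul u) < (h * x) ^+ 2 * n.+1%:R.
  by rewrite mulrC -ltr_pdivrMr//; exact: truncnS_gt.
suff : (h * x) ^+ 2 * n.+1%:R <= L2dot leb (xmul u) (xmul u) by rewrite leNgt n1.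
rewrite -lee_fin -L2dot_sqrE//.
have -> : (((h * x) ^+ 2 * n.+1%:R)%:E =
    \int[leb]_(t in `[x, (x + n.+1%:R)%R]) ((h * x) ^+ 2)%:E)%E.
  rewrite integral_cst//= lebesgue_measure_itv/= lte_fin ltrDl ltr0n.
  by rewrite -EFinB -EFinM; congr EFin; ring.
rewrite [leLHS]integral_mkcond; apply: ge0_le_integral => //.
- by move=> t _; rewrite patchE; case: ifPn => // _; rewrite lee_fin ltW.
- by apply/(measurable_restrictT _ _).1 => //; exact: measurable_cst.
- by apply/measurable_EFinP; apply: measurable_funX; exact: L2_measurable xu.
- move=> t _; rewrite patchE; case: ifPn => [|_]; last by rewrite lee_fin sqr_ge0.
  rewrite inE/= in_itv/= => /andP[xt _]; rewrite lee_fin.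
  have t0 : 0 < t by exact: lt_le_trans xt.
  rewrite xmul_gt0// !exprMn -[u t ^+ 2]real_normK ?num_real// mulrC.
  by rewrite ler_pM ?sqr_ge0// ler_sqr ?nnegrE ?hu// ltW.
Qed.

End pointwise.

(** * Integration by parts *)

Section calculus.
Variable R : realType.
Implicit Types (a b c x y e d l K M : R) (u v w f g s : R -> R).
Notation leb := (@lebesgue_measure R).

Definition C1 f f' := (forall x : R, is_derive x 1 f (f' x)) /\ continuous (f' : R -> R).

Lemma C1_continuous f f' : C1 f f' -> continuous (f : R -> R).
Proof. by move=> [df _] x; have [/derivable1_diffP/differentiable_continuous] := df x. Qed.

Lemma C1_mvt f f' a b : C1 f f' -> a <= b ->
  exists2 c, a <= c <= b & f b - f a = f' c * (b - a).
Proof.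
move=> fC ab; have [|c] := @MVT_segment R f f' a b ab (fun x _ => fC.1 x).
  exact/continuous_subspaceT/(C1_continuous fC).
by rewrite in_itv/=; exists c.
Qed.

Lemma continuous_bounded f a b : continuous (f : R -> R) -> a <= b ->
  exists2 M, 0 < M & forall x, a <= x <= b -> `|f x| <= M.
Proof.
move=> cf ab; have [c _ fc] := EVT_max ab (continuous_subspaceT cf).
have [d _ fd] := EVT_min ab (continuous_subspaceT cf).
exists (`|f c| + `|f d| + 1) => [|x xab]; first by rewrite ltr_wpDl// addr_ge0.
have xab' : x \in `[a, b] by rewrite in_itv.
rewrite ler_norml; have := fc _ xab'; have := fd _ xab'.
have := ler_norm (f c); have := ler_norm (- f d); rewrite normrN => *.
by apply/andP; split; have := normr_ge0 (f c); have := normr_ge0 (f d); lra.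
Qed.

Lemma C1_lipschitz f f' a b : C1 f f' -> a <= b -> exists2 K, 0 < K &
  forall x y, a <= x <= b -> a <= y <= b -> `|f y - f x| <= K * `|y - x|.
Proof.
move=> fC ab; have [K K0 fK] := continuous_bounded fC.2 ab; exists K => // x y.
wlog xy : x y / x <= y => [H|].
  by have [/H//|/ltW/H{}H xab yab] := leP x y; rewrite distrC (distrC y); exact: H.
move=> /andP[ax xb] /andP[ay yb]; have [c /andP[xc cy] ->] := C1_mvt fC xy.
by rewrite normrM ler_wpM2r// fK// (le_trans ax xc) (le_trans cy yb).
Qed.

Lemma lipschitz_AC_loc u :
  (forall a b, 0 < a -> a <= b -> exists2 K, 0 < K &
    forall x y, a <= x -> x <= y -> y <= b -> `|u y - u x| <= K * (y - x)) ->
  AC_loc u.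
Proof.
move=> uK a b a0 ab e e0; have [K K0 H] := uK a b a0 ab.
exists (e / K) => [|n s t st _]; first exact: divr_gt0.
rewrite ltr_pdivlMr// => sumK; apply: le_lt_trans sumK.
rewrite mulrC mulr_sumr; apply: ler_sum => i _.
by have [? [? ?]] := st i; exact: H.
Qed.

Lemma C1_AC_loc f f' : C1 f f' -> AC_loc f.
Proof.
move=> fC; apply: lipschitz_AC_loc => a b a0 ab.
have [K K0 H] := C1_lipschitz fC ab; exists K => // x y ax xy yb.
rewrite -[y - x]ger0_norm ?subr_ge0//; apply: H.
  by rewrite ax (le_trans xy).
by rewrite (le_trans ax).
Qed.

Lemma AC_loc_bounded u a b : AC_loc u -> 0 < a -> a <= b ->
  exists2 M, 0 < M & forall x, a <= x <= b -> `|u x| <= M.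
Proof.
move=> uac a0 ab.
have : {within `[a, b], continuous u}.
  apply: continuous_in_subspaceT => x; rewrite inE/= in_itv/= => /andP[ax _].
  by apply: abs_continuous_continuous => //; exact: lt_le_trans ax.
move=> cu; have [c _ fc] := EVT_max ab cu.
have [d _ fd] := EVT_min ab cu.
exists (`|u c| + `|u d| + 1) => [|x xab]; first by rewrite ltr_wpDl// addr_ge0.
have xab' : x \in `[a, b] by rewrite in_itv.
rewrite ler_norml; have := fc _ xab'; have := fd _ xab'.
have := ler_norm (u c); have := ler_norm (- u d); rewrite normrN => *.
by apply/andP; split; have := normr_ge0 (u c); have := normr_ge0 (u d); lra.
Qed.

Lemma AC_locM u v : AC_loc u -> AC_loc v -> AC_loc (u \* v).
Proof.
move=> uac vac a b a0 ab e e0.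
have [M M0 uM] := AC_loc_bounded uac a0 ab.
have [N N0 vN] := AC_loc_bounded vac a0 ab.
have e1 : 0 < e / 2 / N by rewrite divr_gt0// divr_gt0.
have e2 : 0 < e / 2 / M by rewrite divr_gt0// divr_gt0.
have [d d0 H] := uac a b a0 ab _ e1.
have [d' d0' H'] := vac a b a0 ab _ e2.
exists (Num.min d d') => [|n s t st dis]; first by rewrite lt_min d0.
rewrite lt_min => /andP[/(H n s t st dis) h /(H' n s t st dis) h'].
apply: (@le_lt_trans _ _ (N * \sum_(i < n) `|u (t i) - u (s i)| +
    M * \sum_(i < n) `|v (t i) - v (s i)|)).
  rewrite !mulr_sumr -big_split/=; apply: ler_sum => i _.
  rewrite (_ : _ - _ = v (t i) * (u (t i) - u (s i)) + u (s i) * (v (t i) - v (s i))); last by ring.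
  have [h1 [h2 h3]] := st i.
  apply: le_trans (ler_normD _ _) _; rewrite !normrM; apply: lerD; apply: ler_wpM2r => //.
    by apply: vN; rewrite h3 (le_trans h1).
  by apply: uM; rewrite h1 (le_trans h2).
have -> : e = e / 2 + e / 2 by lra.
by apply: ltrD; rewrite mulrC -ltr_pdivlMr.
Qed.

Lemma inv_AC_loc : AC_loc (fun x : R => x^-1).
Proof.
apply: lipschitz_AC_loc => a b a0 ab; exists (a ^- 2); first by rewrite invr_gt0 exprn_gt0.
move=> x y ax xy _; have x0 := lt_le_trans a0 ax; have y0 := lt_le_trans x0 xy.
have -> : y^-1 - x^-1 = - ((x * y)^-1 * (y - x)).
  by field; rewrite !gt_eqF.
rewrite normrN normrM ger0_norm ?invr_ge0 ?mulr_ge0 ?(ltW x0) ?(ltW y0)//.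
rewrite ger0_norm ?subr_ge0// ler_wpM2r ?subr_ge0// lef_pV2 ?posrE ?mulr_gt0 ?exprn_gt0//.
by rewrite expr2 ler_pM ?(ltW a0)// (le_trans ax).
Qed.

(** The product of [v] with a continuously differentiable function is locally
    absolutely continuous, and the product rule gives its density. *)
Lemma integral_by_parts v g psi psi' a b : AC_loc v -> density v g ->
  C1 psi psi' -> 0 < a -> a <= b ->
  leb.-integrable `[a, b] (EFin \o (fun x => psi x * g x + psi' x * v x)) /\
  \int[leb]_(x in `[a, b]) (psi x * g x + psi' x * v x) =
    psi b * v b - psi a * v a.
Proof.
move=> vac dv pC a0 ab.
have dens := AC_loc_density (AC_locM (C1_AC_loc pC) vac).
set h := limsup_dquot _ in dens.
have aeE : {ae leb, forall x, 0 < x -> h x = psi x * g x + psi' x * v x}.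
  apply: ae_imply2 (density_ae dens) (density_ae dv) => x hx vx x0.
  have [_ <-] := hx x0; have := is_deriveM (pC.1 x) (vx x0); case=> _ ->.
  by rewrite /GRing.scale/=; congr (_ + _); rewrite mulrC.
have [ih hE] := density_int dens a0 ab.
have mvI : measurable_fun `[a, b]%classic (v : measurableTypeR R -> measurableTypeR R).
  apply: subspace_continuous_measurable_fun => //.
  apply: continuous_in_subspaceT => x; rewrite inE/= in_itv/= => /andP[ax _].
  by apply: abs_continuous_continuous => //; exact: lt_le_trans ax.
have mC f : continuous f -> measurable_fun `[a, b]%classic (f : measurableTypeR R -> measurableTypeR R).
  by move=> cf; apply: measurable_funTS; exact: continuous_measurable_fun.
have mk : measurable_fun `[a, b]%classic ((fun x => psi x * g x + psi' x * v x) : measurableTypeR R -> measurableTypeR R).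
  apply: measurable_funD; apply: measurable_funM => //.
  - by apply: mC; exact: C1_continuous pC.
  - by apply: measurable_funTS; case: dv.
  - by apply: mC; case: pC.
have ae_ab : ae_eq leb `[a, b]%classic (EFin \o h) (EFin \o (fun x => psi x * g x + psi' x * v x)).
  apply: ae_imply aeE => x hx /=; rewrite in_itv/= => /andP[ax _]; congr EFin.
  by apply: hx; exact: lt_le_trans ax.
have mh : measurable_fun `[a, b]%classic (EFin \o h : measurableTypeR R -> \bar R).
  by case/integrableP : ih.
have mkE : measurable_fun `[a, b]%classic (EFin \o (fun x => psi x * g x + psi' x * v x) : measurableTypeR R -> \bar R).
  exact/measurable_EFinP.
split.
  apply/integrableP; split => //.
  rewrite (_ : (\int[leb]_(x in `[a, b]) _)%E = (\int[leb]_(x in `[a, b]) `|(EFin \o h) x|)%E).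
    by case/integrableP : ih.
  apply/esym/ae_eq_integral => //.
  - exact: measurableT_comp.
  - exact: measurableT_comp.
  - exact: ae_eq_abse.
rewrite [RHS]hE; congr fine; exact/esym/ae_eq_integral.
Qed.

Lemma L2_ae_bounded (h : R -> R) M b :
  measurable_fun setT (h : measurableTypeR R -> measurableTypeR R) ->
  {ae leb, forall x, `|h x| <= M * \1_(`[0, b]%classic : set R) x} -> L2 leb h.
Proof.
move=> mh hM; apply/L2P; split => //.
apply: (@le_lt_trans _ _ (\int[leb]_x ((M ^+ 2) * \1_(`[0, b]%classic : set R) x)%:E)%E).
  apply: ae_ge0_le_integral => //.
  - by move=> x _; rewrite lee_fin sqr_ge0.
  - by apply/measurable_EFinP; exact: measurable_funX.
  - by move=> x _; rewrite lee_fin mulr_ge0// ?sqr_ge0// indicE.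
  - by apply/measurable_EFinP; apply: measurable_funM => //; exact: measurable_indic.
  - apply: ae_imply hM => x hx _; rewrite lee_fin.
    rewrite -[h x ^+ 2]real_normK ?num_real//.
    have := normr_ge0 (h x); move: hx; rewrite indicE; case: (_ \in _); rewrite /= !(mulr1, mulr0).
      by move=> ? ?; rewrite ler_sqr ?nnegrE//; lra.
    move=> h0 h1; have -> : `|h x| = 0 by lra.
    by rewrite expr0n.
under eq_integral do rewrite EFinM.
rewrite ge0_integralZl//; last 2 first.
- by apply/measurable_EFinP; exact: measurable_indic.
- by rewrite lee_fin sqr_ge0.
rewrite integral_indic// setIT; apply: lte_mul_pinfty => //.
  by rewrite lee_fin sqr_ge0.
have : (leb (`[0%R, b]%classic : set R) < +oo)%E; last exact.
by rewrite lebesgue_measure_itv/=; case: ifPn => _; rewrite ?ltry// -EFinB ltry.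
Qed.

End calculus.

(** * Hats: explicit harmonic functions between three nodes *)

Section hyperbolic.
Variable R : realType.
Implicit Types (c x y : R).

(** The solutions of [s'' = c^2 s] with data [(s, s')] equal to [(1, 0)] and
    [(0, 1)] at 0. The case [c = 0] is included in order to treat the energy form and
    its perturbations [E_l], for which [c^2 = 2 l], together. *)
Definition coshc c x : R := (expR (c * x) + expR (- (c * x))) / 2.
Definition sinhc c x : R := if c == 0 then x else (expR (c * x) - expR (- (c * x))) / (2 * c).

Lemma is_derive_expRM c x : is_derive x 1 (fun t => expR (c * t)) (c * expR (c * x)).
Proof.
have := is_derive1_comp (is_derive_expR (c * x)) (is_deriveZ c (is_derive_id x (1 : R))).
by rewrite /GRing.scale/= mulr1 mulrC; exact.
Qed.

Lemma is_derive_coshc c x : is_derive x 1 (coshc c) (c ^+ 2 * sinhc c x).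
Proof.
have H := is_deriveZ (2^-1) (is_deriveD (is_derive_expRM c x) (is_derive_expRM (- c) x)).
rewrite (_ : coshc c = fun t => 2^-1 * (expR (c * t) + expR (- c * t))); last first.
  by apply/funext => t; rewrite /coshc mulrC -mulNr.
apply: (is_derive_eq H); rewrite /sinhc; case: eqP => [->|/eqP c0].
  by rewrite oppr0 !mul0r addr0 scaler0 expr0n mul0r.
by rewrite /GRing.scale/= -(mulNr c x); field.
Qed.

Lemma is_derive_sinhc c x : is_derive x 1 (sinhc c) (coshc c x).
Proof.
have [->|c0] := eqVneq c 0.
  rewrite (_ : coshc 0 x = 1); last by rewrite /coshc mul0r oppr0 expR0; field.
  rewrite (_ : sinhc 0 = id); first exact: is_derive_id.
  by apply/funext => t; rewrite /sinhc eqxx.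
have H := is_deriveZ ((2 * c)^-1) (is_deriveB (is_derive_expRM c x) (is_derive_expRM (- c) x)).
rewrite (_ : sinhc c = fun t => (2 * c)^-1 * (expR (c * t) - expR (- c * t))); last first.
  by apply/funext => t; rewrite /sinhc (negbTE c0) mulrC -mulNr.
by apply: (is_derive_eq H); rewrite /coshc /GRing.scale/= -(mulNr c x); field.
Qed.

Lemma sinhcC1 c : C1 (sinhc c) (coshc c).
Proof.
split=> [x|x]; first exact: is_derive_sinhc.
by have [/derivable1_diffP/differentiable_continuous] := is_derive_coshc c x.
Qed.

Lemma sinhc0 c : sinhc c 0 = 0.
Proof. by rewrite /sinhc mulr0 oppr0 subrr mul0r; case: ifP. Qed.

Lemma coshc0 c : coshc c 0 = 1.
Proof. by rewrite /coshc mulr0 oppr0 expR0; field. Qed.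

Lemma coshc_ge1 c x : 1 <= coshc c x.
Proof.
have := expR_ge1Dx (c * x); have := expR_ge1Dx (- (c * x)); rewrite /coshc; lra.
Qed.

Lemma sinhc_ge c x : 0 <= x -> x <= sinhc c x.
Proof.
move=> x0; have [y _] := C1_mvt (sinhcC1 c) x0; rewrite sinhc0 !subr0 => ->.
by rewrite ler_peMl// coshc_ge1.
Qed.

Lemma sinhc_gt0 c x : 0 < x -> 0 < sinhc c x.
Proof. by move=> x0; apply: lt_le_trans (sinhc_ge c (ltW x0)). Qed.

End hyperbolic.

Section hat.
Variable R : realType.
Notation leb := (@lebesgue_measure R).
Notation BR := (measurableTypeR R).
Variables (a y b c1 c2 : R).
Hypotheses (a0 : 0 <= a) (ay : a < y) (yb : y < b).

(** In dimension 3 the substitution [w = s / x] turns the radial equation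
    [(x^2 w')' = c^2 x^2 w] into [s'' = c^2 s]. The profile [s] of a hat vanishes
    outside of [[a, b]], is 1 at [y], and solves this equation with the constants
    [c1] and [c2] on the two sides of [y]. The flux [x^2 w'] equals [x s' - s]. *)
Definition rise x : R := sinhc c1 (x - a) / sinhc c1 (y - a).
Definition rise' x : R := coshc c1 (x - a) / sinhc c1 (y - a).
Definition fall x : R := sinhc c2 (b - x) / sinhc c2 (b - y).
Definition fall' x : R := - coshc c2 (b - x) / sinhc c2 (b - y).
Definition rise_flux x := x * rise' x - rise x.
Definition fall_flux x := x * fall' x - fall x.
(** Writing the profile with [clamp] instead of by cases makes its absolute
    continuity a consequence of that of [rise] and [fall]. *)
Definition profile x := rise (clamp a y x) + (fall (clamp y b x) - 1).
Definition hat : R -> R := (fun x => x^-1) \* profile.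

Let y0 : 0 < y := le_lt_trans a0 ay.

Let sa : sinhc c1 (y - a) != 0.
Proof. by rewrite gt_eqF// sinhc_gt0// subr_gt0. Qed.

Let sb : sinhc c2 (b - y) != 0.
Proof. by rewrite gt_eqF// sinhc_gt0// subr_gt0. Qed.

Lemma rise_a : rise a = 0. Proof. by rewrite /rise subrr sinhc0 mul0r. Qed.
Lemma rise_y : rise y = 1. Proof. by rewrite /rise divff. Qed.
Lemma fall_y : fall y = 1. Proof. by rewrite /fall divff. Qed.
Lemma fall_b : fall b = 0. Proof. by rewrite /fall subrr sinhc0 mul0r. Qed.

Let is_derive_shift (f : R -> R) (z x l : R) : is_derive (x - z) 1 f l ->
  is_derive x 1 (fun t => f (t - z)) l.
Proof.
move=> H; have G : is_derive x 1 (fun t : R => t - z) 1.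
  apply: (is_derive_eq (is_deriveB (is_derive_id x (1 : R)) (is_derive_cst z x 1))).
  by rewrite subr0.
by have := @is_derive1_comp R f (fun t => t - z) x l 1 H G; rewrite mulr1.
Qed.

Let is_derive_refl (f : R -> R) (z x l : R) : is_derive (z - x) 1 f l ->
  is_derive x 1 (fun t => f (z - t)) (- l).
Proof.
move=> H; have G : is_derive x 1 (fun t : R => z - t) (-1).
  apply: (is_derive_eq (is_deriveB (is_derive_cst z x 1) (is_derive_id x (1 : R)))).
  by rewrite sub0r.
by have := @is_derive1_comp R f (fun t => z - t) x l (-1) H G; rewrite mulrN1.
Qed.

Let is_derive_divr (f : R -> R) (k x l : R) : is_derive x 1 f l ->
  is_derive x 1 (fun t => f t / k) (l / k).
Proof.
move=> H; rewrite (_ : (fun t => f t / k) = (fun t => k^-1 * f t)); last first.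
  by apply/funext => t; rewrite mulrC.
by rewrite mulrC; exact: (is_deriveZ k^-1 H).
Qed.

Let C1I (f f' f'' : R -> R) : (forall x : R, is_derive x 1 f (f' x)) ->
  (forall x : R, is_derive x 1 f' (f'' x)) -> C1 f f'.
Proof.
move=> df df'; split=> // x.
by have [/derivable1_diffP/differentiable_continuous] := df' x.
Qed.

Let rise_der (x : R) : is_derive x 1 rise (rise' x).
Proof. by apply: is_derive_divr; apply: is_derive_shift; exact: is_derive_sinhc. Qed.

Let rise'_der (x : R) : is_derive x 1 rise' (c1 ^+ 2 * rise x).
Proof.
rewrite /rise mulrA; apply: is_derive_divr; apply: is_derive_shift.
exact: is_derive_coshc.
Qed.

Let fall_der (x : R) : is_derive x 1 fall (fall' x).
Proof. by apply: is_derive_divr; apply: is_derive_refl; exact: is_derive_sinhc. Qed.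

Let fall'_der (x : R) : is_derive x 1 fall' (c2 ^+ 2 * fall x).
Proof.
have H := is_derive_divr (sinhc c2 (b - y))
  (is_deriveN (is_derive_refl (is_derive_coshc c2 (b - x)))).
by apply: (is_derive_eq H); rewrite opprK /fall mulrA.
Qed.

Lemma rise_C1 : C1 rise rise'. Proof. exact: C1I rise_der rise'_der. Qed.
Lemma fall_C1 : C1 fall fall'. Proof. exact: C1I fall_der fall'_der. Qed.

Let flux_der (s s' s'' : R -> R) (x : R) : is_derive x 1 s (s' x) -> is_derive x 1 s' (s'' x) ->
  is_derive x 1 (fun t => t * s' t - s t) (x * s'' x).
Proof.
move=> ds ds'; have H := is_deriveB (is_deriveM (is_derive_id x (1 : R)) ds') ds.
by apply: (is_derive_eq H); rewrite /GRing.scale/= mulr1 addrK.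
Qed.

Lemma rise_flux_C1 : C1 rise_flux (fun x => x * (c1 ^+ 2 * rise x)).
Proof.
split=> x; first exact: (@flux_der rise rise' (fun t => c1 ^+ 2 * rise t) x (rise_der x) (rise'_der x)).
apply: (@continuousM _ _ id _ x); first exact: cvg_id.
apply: (@continuousM _ _ (cst _) rise x); first exact: cvg_cst.
exact: (C1_continuous rise_C1).
Qed.

Lemma fall_flux_C1 : C1 fall_flux (fun x => x * (c2 ^+ 2 * fall x)).
Proof.
split=> x; first exact: (@flux_der fall fall' (fun t => c2 ^+ 2 * fall t) x (fall_der x) (fall'_der x)).
apply: (@continuousM _ _ id _ x); first exact: cvg_id.
apply: (@continuousM _ _ (cst _) fall x); first exact: cvg_cst.
exact: (C1_continuous fall_C1).
Qed.

Let clamp_low (p q x : R) : p <= q -> x <= p -> clamp p q x = p.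
Proof. by move=> pq xp; rewrite /clamp min_l ?max_l// (le_trans xp). Qed.

Let clamp_high (p q x : R) : p <= q -> q <= x -> clamp p q x = q.
Proof. by move=> pq qx; rewrite /clamp min_r ?max_r. Qed.

Lemma profile_rise x : a <= x <= y -> profile x = rise x.
Proof.
move=> /andP[ax xy]; rewrite /profile clamp_id ?ax// (clamp_low (ltW yb) xy).
by rewrite fall_y subrr addr0.
Qed.

Lemma profile_fall x : y <= x <= b -> profile x = fall x.
Proof.
move=> /andP[yx xb]; rewrite /profile (@clamp_id _ y b x) ?yx//.
by rewrite (clamp_high (ltW ay) yx) rise_y addrC subrK.
Qed.

Lemma profile_out x : (x <= a) || (b <= x) -> profile x = 0.
Proof.
move=> /orP[xa|bx]; rewrite /profile.
  rewrite (clamp_low (ltW ay) xa) (clamp_low (ltW yb) (le_trans xa (ltW ay))).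
  by rewrite rise_a fall_y subrr addr0.
rewrite (clamp_high (ltW yb) bx) (clamp_high (ltW ay) (le_trans (ltW yb) bx)).
by rewrite rise_y fall_b sub0r subrr.
Qed.

Lemma clamp_AC_loc (s s' : R -> R) p q : p <= q -> C1 s s' -> AC_loc (s \o clamp p q).
Proof.
move=> pq sC; have [K K0 H] := C1_lipschitz sC pq.
apply: lipschitz_AC_loc => ? ? _ _; exists K => // x z _ xz _ /=.
apply: le_trans (H _ _ _ _) _; try exact: clamp_itv.
rewrite ler_wpM2l ?(ltW K0)// ger0_norm ?subr_ge0 ?clamp_le//.
exact: clampB_le.
Qed.

Lemma cst_AC_loc (k : R) : AC_loc (fun _ : R => k).
Proof.
apply: lipschitz_AC_loc => ? ? _ _; exists 1 => // x z _ xz _.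
by rewrite subrr normr0 mul1r subr_ge0.
Qed.

Lemma hat_AC_loc : AC_loc hat.
Proof.
apply: AC_locM; first exact: inv_AC_loc.
have -> : profile = 1 *: (rise \o clamp a y) + (1 *: (fall \o clamp y b) + (fun=> -1)).
  by rewrite !scale1r; apply/funext.
apply: AC_loc_lin; first exact: clamp_AC_loc (ltW ay) rise_C1.
apply: AC_loc_lin; last exact: cst_AC_loc.
exact: clamp_AC_loc (ltW yb) fall_C1.
Qed.

Lemma hatE x : hat x = profile x / x.
Proof. by rewrite /hat mulrC. Qed.

Lemma hat_y : hat y = y^-1.
Proof. by rewrite hatE profile_rise ?lexx ?(ltW ay)// rise_y mul1r. Qed.

Lemma hat_out x : (x <= a) || (b <= x) -> hat x = 0.
Proof. by move=> xo; rewrite hatE profile_out// mul0r. Qed.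

Let hat_der (s s' : R -> R) (x : R) : 0 < x -> is_derive x 1 s (s' x) ->
  (\forall t \near x, profile t = s t) ->
  is_derive x 1 hat ((x * s' x - s x) / x ^+ 2).
Proof.
move=> x0 ds ps; have x0' : x != 0 by rewrite gt_eqF.
have dp : is_derive x 1 profile (s' x).
  by apply: near_eq_is_derive ds; apply: filterS ps => t ->.
have H := is_deriveM (is_deriveV x0' (is_derive_id x (1 : R))) dp.
have px : profile x = s x by apply: nbhs_singleton ps.
apply: (is_derive_eq H); rewrite /GRing.scale/= px mulr1.
by field.
Qed.

Definition hat_flux x : R :=
  if (a < x < y) then rise_flux x else if (y < x < b) then fall_flux x else 0.

Lemma is_derive_hat (x : R) : 0 < x -> x != a -> x != y -> x != b ->
  is_derive x 1 hat (hat_flux x / x ^+ 2).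
Proof.
move=> x0 xa xy xb; rewrite /hat_flux.
have near_itv (p q : R) : p < x -> x < q -> \forall t \near x, p < t < q.
  move=> px xq; near=> t; apply/andP; split.
    by near: t; exact: lt_nbhsr.
  by near: t; exact: lt_nbhsl.
case: ifPn => [/andP[ax xy']|nax].
  apply: hat_der => //; apply: filterS (near_itv _ _ ax xy') => t /andP[/ltW h /ltW h'].
  by rewrite profile_rise// h.
case: ifPn => [/andP[yx xb']|nxb].
  apply: hat_der => //; apply: filterS (near_itv _ _ yx xb') => t /andP[/ltW h /ltW h'].
  by rewrite profile_fall// h.
have H : is_derive x 1 (cst 0 : R -> R) 0 by exact: is_derive_cst.
have := @hat_der (cst 0) (cst 0) x x0 H; rewrite mulr0 subrr; apply.
have [xlta|alex] := ltP x a.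
  near=> t; rewrite profile_out//; apply/orP; left; apply: ltW.
  by near: t; exact: lt_nbhsl.
have bltx : b < x.
  move: nax nxb; rewrite !negb_and -!leNgt => /orP[|yx].
    by move=> xlea; exfalso; move: xa; rewrite eq_le xlea alex.
  move=> /orP[xy''|bx]; first by exfalso; move: xy; rewrite eq_le xy'' yx.
  by rewrite lt_neqAle eq_sym xb.
near=> t; rewrite profile_out//; apply/orP; right; apply: ltW.
by near: t; exact: lt_nbhsr.
Unshelve. all: by end_near. Qed.

Lemma ae_not_node : {ae leb, forall x, [/\ x != a, x != y & x != b]}.
Proof.
exists [set a; y; b]; split.
- by apply: measurableU => //; exact: measurableU.
- apply: countable_lebesgue_measure0; apply: finite_set_countable.
  by rewrite !finite_setU; do !split; exact: finite_set1.
- move=> x /= H; apply: contrapT => nx; apply: H.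
  by split; apply/eqP => xE; apply: nx; rewrite xE; [left; left|left; right|right].
Qed.

Let f := limsup_dquot hat.

Lemma hat_density : density hat f.
Proof. exact: AC_loc_density hat_AC_loc. Qed.

Lemma ae_xmul_hat_flux : {ae leb, forall x, 0 < x -> xmul f x = hat_flux x / x}.
Proof.
apply: ae_imply2 (density_ae hat_density) ae_not_node => x fx [xa xy xb] x0.
have [_ E1] := fx x0; have [_ E2] := is_derive_hat x0 xa xy xb.
have E : f x = hat_flux x / x ^+ 2 by rewrite -E2; exact/esym/E1.
by rewrite xmul_gt0// E; field; rewrite gt_eqF.
Qed.

Lemma xmul_hat x : 0 < x -> xmul hat x = profile x.
Proof. by move=> x0; rewrite xmul_gt0// hatE mulrC divfK// gt_eqF. Qed.

(** The hat is in the form domain also when it starts at [a = 0]: there the rise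
    is at most a multiple of [x], so that the flux is too, and [x w'] is bounded. *)
Lemma hat_bounds : exists2 M, 0 < M &
  (forall x, 0 < x -> `|profile x| <= M * \1_(`[0, b]%classic : set R) x) /\
  (forall x, 0 < x -> `|hat_flux x| <= M * \1_(`[0, b]%classic : set R) x * x).
Proof.
have [K1 K10 HK1] := continuous_bounded rise_C1.2 (ltW ay).
have [K2 K20 HK2] := continuous_bounded fall_C1.2 (ltW yb).
have riseK x : a <= x <= y -> `|rise x| <= K1 * x.
  move=> /andP[ax xy]; have [z /andP[az zx]] := C1_mvt rise_C1 ax.
  rewrite rise_a subr0 => ->; rewrite normrM (@ger0_norm _ (x - a)) ?subr_ge0//.
  by rewrite ler_pM ?subr_ge0// ?HK1 ?az ?(le_trans zx)// lerBlDr lerDl.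
have fallK x : y <= x <= b -> `|fall x| <= K2 * b.
  move=> /andP[yx xb]; have [z /andP[xz zb]] := C1_mvt fall_C1 xb.
  rewrite fall_b sub0r => H; rewrite -normrN H normrM (@ger0_norm _ (b - x)) ?subr_ge0//.
  rewrite ler_pM ?subr_ge0// ?HK2 ?zb ?(le_trans yx)// lerBlDr lerDl.
  by rewrite (le_trans (ltW y0)).
have b0 : 0 < b := lt_trans y0 yb.
exists (2 * K1 + K1 * b + K2 * b + K2 + K2 * b / y).
  have : 0 <= K2 * b / y by rewrite divr_ge0 ?(ltW y0)// mulr_ge0 ?(ltW b0) ?(ltW K20).
  have : 0 < K1 * b by rewrite mulr_gt0.
  have : 0 < K2 * b by rewrite mulr_gt0.
  lra.
have P1 : 0 < K1 * b by rewrite mulr_gt0.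
have P2 : 0 < K2 * b by rewrite mulr_gt0.
have P3 : 0 <= K2 * b / y by rewrite divr_ge0 ?(ltW y0)// ltW.
have in0b x : 0 < x -> x <= b -> \1_(`[0, b]%classic : set R) x = 1 :> R.
  by move=> x0 xb; rewrite indicE mem_set//= in_itv/= (ltW x0).
split=> x x0.
- have [xa|ax] := ltP x a.
    by rewrite profile_out ?(ltW xa)// normr0 mulr_ge0// ?indicE//; lra.
  have [xy|yx] := leP x y.
    rewrite profile_rise ?ax// in0b ?(le_trans xy (ltW yb))// mulr1.
    apply: (@le_trans _ _ (K1 * x)); first by rewrite riseK// ax.
    have : K1 * x <= K1 * b by rewrite ler_wpM2l ?(ltW K10)// (le_trans xy (ltW yb)).
    lra.
  have [xb|bx] := leP x b; last first.
    by rewrite profile_out ?(ltW bx) ?orbT// normr0 mulr_ge0// ?indicE//; lra.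
  rewrite profile_fall ?(ltW yx)// in0b// mulr1.
  apply: (@le_trans _ _ (K2 * b)); first by rewrite fallK// (ltW yx).
  lra.
- rewrite /hat_flux; case: ifPn => [/andP[/ltW ax /ltW xy]|_].
    rewrite in0b ?(le_trans xy (ltW yb))// mulr1 /rise_flux.
    apply: le_trans (ler_normB _ _) _; rewrite normrM (gtr0_norm x0) mulrC.
    have h1 : `|rise' x| <= K1 by rewrite HK1// ax.
    have h2 : `|rise x| <= K1 * x by rewrite riseK// ax.
    have h3 : `|rise' x| * x <= K1 * x by rewrite ler_wpM2r// ltW.
    apply: (@le_trans _ _ (2 * K1 * x)); first lra.
    rewrite ler_wpM2r ?(ltW x0)//; lra.
  case: ifPn => [/andP[/ltW yx /ltW xb]|_]; last first.
    by rewrite normr0 mulr_ge0 ?(ltW x0)// mulr_ge0// ?indicE//; lra.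
  rewrite in0b// mulr1 /fall_flux.
  apply: le_trans (ler_normB _ _) _; rewrite normrM (gtr0_norm x0) mulrC.
  have h1 : `|fall' x| <= K2 by rewrite HK2// yx.
  have h2 : `|fall x| <= K2 * b / y * x.
    apply: (@le_trans _ _ (K2 * b)); first by rewrite fallK// yx.
    by rewrite -mulrA ler_peMr ?(ltW P2)// mulrC ler_pdivlMr// mul1r.
  have h3 : `|fall' x| * x <= K2 * x by rewrite ler_wpM2r// ltW.
  apply: (@le_trans _ _ ((K2 + K2 * b / y) * x)); first by rewrite mulrDl lerD.
  rewrite ler_wpM2r ?(ltW x0)//; lra.
Qed.

Lemma hat_bessel_density : bessel_density hat f.
Proof.
have [M M0 [pM fM]] := hat_bounds; split; first exact: hat_density.
- apply: (@L2_ae_bounded _ _ M b).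
    by apply: measurable_xmul; exact: measurable_AC_loc hat_AC_loc.
  apply: aeW => x; have [x0|x0] := ltP 0 x; first by rewrite xmul_hat// pM.
  by rewrite xmul_le0// normr0 mulr_ge0 ?(ltW M0)// indicE.
- apply: (@L2_ae_bounded _ _ M b).
    by apply: measurable_xmul; apply: measurable_restrict_halfline; case: hat_density.
  apply: ae_imply ae_xmul_hat_flux => x fx; have [x0|x0] := ltP 0 x.
    by rewrite fx// normrM normfV (gtr0_norm x0) ler_pdivrMr// fM.
  by rewrite xmul_le0// normr0 mulr_ge0 ?(ltW M0)// indicE.
Qed.

Lemma hat_dom : bessel_dom hat.
Proof. exact: bessel_density_dom hat_AC_loc hat_bessel_density. Qed.

End hat.

Section hat_identity.
Variable R : realType.
Notation leb := (@lebesgue_measure R).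
Notation BR := (measurableTypeR R).
Variables (a y b c1 c2 : R).
Hypotheses (a0 : 0 <= a) (ay : a < y) (yb : y < b).
Variable v : R -> R.
Hypothesis vD : bessel_dom v.

Let y0 : 0 < y := le_lt_trans a0 ay.
Notation w := (hat a y b c1 c2).
Let f := limsup_dquot w.
Let g := limsup_dquot v.
Let wD : bessel_density w f := hat_bessel_density c1 c2 a0 ay yb.
Let vd : bessel_density v g := bessel_dom_density vD.
Let vac : AC_loc v. Proof. by case: vD. Qed.

Let h : R -> R := xmul f \* xmul g.
Let k : R -> R := xmul w \* xmul v.

Let ih : leb.-integrable setT (EFin \o h).
Proof. by case: wD => _ _ fL; case: vd => _ _ gL; exact: L2_integrableM. Qed.

Let ik : leb.-integrable setT (EFin \o k).
Proof. by case: wD => _ wL _; case: vd => _ vL _; exact: L2_integrableM. Qed.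

Let ihA (A : set BR) : measurable A -> leb.-integrable A (EFin \o h).
Proof. by move=> mA; exact: integrableS ih. Qed.

Let ikA (A : set BR) : measurable A -> leb.-integrable A (EFin \o k).
Proof. by move=> mA; exact: integrableS ik. Qed.

Let eq_ae_Rintegral (A : set BR) (p q : R -> R) :
  {ae leb, forall x, A x -> p x = q x} ->
  \int[leb]_(x in A) p x = \int[leb]_(x in A) q x.
Proof.
move=> [N [mN N0 pqN]]; congr fine; apply: (@eq_integral_off_null _ _ _ _ _ N) => //.
move=> x Ax Nx; congr EFin; apply: contrapT => pq; apply: Nx; apply: pqN => /= /(_ Ax).
exact: pq.
Qed.

Let ae_h (P : R -> Prop) (q : R -> R) :
  (forall x, P x -> 0 < x -> x != a -> x != y -> x != b -> hat_flux a y b c1 c2 x = q x) ->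
  {ae leb, forall x, P x -> 0 < x -> h x = q x * g x}.
Proof.
move=> Pq; apply: ae_imply2 (ae_xmul_hat_flux c1 c2 ay yb) (ae_not_node a y b).
move=> x fx [xa xy xb] Px x0; rewrite /h /= fx// Pq// xmul_gt0//.
by field; rewrite gt_eqF.
Qed.

Let iH (c : R) (A : set BR) : measurable A ->
  leb.-integrable A (EFin \o (fun x => h x + c ^+ 2 * k x)).
Proof.
move=> mA; have i2 : leb.-integrable A (EFin \o (fun x => c ^+ 2 * k x)).
  exact: (integrableZl mA _ (ikA mA)).
exact: (integrableD mA (ihA mA) i2).
Qed.

(** On one piece the profile solves the differential equation, so that
    integration by parts leaves the boundary terms only. *)
Let piece (c alpha beta : R) (s s' : R -> R) :
  C1 (fun x => x * s' x - s x) (fun x => x * (c ^+ 2 * s x)) ->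
  0 < alpha -> alpha <= beta ->
  (forall x, alpha <= x <= beta -> profile a y b c1 c2 x = s x) ->
  (forall x, alpha < x < beta -> x != a -> x != y -> x != b ->
     hat_flux a y b c1 c2 x = x * s' x - s x) ->
  \int[leb]_(x in `[alpha, beta]) (h x + c ^+ 2 * k x) =
    (beta * s' beta - s beta) * v beta - (alpha * s' alpha - s alpha) * v alpha.
Proof.
move=> sC al0 alb ps fs; have [dv _ _] := vd.
have [_ <-] := integral_by_parts vac dv sC al0 alb.
rewrite -Rintegral_itv_obnd_cbnd; last exact: iH.
rewrite -[RHS]Rintegral_itv_obnd_cbnd; last first.
  have [i _] := integral_by_parts vac dv sC al0 alb.
  by apply: integrableS i => //; exact: subset_itv_oc_cc.
apply: eq_ae_Rintegral.
have := @ae_h (fun x => alpha < x < beta) (fun x => x * s' x - s x).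
move=> /(_ (fun x xab _ xa xy xb => fs x xab xa xy xb)) H.
have nb : {ae leb, forall x, x != beta}.
  exists [set beta]; split; [by []|exact: lebesgue_measure_set1|].
  by move=> x /= /negP; rewrite negbK => /eqP.
apply: ae_imply2 H nb => x Hx xb; rewrite /= in_itv/= => /andP[ax xbeta].
have x0 : 0 < x by exact: lt_trans ax.
rewrite Hx//; last by rewrite ax lt_neqAle xb.
rewrite /k /= xmul_hat// xmul_gt0// ps ?xbeta ?(ltW ax)//.
by congr (_ + _); rewrite mulrCA; ring.
Qed.

Let left_piece alpha : a <= alpha -> 0 < alpha -> alpha <= y ->
  \int[leb]_(x in `[alpha, y]) (h x + c1 ^+ 2 * k x) =
    rise_flux a y c1 y * v y - rise_flux a y c1 alpha * v alpha.
Proof.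
move=> aal al0 aly; apply: (piece (rise_flux_C1 a y c1)) => // x /andP[h1 h2].
  by apply: profile_rise => //; rewrite h2 (le_trans aal).
by move=> *; rewrite /hat_flux (le_lt_trans aal h1) h2.
Qed.

Let right_piece :
  \int[leb]_(x in `[y, b]) (h x + c2 ^+ 2 * k x) =
    fall_flux y b c2 b * v b - fall_flux y b c2 y * v y.
Proof.
apply: (piece (fall_flux_C1 y b c2)) => // [|x /andP[h1 h2]|x /andP[h1 h2] *].
- exact: ltW.
- by apply: profile_fall => //; rewrite h1.
- by rewrite /hat_flux h1 h2 (ltNge x y) (ltW h1) andbF.
Qed.

(** For [a = 0] the integral over [[alpha, y]] tends to that over [[0, y]], and
    the boundary term at [alpha] tends to 0: the flux is of order [alpha] and [v]
    is at most of order [alpha^(-1/2)] by [bessel_decay]. *)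
Let left_full :
  \int[leb]_(x in `]a, y]) (h x + c1 ^+ 2 * k x) =
    rise_flux a y c1 y * v y - rise_flux a y c1 a * v a.
Proof.
move: a0; rewrite le_eqVlt => /predU1P[aE|a0']; last first.
  by rewrite Rintegral_itv_obnd_cbnd ?left_piece ?(ltW ay)//; exact: iH.
have rf0 : rise_flux a y c1 a = 0.
  by rewrite /rise_flux -{1}aE mul0r rise_a sub0r oppr0.
rewrite rf0 mul0r subr0; apply/eqP; rewrite -subr_eq0; apply/eqP.
set X := (X in X = 0); apply/eqP; rewrite -normr_le0; apply/ler_addgt0Pr => e e0.
rewrite add0r; have e20 : 0 < e / 2 by lra.
have XE alpha : 0 < alpha -> alpha <= y ->
    X = \int[leb]_(x in `[a, alpha]) (h x + c1 ^+ 2 * k x) - rise_flux a y c1 alpha * v alpha.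
  move=> al0 aly; have aal : a <= alpha by rewrite -aE ltW.
  have iay := iH c1 (_ : measurable (`]a, y]%classic : set BR)).
  rewrite /X -(@Rintegral_itv_obnd_cbnd _ a); last exact: iH.
  have := left_piece aal al0 aly.
  rewrite -(@Rintegral_itv_obnd_cbnd _ alpha); last exact: iH.
  rewrite -(@Rintegral_itvB _ _ (BRight a) (BRight y) alpha)//; last exact: iH.
  lra.
have [K K0 HK] := continuous_bounded (rise_C1 a y c1).2 (ltW ay).
have fluxK x : 0 < x -> x <= y -> `|rise_flux a y c1 x| <= 2 * K * x.
  move=> x0 xy; rewrite /rise_flux; apply: le_trans (ler_normB _ _) _.
  have ax : a <= x by rewrite -aE ltW.
  have h1 : `|rise' a y c1 x| <= K by rewrite HK// ax.
  have h2 : `|rise a y c1 x| <= K * x.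
    have [z /andP[az zx]] := C1_mvt (rise_C1 a y c1) ax.
    rewrite rise_a subr0 => ->; rewrite -{2}aE subr0 normrM (gtr0_norm x0).
    by rewrite ler_wpM2r ?(ltW x0)// HK// az (le_trans zx).
  rewrite normrM (gtr0_norm x0).
  have : x * `|rise' a y c1 x| <= x * K by rewrite ler_wpM2l// ltW.
  lra.
have E0 := bessel_ge0 vD.
have near0 : \forall alpha \near a, a <= alpha ->
    `| \int[leb]_(x in `[a, alpha]) (h x + c1 ^+ 2 * k x) | < e / 2.
  exact: (parameterized_integral_near_left ay e20 (iH c1 _)).
pose C := 4 * K ^+ 2 * bessel v v + 1.
have C0 : 0 < C by rewrite ltr_wpDl// mulr_ge0// mulr_ge0// sqr_ge0.
have [alpha [al0 aly alC alN]] : exists alpha, [/\ 0 < alpha, alpha <= y,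
    C * alpha <= (e / 2) ^+ 2 &
    `| \int[leb]_(x in `[a, alpha]) (h x + c1 ^+ 2 * k x) | < e / 2].
  have near0' : \forall alpha \near a^'+,
    `| \int[leb]_(x in `[a, alpha]) (h x + c1 ^+ 2 * k x) | < e / 2.
    near=> t; have at_ : a <= t by apply: ltW; near: t; exact: nbhs_right_gt.
    by move: (at_); near: t; exact: (cvg_at_right_filter (@cvg_id _ _) near0).
  have ex : \forall alpha \near a^'+, [/\ 0 < alpha, alpha <= y,
    C * alpha <= (e / 2) ^+ 2 &
    `| \int[leb]_(x in `[a, alpha]) (h x + c1 ^+ 2 * k x) | < e / 2].
    near=> t; split.
    - by rewrite aE; near: t; exact: nbhs_right_gt.
    - by near: t; exact: nbhs_right_le.
    - rewrite mulrC -ler_pdivlMr//; near: t; apply: nbhs_right_le.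
      by rewrite -aE divr_gt0// exprn_gt0.
    - by near: t.
  by have [t] := @filter_ex _ _ _ _ ex; exists t.
rewrite (XE _ al0 aly); apply: le_trans (ler_normB _ _) _.
have -> : e = e / 2 + e / 2 by lra.
apply: lerD; first exact: ltW.
rewrite -ler_sqr ?nnegrE ?(ltW e20)// normrM exprMn.
apply: le_trans alC; rewrite [X in _ * X]real_normK ?num_real//.
have h1 : `|rise_flux a y c1 alpha| ^+ 2 <= (2 * K * alpha) ^+ 2.
  rewrite ler_sqr ?nnegrE ?fluxK// mulr_ge0 ?(ltW al0)//; lra.
have h2 := bessel_decay vD al0.
apply: (@le_trans _ _ ((2 * K * alpha) ^+ 2 * (bessel v v * alpha^-1))).
  by rewrite ler_pM ?sqr_ge0.
have -> : (2 * K * alpha) ^+ 2 * (bessel v v * alpha^-1) = 4 * K ^+ 2 * bessel v v * alpha.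
  by field; rewrite gt_eqF.
by rewrite ler_wpM2r ?(ltW al0)// lerDl.
Unshelve. all: by end_near. Qed.

(** The energy of a hat against [v]: on each of its two pieces the hat solves
    [(x^2 w')' = c^2 x^2 w], so that only the fluxes [x^2 w'] at the three nodes
    remain.  When the hat starts at 0 its flux there vanishes. *)
Lemma hat_bessel :
  bessel w v + c1 ^+ 2 * \int[leb]_(x in `]a, y]) (xmul w x * xmul v x)
    + c2 ^+ 2 * \int[leb]_(x in `]y, b]) (xmul w x * xmul v x) =
  rise_flux a y c1 y * v y - rise_flux a y c1 a * v a +
  (fall_flux y b c2 b * v b - fall_flux y b c2 y * v y).
Proof.
have [dw _ _] := wD; have [dv _ _] := vd.
rewrite -left_full -right_piece -(@Rintegral_itv_obnd_cbnd _ y); last exact: iH.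
rewrite !RintegralD//; try exact: ihA; try exact: (integrableZl _ (_ ^+ 2) (ikA _)).
rewrite !RintegralZl//; try exact: ikA.
rewrite (besselE dw dv).
have -> : L2dot leb (xmul f) (xmul g) = \int[leb]_(x in `]a, y]) h x + \int[leb]_(x in `]y, b]) h x.
  have -> : L2dot leb (xmul f) (xmul g) = \int[leb]_(x in `]a, b]) h x.
    rewrite Rintegral_mkcond; apply: eq_ae_Rintegral.
    have := @ae_h (fun x => ~ (a < x <= b)) (fun=> 0).
    move=> /(_ _)H; apply: ae_imply (H _).
      move=> x Hx _; rewrite patchE; case: ifPn => // /negP xab.
      have [x0|x0] := ltP 0 x; last by rewrite xmul_le0// mul0r.
      have := Hx; rewrite mul0r => Hx'; rewrite -[LHS]/(h x) Hx'// => xab'.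
      by apply: xab; rewrite inE/= in_itv.
    move=> x xab x0 xa xy xb; rewrite /hat_flux.
    case: ifPn => [/andP[h1 h2]|_].
      by exfalso; apply: xab; rewrite h1 (ltW (lt_trans h2 yb)).
    case: ifPn => [/andP[h1 h2]|//].
    by exfalso; apply: xab; rewrite (lt_trans ay h1) ltW.
  rewrite -(@Rintegral_itvB _ _ (BRight a) (BRight b) y)//.
  - by rewrite addrC subrK.
  - exact: ihA.
  - by rewrite bnd_simp ltW.
  - by rewrite bnd_simp ltW.
by rewrite /k /=; ring.
Qed.

End hat_identity.

(** * The orthogonal complement of the kernel of the trace *)

Section hat_lambda.
Variable R : realType.
Implicit Types (a b c x y l : R) (u v w p : R -> R).
Notation leb := (@lebesgue_measure R).

(** Where the constant [c1] does not fit [l] the function [v] must vanish. This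
    covers functions that vanish on [(0, 1)], against which the hat that is
    constant there may be tested. *)
Lemma hat_bessel_lambda a y b c1 c2 l v : 0 <= a -> a < y -> y < b -> bessel_dom v ->
  c2 ^+ 2 = 2 * l -> c1 ^+ 2 = 2 * l \/ (forall x, a < x <= y -> v x = 0) ->
  bessel_lambda l (hat a y b c1 c2) v =
  rise_flux a y c1 y * v y - rise_flux a y c1 a * v a +
  (fall_flux y b c2 b * v b - fall_flux y b c2 y * v y).
Proof.
move=> a0 ay yb vD c2E c1E; have wD := hat_dom c1 c2 a0 ay yb.
rewrite -(hat_bessel c1 c2 a0 ay yb vD) c2E.
have -> : c1 ^+ 2 * \int[leb]_(x in `]a, y]) (xmul (hat a y b c1 c2) x * xmul v x) =
    2 * l * \int[leb]_(x in `]a, y]) (xmul (hat a y b c1 c2) x * xmul v x).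
  case: c1E => [->//|v0]; suff -> : \int[leb]_(x in `]a, y]) (xmul (hat a y b c1 c2) x * xmul v x) = 0.
    by rewrite !mulr0.
  rewrite (_ : 0 = \int[leb]_(x in `]a, y]) (cst 0 x : R)); last first.
    by rewrite /Rintegral integral0_eq.
  apply: eq_Rintegral => x; rewrite inE/= in_itv/= => xay.
  have x0 : 0 < x by case/andP : xay => ax _; exact: le_lt_trans ax.
  by rewrite (xmul_gt0 v x0) v0// !mulr0.
rewrite /bessel_lambda -addrA -mulrDr; congr (_ + _).
have [_ wL _] := wD; have [_ vL _] := vD.
have xwL := L2_bessel_m wL; have xvL := L2_bessel_m vL.
rewrite (integral_bessel_m wL vL) mulrCA mulrA; congr (_ * _).
have i := L2_integrableM xwL xvL.
rewrite /L2dot.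
transitivity (\int[leb]_(x in `]a, b]) (xmul (hat a y b c1 c2) x * xmul v x)).
  rewrite [RHS]Rintegral_mkcond; apply: eq_Rintegral => x _.
  rewrite patchE; case: ifPn => // /negP xab.
  have [x0|x0] := ltP 0 x; last by rewrite xmul_le0// mul0r.
  rewrite xmul_gt0// hat_out ?mulr0 ?mul0r// -implyNb -ltNge; apply/implyP => ax.
  rewrite leNgt; apply/negP => xb; apply: xab.
  by rewrite inE/= in_itv/= ax ltW.
rewrite -(@Rintegral_itvB _ _ (BRight a) (BRight b) y).
- by rewrite addrC subrK.
- exact: integrableS i.
- by rewrite bnd_simp ltW.
- by rewrite bnd_simp ltW.
Qed.

(** The support of the trace measure without its null point 0. *)
Definition node x := 0 < x <= 1 \/ exists2 k : nat, (0 < k)%N & x = k%:R.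

Lemma node_gt0 x : node x -> 0 < x.
Proof. by case=> [/andP[]//|[k k0 ->]]; rewrite ltr0n. Qed.

Lemma trace_kerJ_node v x : trace_kerJ v -> node x -> v x = 0.
Proof.
move=> [_ v01 vk] [/andP[x0]|[k k0 ->]]; last exact: vk.
by rewrite le_eqVlt => /predU1P[->|x1]; [exact: (vk 1)|apply: v01; rewrite x0].
Qed.

Lemma rise_flux_0 y c : rise_flux 0 y c 0 = 0.
Proof. by rewrite /rise_flux mul0r rise_a subr0. Qed.

Lemma fall_flux_end y b c : fall_flux y b c b = - (b / sinhc c (b - y)).
Proof. by rewrite /fall_flux fall_b subr0 /fall' subrr coshc0 mulN1r mulrN. Qed.

Lemma rise_flux_top a y c : a < y ->
  rise_flux a y c y = y * (coshc c (y - a) / sinhc c (y - a)) - 1.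
Proof. by move=> ay; rewrite /rise_flux rise_y// /rise'. Qed.

Lemma fall_flux_top y b c : y < b ->
  fall_flux y b c y = - (y * (coshc c (b - y) / sinhc c (b - y))) - 1.
Proof. by move=> yb; rewrite /fall_flux fall_y// /fall' mulNr mulrN. Qed.

Lemma green_compl l y (N : nat) : 0 < l -> node y -> y < N%:R ->
  trace_compl l (hat 0 y N%:R (Num.sqrt (2 * l)) (Num.sqrt (2 * l))).
Proof.
move=> l0 ny yN; have y0 := node_gt0 ny; split; first exact: hat_dom.
move=> v vk; have [vD _ _] := vk.
have cE : Num.sqrt (2 * l) ^+ 2 = 2 * l by rewrite sqr_sqrtr// mulr_ge0// ltW.
rewrite hat_bessel_lambda//; last by left.
rewrite rise_flux_0 (trace_kerJ_node vk ny) (@trace_kerJ_node v N%:R)//.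
  by rewrite !mulr0 mul0r !subr0 addr0.
right; exists N => //; rewrite -(ltr_nat R); exact: lt_trans yN.
Qed.

(** The orthogonal complement of the kernel of the trace contains the Green
    functions of all points of the support, so that projecting does not change
    the values there.  The Green functions of the intervals [(0, N)] serve
    this purpose up to an error controlled by the value at [N]. *)
Lemma trace_proj_node l u p y : 0 < l -> bessel_dom u -> trace_proj l u p ->
  node y -> p y = u y.
Proof.
move=> l0 uD [[pD _] orth] ny; have y0 := node_gt0 ny.
apply/esym/eqP; rewrite -subr_eq0 -[_ - _]/((u - p) y).
set v := u - p; have vD : bessel_dom v by exact: bessel_domB.
pose c := Num.sqrt (2 * l).
have cE : c ^+ 2 = 2 * l by rewrite sqr_sqrtr// mulr_ge0// ltW.
pose K := y * (coshc c y / sinhc c y).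
have K0 : 0 < K by rewrite mulr_gt0// divr_gt0 ?sinhc_gt0// (lt_le_trans ltr01)// coshc_ge1.
have bound (N : nat) : 2 * y <= N%:R -> (K * `|v y|) ^+ 2 * N%:R <= 4 * bessel v v.
  move=> yN; have yN' : y < N%:R by lra.
  have N0 : 0 < N%:R :> R by lra.
  have Ny : 0 < N%:R - y by lra.
  have wD := hat_dom c c (lexx 0) y0 yN'.
  have := orth _ (green_compl l0 ny yN'); rewrite (bessel_lambdaC l vD wD) hat_bessel_lambda//; last by left.
  rewrite rise_flux_0 mul0r subr0 rise_flux_top// subr0 fall_flux_top// fall_flux_end.
  set K' := y * (coshc c (N%:R - y) / sinhc c (N%:R - y)).
  have K'0 : 0 <= K'.
    rewrite mulr_ge0 ?(ltW y0)// divr_ge0 ?ltW ?sinhc_gt0//.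
    by rewrite (lt_le_trans ltr01)// coshc_ge1.
  set r := N%:R / sinhc c (N%:R - y) => H.
  have r0 : 0 <= r by rewrite divr_ge0 ?ltW ?sinhc_gt0//.
  have r2 : r <= 2.
    rewrite ler_pdivrMr ?sinhc_gt0//.
    by have := sinhc_ge c (ltW Ny); lra.
  have {}H : (K + K') * v y = r * v N%:R by move: H; rewrite -/K; lra.
  have H1 : K * `|v y| <= 2 * `|v N%:R|.
    apply: (@le_trans _ _ ((K + K') * `|v y|)); first by rewrite ler_wpM2r// lerDl.
    have KK : 0 <= K + K' by rewrite addr_ge0// ltW.
    rewrite -[K + K']ger0_norm// -normrM H normrM (ger0_norm r0).
    by rewrite ler_wpM2r.
  have H2 := bessel_decay vD N0.
  have H3 : (K * `|v y|) ^+ 2 <= (2 * `|v N%:R|) ^+ 2.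
    by rewrite ler_sqr ?nnegrE// mulr_ge0// ltW.
  have H4 : (2 * `|v N%:R|) ^+ 2 <= 4 * (bessel v v * N%:R^-1).
    rewrite exprMn real_normK ?num_real//; have -> : (2 : R) ^+ 2 = 4 by ring.
    by rewrite ler_wpM2l.
  rewrite -ler_pdivlMr//; apply: le_trans H3 (le_trans H4 _).
  by rewrite mulrA.
apply/contraT => vy0.
have P0 : 0 < (K * `|v y|) ^+ 2 by rewrite exprn_gt0// mulr_gt0// normr_gt0.
pose N := (Num.truncn (2 * y) + Num.truncn (4 * bessel v v / (K * `|v y|) ^+ 2)).+1.
have N1 : 2 * y <= N%:R.
  apply/ltW/(lt_le_trans (truncnS_gt _)); by rewrite ler_nat ltnS leq_addr.
have N2 : 4 * bessel v v / (K * `|v y|) ^+ 2 < N%:R.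
  apply: (lt_le_trans (truncnS_gt _)); by rewrite ler_nat ltnS leq_addl.
move: N2; rewrite ltr_pdivrMr// => N2.
by have := bound _ N1; rewrite mulrC leNgt N2.
Qed.

(** The extensions of the indicator of the nodes in [(n, n+1]]: energy minimizing
    for [E_l] between the nodes. For [n = 0] the nodes fill [(0, 1]] and the hat is
    the constant 1 there, which corresponds to [c1 = 0]. *)
Definition phi (n : nat) l : R -> R :=
  n.+1%:R *: hat n%:R n.+1%:R n.+2%:R (if n == 0%N then 0 else Num.sqrt (2 * l)) (Num.sqrt (2 * l)).

Let lt1 (n : nat) : (n%:R : R) < n.+1%:R. Proof. by rewrite ltr_nat. Qed.

Lemma phi_dom n l : bessel_dom (phi n l).
Proof. by apply: bessel_domZ; apply: hat_dom. Qed.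

Lemma phi_node n l x : node x -> phi n l x = ((n%:R < x <= n.+1%:R)%R)%:R.
Proof.
move=> nx; set c1 := if n == 0%N then 0 else Num.sqrt (2 * l).
have -> : phi n l x = n.+1%:R * hat n%:R n.+1%:R n.+2%:R c1 (Num.sqrt (2 * l)) x by [].
have [xn|nltx] := leP x n%:R.
  by rewrite hat_out ?xn// mulr0.
have [xn1|n1x] := leP x n.+1%:R; last first.
  case: nx => [/andP[_ x1]|[k k0 xE]].
    by exfalso; move: n1x; rewrite ltNge (le_trans x1)// ler1n.
  by rewrite hat_out ?mulr0// orbC xE ler_nat; move: n1x; rewrite xE ltr_nat => ->.
have [n0|n0] := eqVneq n 0%N.
  have x0 : x != 0 by rewrite gt_eqF// node_gt0.
  rewrite hatE profile_rise ?(ltW nltx)// /c1 n0 eqxx.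
  by rewrite /rise /sinhc eqxx !subr0 mul1r divr1 divff.
case: nx => [/andP[_ x1]|[k k0 xE]].
  by exfalso; move: nltx; rewrite ltNge (le_trans x1)// ler1n lt0n.
have -> : x = n.+1%:R.
  by move: nltx xn1; rewrite xE ltr_nat ler_nat => h1 h2; congr (_%:R); apply/eqP; rewrite eqn_leq h2.
by rewrite hat_y// divff// pnatr_eq0.
Qed.

(** For [n > 0] these are the energies of resistors of conductance [n (n+1)]
    between [n] and [n+1], tested with the indicator of [n+1]. *)
Definition flux_form n v : R :=
  n%:R * n.+1%:R * (v n.+1%:R - v n%:R) + n.+1%:R * n.+2%:R * (v n.+1%:R - v n.+2%:R).

Lemma bessel_phi0 n v : bessel_dom v -> bessel (phi n 0) v = flux_form n v.
Proof.
move=> vD; have hD := hat_dom 0 0 (ler0n R n) (lt1 n) (lt1 n.+1).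
have b0 (u w : R -> R) : bessel u w = bessel_lambda 0 u w by rewrite /bessel_lambda mul0r addr0.
rewrite b0 /phi mulr0 sqrtr0 if_same (bessel_lambdaZl 0 _ hD vD) -b0.
have := hat_bessel 0 0 (ler0n R n) (lt1 n) (lt1 n.+1) vD.
rewrite expr0n/= !mul0r !addr0 => ->.
rewrite rise_flux_top// fall_flux_top// fall_flux_end /rise_flux rise_a subr0 /rise'.
have S1 (m : nat) : (m.+1%:R : R) - m%:R = 1 by rewrite -natr1; ring.
rewrite !S1 subrr !coshc0 /coshc !mul0r oppr0 expR0 /sinhc eqxx /flux_form.
rewrite -!natr1; by field.
Qed.

(** Functions in the kernel vanish at the nodes, so that no flux remains. *)
Lemma phi_compl n l : 0 < l -> trace_compl l (phi n l).
Proof.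
move=> l0; split; first exact: phi_dom.
move=> v vk; have [vD v01 vk'] := vk.
have hD (c : R) := hat_dom c (Num.sqrt (2 * l)) (ler0n R n) (lt1 n) (lt1 n.+1).
have cE : Num.sqrt (2 * l) ^+ 2 = 2 * l by rewrite sqr_sqrtr// mulr_ge0// ltW.
rewrite /phi (bessel_lambdaZl l _ (hD _) vD) hat_bessel_lambda//; last first.
  case: eqVneq => [->|_]; [right => x /andP[x0]|by left].
  by rewrite le_eqVlt => /predU1P[->|x1]; [exact: (vk' 1%N)|apply: v01; rewrite x0].
rewrite (vk' n.+1 isT) (vk' n.+2 isT) !mulr0 sub0r subr0 addr0.
case: n hD => [|n] hD; first by rewrite rise_flux_0 mul0r oppr0 mulr0.
by rewrite vk'// mulr0 oppr0 mulr0.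
Qed.

Lemma phi_ker n l : trace_kerJ (phi n 0 - phi n l).
Proof.
split; first by apply: bessel_domB; exact: phi_dom.
- move=> x /andP[x0 x1]; have nx : node x by left; rewrite x0 ltW.
  by change (phi n 0 x - phi n l x = 0); rewrite !phi_node// subrr.
- move=> k k0; have nk : node k%:R by right; exists k.
  by change (phi n 0 k%:R - phi n l k%:R = 0); rewrite !phi_node// subrr.
Qed.

End hat_lambda.

(** * The trace measure *)

Section trace_measure.
Variable R : realType.
Implicit Types (x y : R) (u v g : R -> R).
Variable a : nat -> {posnum R}.
Notation mu := (trace_mu a).

Lemma trace_muE (A : set R) : measurable A ->
  mu A = (trace_mu_ac R A + \sum_(1 <= k <oo) ((a k)%:num%:E * dirac (k%:R : R) A))%E.
Proof. by move=> mA; exact: (measure_addE _ _ A). Qed.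

Lemma trace_mu_acE (A : set R) :
  trace_mu_ac R A = (\int[@lebesgue_measure R]_(x in A `&` `]0%R, 1%R[) (x ^+ 2)%:E)%E.
Proof. by []. Qed.

Lemma trace_mu_ac_le (A : set R) : measurable A ->
  (trace_mu_ac R A <= 1)%E.
Proof.
move=> mA; rewrite trace_mu_acE.
have mI : measurable (A `&` `]0, 1[%classic : set (measurableTypeR R)) by exact: measurableI.
apply: (@le_trans _ _ (\int[@lebesgue_measure R]_(x in A `&` `]0%R, 1%R[) 1%E)%E).
  apply: ge0_le_integral => //.
  - by move=> x _; rewrite lee_fin sqr_ge0.
  - by apply: measurable_funTS; apply/measurable_EFinP; exact: exprn_measurable.
  - move=> x [_]; rewrite /= in_itv/= => /andP[x0 x1].
    by rewrite lee_fin expr_le1// ltW.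
rewrite integral_cst// mul1e.
apply: (@le_trans _ _ (@lebesgue_measure R `]0, 1[%classic)).
  by apply: le_measure; rewrite ?inE//; exact: subIsetr.
by rewrite lebesgue_measure_itv/= lte_fin ltr01 sube0.
Qed.

Lemma trace_mu_atom (k : nat) : (0 < k)%N -> mu [set k%:R] = (a k)%:num%:E.
Proof.
move=> k0; rewrite trace_muE//.
rewrite trace_mu_acE [X in (X + _)%E](_ : _ = 0%E) ?add0e; last first.
  rewrite (_ : _ `&` _ = set0) ?integral_set0//.
  apply/seteqP; split => // x [/= ->]; rewrite in_itv/= => /andP[_].
  by rewrite ltrn1 -[k]prednK.
apply/cvg_lim => //; apply: cvg_near_cst; near=> N.
have kN : (k < N)%N by near: N; exact: nbhs_infty_gt.
rewrite (bigD1_seq k)//= ?iota_uniq ?mem_index_iota ?k0//.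
rewrite diracE mem_set// mule1 big1_seq ?adde0// => j /andP[jk _].
rewrite diracE memNset ?mule0//= => /eqP; rewrite eqr_nat; exact/negP.
Unshelve. all: by end_near. Qed.

Lemma measurable_node : measurable ([set x | node x] : set R).
Proof.
rewrite (_ : [set x | node x] = `]0, 1]%classic `|` \bigcup_k [set k.+1%:R]).
  apply: measurableU => //; exact: bigcup_measurable.
apply/seteqP; split => x /=.
- move=> [x01|[[//|k] _ ->]]; first by left; rewrite /= in_itv.
  by right; exists k.
- by move=> [|[k _ /= ->]]; [rewrite in_itv/=; left|right; exists k.+1].
Qed.

Lemma ae_node : {ae mu, forall x, node x}.
Proof.
exists (~` [set x | node x]); split => //.
- by apply: measurableC; exact: measurable_node.
- rewrite trace_muE; last by apply: measurableC; exact: measurable_node.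
  rewrite trace_mu_acE [X in (X + _)%E](_ : _ = 0%E) ?add0e; last first.
    rewrite (_ : _ `&` _ = set0) ?integral_set0//.
    apply/seteqP; split => // x [/= nx]; rewrite in_itv/= => /andP[x0 x1].
    by apply: nx; left; rewrite x0 ltW.
  apply: eseries0 => k k1 _; rewrite diracE memNset ?mule0//= => nk.
  by apply: nk; right; exists k.
Qed.

Lemma node_trace_F x : node x -> x \in @trace_F R.
Proof.
move=> nx; rewrite inE; case: nx => [/andP[x0 x1]|[k k0 ->]].
  by left; rewrite /= in_itv/= ltW.
by right; exists k.
Qed.

Lemma trace_J_node u x : node x -> trace_J u x = u x.
Proof. by move=> nx; rewrite /trace_J patchE node_trace_F. Qed.

Lemma ae_trace_mu_atom (P : R -> Prop) (k : nat) : (0 < k)%N ->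
  {ae mu, forall x, P x} -> P k%:R.
Proof.
move=> k0 [N [mN N0 PN]]; apply: contrapT => nP.
have : (mu [set k%:R] <= mu N)%E.
  by apply: le_measure; rewrite ?inE// => x /= ->; exact: PN.
rewrite trace_mu_atom// N0 lee_fin; apply/negP; rewrite -ltNge.
by [].
Qed.

Lemma L2dot_atom g (k : nat) : (0 < k)%N ->
  L2dot mu (\1_([set k%:R] : set R)) g = (a k)%:num * g k%:R.
Proof.
move=> k0; rewrite /L2dot.
transitivity (\int[mu]_(x in [set k%:R]) g k%:R).
  rewrite [RHS]Rintegral_mkcond; apply: eq_Rintegral => x _.
  rewrite patchE indicE; case: (boolP (x \in _)) => [|_]; last by rewrite mul0r.
  by rewrite inE/= => ->; rewrite mul1r.
by rewrite Rintegral_cst// trace_mu_atom// mulrC.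
Qed.

Lemma L2_indic_fin (A : set R) : measurable A -> (mu A < +oo)%E -> L2 mu (\1_A : R -> R).
Proof.
move=> mA Afin; apply/L2P; split; first exact: measurable_indic.
rewrite (_ : (\int[mu]_x _)%E = mu A)//.
transitivity (\int[mu]_x (\1_A x)%:E)%E; last by rewrite integral_indic// setIT.
apply: eq_integral => x _; congr EFin.
by rewrite indicE; case: (x \in A); rewrite ?expr1n ?expr0n.
Qed.

(** The partition of the nodes into [(0, 1]] and the single integers from 2 on;
    the traces of the functions [phi n l] are the indicators of the cells. *)
Definition cell (n : nat) : set R := if n is 0%N then `]0, 1]%classic else [set n.+1%:R].

Lemma measurable_cell n : measurable (cell n).
Proof. by case: n => [|n] /=. Qed.

Lemma cell_node n x : node x -> (x \in cell n) = (n%:R < x <= n.+1%:R).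
Proof.
move=> nx; apply/idP/idP; rewrite inE; case: n => [|n] /=.
- by rewrite in_itv.
- by move=> ->; rewrite ltr_nat lexx ltnS leqnn.
- by rewrite in_itv.
- move=> /andP[h1 h2]; case: nx => [/andP[_ x1]|[k k0 xk]].
    by exfalso; move: h1; rewrite ltNge (le_trans x1)// ler1n.
  move: h1 h2; rewrite xk ltr_nat ler_nat => h1 h2; congr (_%:R).
  by apply/eqP; rewrite eqn_leq h2.
Qed.

Lemma trace_mu_open_unit (A : set R) : measurable A -> A `<=` `]0, 1[%classic ->
  mu A = trace_mu_ac R A.
Proof.
move=> mA A01; rewrite trace_muE// [X in (_ + X)%E](_ : _ = 0%E) ?adde0//.
apply: eseries0 => k k1 _; rewrite diracE memNset ?mule0// => /A01 /=.
rewrite in_itv/= => /andP[_]; apply/negP.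
by rewrite -leNgt -[1]/(1%:R) ler_nat.
Qed.

Lemma trace_mu_unit_fin : (mu `]0%R, 1%R]%classic < +oo)%E.
Proof.
rewrite -(@setUitv1 _ _ (BRight 0) 1 true) ?bnd_simp//.
have m1 : mu [set 1] = (a 1)%:num%:E by exact: (trace_mu_atom (k := 1)).
apply: le_lt_trans (measureU2 _ _ _) _ => //.
have m01 : (mu `]0%R, 1%R[%classic < +oo)%E.
  rewrite trace_mu_open_unit//; apply: (@le_lt_trans _ _ 1%E); last exact: ltry.
  exact: trace_mu_ac_le.
by apply: lte_add_pinfty; [exact: m01|rewrite [X in (X < _)%E]m1 ltry].
Qed.

Lemma trace_mu_itv_gt0 x y : 0 < x -> x < y -> y <= 1 -> (0 < mu `[x, y]%classic)%E.
Proof.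
move=> x0 xy y1.
apply: (@lt_le_trans _ _ (mu `]x, y[%classic)); last first.
  by apply: le_measure; rewrite ?inE//; exact: subset_itv_oo_cc.
have sub : (`]x, y[%classic : set R) `<=` `]0, 1[%classic.
  by move=> t /=; rewrite !in_itv/= => /andP[h1 h2]; apply/andP; split; lra.
rewrite trace_mu_open_unit// trace_mu_acE setIidl//.
apply: (@lt_le_trans _ _ (\int[@lebesgue_measure R]_(t in `]x, y[) (x ^+ 2)%:E)%E).
  rewrite integral_cst//= lebesgue_measure_itv/= lte_fin xy -EFinB -EFinM lte_fin.
  by rewrite mulr_gt0 ?exprn_gt0// subr_gt0.
apply: ge0_le_integral => //.
- by move=> t _; rewrite lee_fin sqr_ge0.
- by apply: measurable_funTS; apply/measurable_EFinP; exact: exprn_measurable.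
- move=> t /=; rewrite in_itv/= => /andP[h1 h2]; rewrite lee_fin.
  by rewrite ler_sqr ?nnegrE; lra.
Qed.

Lemma L2_cell n : L2 mu (\1_(cell n) : R -> R).
Proof.
apply: L2_indic_fin; first exact: measurable_cell.
case: n => [|n]; first exact: trace_mu_unit_fin.
by rewrite /cell trace_mu_atom// ltry.
Qed.

Lemma L2_atom (k : nat) : (0 < k)%N -> L2 mu (\1_([set k%:R] : set R) : R -> R).
Proof. by move=> k0; apply: L2_indic_fin => //; rewrite trace_mu_atom// ltry. Qed.

(** Minus the density of the flux form with respect to the measure of the
    support; the coefficient of the possible node 0 vanishes. *)
Definition flux_density (n : nat) : R -> R :=
  (n%:R * n.+1%:R / (a n)%:num) *: \1_([set n%:R] : set R) +
  ((n.+1%:R * n.+2%:R / (a n.+2)%:num) *: \1_([set n.+2%:R] : set R) +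
   (- (2 * n.+1%:R ^+ 2) / (a n.+1)%:num) *: \1_([set n.+1%:R] : set R)).

Let term0 n : L2 mu ((n%:R * n.+1%:R / (a n)%:num) *: \1_([set n%:R] : set R)).
Proof.
case: n => [|n]; last by apply: L2_Z; exact: L2_atom.
by rewrite mul0r mul0r scale0r; exact: L2_0.
Qed.

Lemma L2_flux_density n : L2 mu (flux_density n).
Proof.
by apply: L2_D => //; apply: L2_D; apply: L2_Z; exact: L2_atom.
Qed.

Lemma L2dot_flux_density n g : L2 mu g -> L2dot mu (flux_density n) g = - flux_form n g.
Proof.
move=> gL; have L1 := L2_atom (ltn0Sn n); have L2' := L2_atom (ltn0Sn n.+1).
rewrite /flux_density L2dotDl//; last by apply: L2_D; exact: L2_Z.
rewrite L2dotDl; [|exact: L2_Z|exact: L2_Z|exact: gL].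
rewrite (L2dotZl _ L2' gL) (L2dotZl _ L1 gL) !L2dot_atom//.
have -> : L2dot mu ((n%:R * n.+1%:R / (a n)%:num) *: \1_([set n%:R] : set R)) g =
    n%:R * n.+1%:R * g n%:R.
  case: n {L1 L2'} => [|n].
    rewrite mul0r mul0r scale0r mul0r -[0](scale0r g) (L2dotZl 0 gL gL).
    by rewrite mul0r.
  rewrite (L2dotZl _ (L2_atom (ltn0Sn n)) gL) L2dot_atom//.
  by field.
rewrite /flux_form -!natr1; field.
by apply/andP; split.
Qed.

Let indic_nat (i j : nat) : \1_([set i%:R] : set R) (j%:R : R) = (i == j)%:R :> R.
Proof.
rewrite indicE; congr (nat_of_bool _)%:R; apply/idP/idP; rewrite inE/=.
  by move/eqP; rewrite eqr_nat eq_sym.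
by move/eqP => ->.
Qed.

Lemma flux_density_next n : flux_density n n.+2%:R = n.+1%:R * n.+2%:R / (a n.+2)%:num.
Proof.
change (n%:R * n.+1%:R / (a n)%:num * \1_([set n%:R] : set R) n.+2%:R +
  (n.+1%:R * n.+2%:R / (a n.+2)%:num * \1_([set n.+2%:R] : set R) n.+2%:R +
   - (2 * n.+1%:R ^+ 2) / (a n.+1)%:num * \1_([set n.+1%:R] : set R) n.+2%:R) =
  n.+1%:R * n.+2%:R / (a n.+2)%:num).
rewrite !indic_nat eqxx !ltn_eqF ?(ltnW (ltnSn _))//.
by rewrite !mulr0 mulr1 add0r addr0.
Qed.

Lemma flux_density_prev n :
  flux_density n n%:R = n%:R * n.+1%:R / (a n)%:num.
Proof.
change (n%:R * n.+1%:R / (a n)%:num * \1_([set n%:R] : set R) n%:R +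
  (n.+1%:R * n.+2%:R / (a n.+2)%:num * \1_([set n.+2%:R] : set R) n%:R +
   - (2 * n.+1%:R ^+ 2) / (a n.+1)%:num * \1_([set n.+1%:R] : set R) n%:R) =
  n%:R * n.+1%:R / (a n)%:num).
rewrite !indic_nat eqxx !gtn_eqF ?(ltnW (ltnSn _))//.
by rewrite !mulr0 mulr1 !addr0.
Qed.

End trace_measure.

(** * The forms E_l of the trace *)

Section limits.
Variable R : realType.

Lemma limn_esup_lt (u : nat -> \bar R) (x : \bar R) : (limn_esup u < x)%E ->
  \forall n \near \oo, (u n < x)%E.
Proof.
move=> /ereal_inf_lt[_ [V Voo <-] Vx]; apply: filterS Voo => n Vn.
by apply: le_lt_trans Vx; apply: ereal_sup_ubound; exists n.
Qed.

Lemma limn_einf_le (u : nat -> \bar R) (x : \bar R) :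
  (\forall n \near \oo, (u n <= x)%E) -> (limn_einf u <= x)%E.
Proof.
move=> ux; apply: le_trans (limn_einf_sup u) _.
apply: ge_ereal_inf; exists (ereal_sup (u @` [set n | (u n <= x)%E])).
  by exists [set n | (u n <= x)%E].
by apply: ge_ereal_sup => _ [n /= un <-].
Qed.

Lemma harmonic_near (d : R) : 0 < d -> \forall n \near \oo, n.+1%:R^-1 <= d.
Proof.
move=> d0; have /cvgrPdist_le/(_ _ d0) := @cvg_harmonic R; apply: filterS => n.
by rewrite sub0r normrN ger0_norm//= invr_ge0.
Qed.

End limits.

Section trace_form.
Variable R : realType.
Implicit Types (x y l e : R) (u v g p w f : R -> R).
Variable a : nat -> {posnum R}.
Notation mu := (trace_mu a).
Notation leb := (@lebesgue_measure R).

(** The witnesses of a finite value of [trace_lambda]. *)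
Definition trace_lift l f w p :=
  [/\ trace_DJ a w, trace_J w = f %[ae mu] & trace_proj l w p].

Lemma trace_lift_dom l f w p : trace_lift l f w p -> bessel_dom p.
Proof. by move=> [_ _ [[pD _] _]]. Qed.

Lemma trace_lift_ae l f w p : 0 < l -> trace_lift l f w p ->
  {ae mu, forall x, node x /\ f x = p x}.
Proof.
move=> l0 [[wD _] wf pr]; apply: ae_imply2 (ae_node a) wf => x nx /(_ I) <-.
by split => //; rewrite trace_J_node// (trace_proj_node l0 wD pr nx).
Qed.

Lemma trace_lift_atom l f w p (k : nat) : 0 < l -> trace_lift l f w p ->
  (0 < k)%N -> f k%:R = p k%:R.
Proof. by move=> l0 tl k0; have [] := ae_trace_mu_atom k0 (trace_lift_ae l0 tl). Qed.

Lemma trace_lambda_ge0 l f : 0 < l -> (0 <= trace_lambda a l f)%E.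
Proof.
move=> l0; apply: le_ereal_inf_tmp => _ [p [w tl] <-].
by rewrite lee_fin; apply: bessel_lambda_ge0 (ltW l0) (trace_lift_dom tl).
Qed.

Lemma trace_lambda_le l f w p : trace_lift l f w p ->
  (trace_lambda a l f <= (bessel_lambda l p p)%:E)%E.
Proof. by move=> tl; apply: ereal_inf_lbound; exists p => //; exists w. Qed.

Lemma trace_lambda_lt l f e : (trace_lambda a l f < e%:E)%E ->
  exists w p, trace_lift l f w p /\ bessel_lambda l p p <= e.
Proof.
by move=> /ereal_inf_lt[_ [p [w tl] <-]]; rewrite lte_fin => /ltW; exists w, p.
Qed.

Let flux_compl_lin l c s p q : 0 <= l -> trace_compl l p -> trace_compl l q ->
  trace_compl l (c *: p + s *: q).
Proof.
move=> l0 [pD pc] [qD qc]; have sD := bessel_domZ s qD; split; first exact: (bessel_dom_lin c pD sD).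
move=> v vk; have [vD _ _] := vk; rewrite (bessel_lambda_linl l c pD sD vD).
by rewrite (bessel_lambdaZl l s qD vD) pc// qc// !mulr0 addr0.
Qed.

Lemma trace_lift_lin l c s f w p n : 0 < l -> trace_lift l f w p ->
  trace_lift l (c *: f + s *: (\1_(@cell R n) : R -> R)) (c *: w + s *: phi n l) (c *: p + s *: phi n l).
Proof.
move=> l0 tl; have ae_f := trace_lift_ae l0 tl; have [[wD wL] wf [pc orth]] := tl.
have fD := phi_dom n l; have sD := bessel_domZ s fD; have [pD _] := pc.
have JE : trace_J (c *: w + s *: phi n l) = c *: trace_J w + s *: trace_J (phi n l).
  apply/funext => x.
  rewrite [RHS]/(c * trace_J w x + s * trace_J (phi n l) x) /trace_J !patchE.
  by case: ifPn => // _; change ((0 : R) = c * 0 + s * 0); rewrite !mulr0 addr0.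
have Jphi : {ae mu, forall x, trace_J (phi n l) x = \1_(@cell R n) x}.
  apply: ae_imply (ae_node a) => x nx.
  by rewrite trace_J_node// phi_node// indicE cell_node.
split.
- split; first exact: (bessel_dom_lin c wD sD).
  have mJ : measurable_fun setT (trace_J (phi n l)).
    have [ac _ _] := fD; have m1 := measurable_AC_loc ac.
    have -> : trace_J (phi n l) = ((phi n l \_ (@halfline R)) \_ ([set x | node x] : set R) : R -> R).
      apply/funext => x; rewrite /trace_J !patchE.
      case: (boolP (x \in @trace_F R)) => xF; last first.
        case: ifPn => // /set_mem nx; by move: xF; rewrite node_trace_F.
      case: ifPn => [/set_mem nx|nx].
        by rewrite halflineE node_gt0.
      have x0 : x <= 0.
        rewrite leNgt; apply/negP => x0; move/negP : nx; apply; apply: mem_set => /=.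
        move: xF; rewrite inE => -[|[k k0 <-]]; last by right; exists k.
        by rewrite /= in_itv/= => /andP[_ x1]; left; rewrite x0.
      have -> : x = 0.
        apply/eqP; rewrite eq_le x0; move: xF; rewrite inE => -[|[k k0 xk]].
          by rewrite /= in_itv/= => /andP[].
        by rewrite -xk ler0n.
      have h0 c1 c2 : hat n%:R n.+1%:R n.+2%:R c1 c2 0 = 0 :> R.
        by apply: hat_out; rewrite ?ltr_nat ?ler0n.
      exact: (etrans (congr1 (GRing.mul n.+1%:R) (h0 _ _)) (mulr0 _)).
    apply/(measurable_restrictT _ _).1; first exact: measurable_node.
    exact: measurable_funTS.
  rewrite JE; apply: L2_lin => //; apply: L2_Z; apply/L2P; split => //.
  have /L2P[_] := L2_cell a n; rewrite (_ : (\int[mu]_x (\1_(@cell R n) x ^+ 2)%:E)%E =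
     (\int[mu]_x (trace_J (phi n l) x ^+ 2)%:E)%E)//.
  apply: ae_eq_integral => //.
  + apply/measurable_EFinP; apply: measurable_funX; apply: measurable_indic.
    exact: measurable_cell.
  + by apply/measurable_EFinP; exact: measurable_funX.
  + by apply: ae_imply Jphi => x -> _.
- rewrite JE; apply: ae_imply2 Jphi wf => x Jx /(_ I) wx _.
  by rewrite [LHS]/(c * trace_J w x + s * trace_J (phi n l) x) Jx wx.
- split; first exact: flux_compl_lin (ltW l0) pc (phi_compl n l0).
  move=> v vc; have [vD _] := vc.
  have -> : c *: w + s *: phi n l - (c *: p + s *: phi n l) = c *: (w - p).
    by rewrite opprD addrACA subrr addr0 scalerBr.
  rewrite (bessel_lambdaZl l c (bessel_domB wD pD) vD) orth ?mulr0//.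
Qed.

(** Adding a multiple of the cell [n] to a trace: the projection of [phi n 0] is
    [phi n l], so its energy and its energy against a projected function do not
    exceed, respectively equal, those of the explicit function [phi n 0]. *)
Lemma trace_lambda_add_cell l c s f w p n : 0 < l -> trace_lift l f w p ->
  (trace_lambda a l (c *: f + s *: (\1_(@cell R n) : R -> R))%R <=
   (c ^+ 2 * bessel_lambda l p p + 2 * c * s * bessel_lambda l (phi n 0%R) p +
    s ^+ 2 * bessel_lambda l (phi n 0%R) (phi n 0%R))%:E)%E.
Proof.
move=> l0 tl; apply: le_trans (trace_lambda_le (trace_lift_lin c s n l0 tl)) _.
have [_ _ [[pD pc] _]] := tl.
have fD := phi_dom n l; have sD := bessel_domZ s fD; have gD := phi_dom n (0 : R).
have dD := bessel_domB gD fD; have [_ fc] := phi_compl n l0.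
have cD := bessel_domZ c pD; have csD := bessel_dom_lin c pD sD.
rewrite lee_fin (bessel_lambda_linl l c pD sD csD) (bessel_lambdaZl l s fD csD).
rewrite (bessel_lambda_linr l c pD sD pD) (bessel_lambda_linr l c pD sD fD).
rewrite (bessel_lambdaC l pD sD) (bessel_lambdaZl l s fD pD).
rewrite (bessel_lambdaC l fD sD) (bessel_lambdaZl l s fD fD) (bessel_lambdaC l fD pD).
have E1 : bessel_lambda l p (phi n l) = bessel_lambda l (phi n 0) p.
  have := pc _ (phi_ker n l); rewrite (bessel_lambdaC l pD dD).
  rewrite (bessel_lambdaBl l gD fD pD) (bessel_lambdaC l fD pD) => /eqP.
  by rewrite subr_eq0 => /eqP ->.
have E2 : bessel_lambda l (phi n l) (phi n l) <= bessel_lambda l (phi n 0) (phi n 0).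
  have := bessel_lambda_ge0 (ltW l0) dD; rewrite (bessel_lambdaBl l gD fD dD).
  rewrite (bessel_lambdaC l fD dD) (bessel_lambdaBl l gD fD fD).
  rewrite (bessel_lambdaC l gD dD) (bessel_lambdaBl l gD fD gD).
  have := fc _ (phi_ker n l); rewrite (bessel_lambdaC l fD dD) (bessel_lambdaBl l gD fD fD).
  rewrite (bessel_lambdaC l fD gD).
  move: (bessel_lambda l (phi n 0) (phi n 0)) (bessel_lambda l (phi n 0) (phi n l)).
  move: (bessel_lambda l (phi n l) (phi n l)) => A B C; lra.
rewrite E1; have := ler_wpM2l (sqr_ge0 s) E2.
move: (bessel_lambda l (phi n 0) p) (bessel_lambda l p p) (bessel_lambda l (phi n l) (phi n l)).
move=> A B C; nra.
Qed.

End trace_form.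

(** * The Mosco limit in the direction of a cell *)

Section mosco.
Variable R : realType.
Implicit Types (x y l e : R) (u v g p w f : R -> R).
Variable a : nat -> {posnum R}.
Notation mu := (trace_mu a).
Notation leb := (@lebesgue_measure R).
Variable E : (R -> R) -> \bar R.
Hypothesis HE : is_trace_form a E.
Notation chi n := (\1_(@cell R n) : R -> R).

Let ls (n : nat) : R := n.+1%:R^-1.

Let ls_gt0 n : 0 < ls n. Proof. by rewrite invr_gt0. Qed.

Let ls_cvg : ls n @[n --> \oo] --> (0 : R). Proof. exact: cvg_harmonic. Qed.

Lemma form_ge0 u : L2 mu u -> (0 <= E u)%E.
Proof.
move=> uL; have [_ /(_ u uL)[f_ [_ _ fE]]] := HE ls_gt0 ls_cvg.
apply: le_trans fE; rewrite leNgt; apply/negP => /limn_esup_lt H.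
have [n] := @filter_ex _ _ _ _ H; apply/negP; rewrite -leNgt.
exact: trace_lambda_ge0.
Qed.

Lemma form_domE u : form_dom mu E u -> exists2 e, 0 <= e & E u = e%:E.
Proof.
move=> [uL uy]; have u0 := form_ge0 uL.
exists (fine (E u)); first exact: fine_ge0.
by rewrite fineK// ge0_fin_numE.
Qed.

(** A recovery sequence represented by projected functions of the half-line. Their
    Hoelder and decay estimates thereby become available for the limit form. *)
Lemma form_recovery u e : form_dom mu E u -> E u = e%:E ->
  exists f_ : nat -> R -> R, [/\ forall n, L2 mu (f_ n), strong_cvg mu f_ u &
    forall d, 0 < d -> \forall n \near \oo, exists w p,
      trace_lift a n.+1%:R^-1 (f_ n) w p /\ bessel_lambda n.+1%:R^-1 p p <= e + d].
Proof.
move=> [uL _] uE; have [_ /(_ u uL)[f_ [fL fu fE]]] := HE ls_gt0 ls_cvg.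
exists f_; split => // d d0.
have H : (limn_esup (fun n => trace_lambda a (ls n) (f_ n)) < (e + d)%:E)%E.
  by apply: le_lt_trans fE _; rewrite uE lte_fin ltrDl.
apply: filterS (limn_esup_lt H) => n /trace_lambda_lt[w [p [tl pe]]].
by exists w, p.
Qed.

Lemma flux_form_node n u v : (forall k, (0 < k)%N -> u k%:R = v k%:R) ->
  flux_form n u = flux_form n v.
Proof.
move=> uv; rewrite /flux_form (uv n.+1)// (uv n.+2)//.
by case: n => [|n]; [rewrite !mul0r|rewrite (uv n.+1)].
Qed.

Lemma phi_cell n l (k : nat) : (0 < k)%N -> phi n l k%:R = chi n k%:R.
Proof.
move=> k0; have nk : node (k%:R : R) by right; exists k.
by rewrite phi_node// indicE cell_node.
Qed.

Let flux_form_cvg n (f_ : nat -> R -> R) u : (forall n, L2 mu (f_ n)) -> L2 mu u ->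
  strong_cvg mu f_ u -> flux_form n (f_ m) @[m --> \oo] --> flux_form n u.
Proof.
move=> fL uL fu; have hL := L2_flux_density a n.
have -> : flux_form n u = - L2dot mu u (flux_density a n).
  by rewrite L2dotC L2dot_flux_density// opprK.
have -> : (fun m => flux_form n (f_ m)) = (fun m => - L2dot mu (f_ m) (flux_density a n)).
  by apply/funext => m; rewrite L2dotC L2dot_flux_density// opprK.
by apply: cvgN; exact: L2dot_cvg.
Qed.

(* The bookkeeping of errors: [B] stands for the energy of the recovery sequence,
   [q'] for the limit of its fluxes [q], and [d], [X] for the contributions of the
   term [l |.|^2], which vanish as [l] tends to 0. *)
Let quad_bound (c s e d q q' r B X l eta T : R) :
  0 < eta -> T = `|2 * c * s| + 1 ->
  B <= e + eta / 4 / (c ^+ 2 + 1) ->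
  `|q - q'| <= eta / 4 / T -> `|d| <= eta / 4 / T ->
  s ^+ 2 * X <= eta / 4 ->
  c ^+ 2 * B + 2 * c * s * (q + d) + s ^+ 2 * (r + X) <=
  c ^+ 2 * e + 2 * c * s * q' + s ^+ 2 * r + eta.
Proof.
move=> eta0 TE hB hq hd hX.
have T0 : 0 < T by rewrite TE ltr_wpDl.
have c1 : 0 < c ^+ 2 + 1 by rewrite ltr_wpDl// sqr_ge0.
have H1 : c ^+ 2 * B <= c ^+ 2 * e + eta / 4.
  have := ler_wpM2l (sqr_ge0 c) hB; rewrite mulrDr => /le_trans; apply.
  rewrite lerD2l mulrA ler_pdivrMr// mulrC ler_wpM2l ?divr_ge0 ?(ltW eta0)//.
  by rewrite lerDl.
have H2 z : `|z| <= eta / 4 / T -> 2 * c * s * z <= eta / 4.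
  move=> hz; apply: le_trans (ler_norm _) _; rewrite normrM.
  have : `|2 * c * s| * `|z| <= T * `|z| by rewrite ler_wpM2r// TE lerDl.
  move=> /le_trans; apply; move: hz; rewrite ler_pdivlMr// mulrC; exact.
have := H2 _ hq; have := H2 _ hd; move: H1 hX.
rewrite !(mulrDr (2 * c * s)) (mulrDr (s ^+ 2)) mulrN.
move: (c ^+ 2 * B) (c ^+ 2 * e) (2 * c * s * q) (2 * c * s * q') (2 * c * s * d).
move: (s ^+ 2 * X) (s ^+ 2 * r) => *; lra.
Qed.

(** Adding a multiple of the cell to a recovery sequence gives a competitor for the
    lower bound of the Mosco limit; the mixed term [flux_form] is continuous in
    [L^2] because it only involves the values at atoms. *)
Lemma form_add_cell_le n c s u e : form_dom mu E u -> E u = e%:E ->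
  (E (c *: u + s *: chi n)%R <=
   (c ^+ 2 * e + 2 * c * s * flux_form n u + s ^+ 2 * flux_form n (chi n))%:E)%E.
Proof.
move=> uD uE; have [uL _] := uD; have [f_ [fL fu rec]] := form_recovery uD uE.
have cL := L2_cell a n.
apply/lee_addgt0Pr => eta eta0.
have [M1 _] := HE ls_gt0 ls_cvg.
have := M1 (fun m => c *: f_ m + s *: chi n) (c *: u + s *: chi n).
move=> /(_ _ _ _)M1'; apply: le_trans (M1' _ _ _) _.
- by move=> m; apply: L2_lin => //; exact: L2_Z.
- by apply: L2_lin => //; exact: L2_Z.
- move=> g gL.
  have dE v : L2 mu v -> L2dot mu (c *: v + s *: chi n) g = c * L2dot mu v g + s * L2dot mu (chi n) g.
    move=> vL; rewrite (L2dotDl (L2_Z c vL) (L2_Z s cL) gL).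
    by rewrite (L2dotZl c vL gL) (L2dotZl s cL gL).
  rewrite dE//; have -> : (fun m => L2dot mu (c *: f_ m + s *: chi n) g) =
      (fun m => c * L2dot mu (f_ m) g + s * L2dot mu (chi n) g).
    by apply/funext => m; rewrite dE.
  apply: cvgD; last exact: cvg_cst.
  by apply: cvgM; [exact: cvg_cst|exact: L2dot_cvg].
apply: limn_einf_le; rewrite -EFinD.
have fD := phi_dom n (0 : R); have [_ phL _] := fD.
have xphL := L2_bessel_m phL.
pose T := `|2 * c * s| + 1; have T0 : 0 < T by rewrite ltr_wpDl.
pose X := L2dot leb (xmul (phi n 0)) (xmul (phi n 0)).
have X0 : 0 <= X by exact: L2dot_ge0.
pose d1 := eta / 4 / (c ^+ 2 + 1).
have d10 : 0 < d1 by rewrite divr_gt0 ?divr_gt0// ltr_wpDl// sqr_ge0.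
pose d2 := eta / 4 / T; have d20 : 0 < d2 by rewrite divr_gt0 ?divr_gt0.
have e0 : 0 <= e by have := form_ge0 uL; rewrite uE lee_fin.
pose D := 2 * X * (e + d1) + 1.
have D0 : 0 < D by rewrite ltr_wpDl// mulr_ge0 ?mulr_ge0// addr_ge0// ltW.
pose D' := 2 * s ^+ 2 * X + 1.
have D'0 : 0 < D' by rewrite ltr_wpDl// mulr_ge0// mulr_ge0// sqr_ge0.
have near1 := harmonic_near (divr_gt0 (exprn_gt0 2 d20) D0).
have near2 := harmonic_near (divr_gt0 (divr_gt0 eta0 (ltr0Sn R 3)) D'0).
have near3 : \forall m \near \oo, `|flux_form n (f_ m) - flux_form n u| <= d2.
  have /cvgrPdist_le/(_ _ d20) := (flux_form_cvg fL uL fu : flux_form n (f_ x) @[x --> \oo] --> flux_form n u).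
  by apply: filterS => m; rewrite distrC.
have near4 := rec _ d10.
near=> m.
have [w [p [tl pB]]] : exists w p, trace_lift a m.+1%:R^-1 (f_ m) w p /\
  bessel_lambda m.+1%:R^-1 p p <= e + d1 by near: m.
have pD := trace_lift_dom tl; have [_ pL _] := pD; have xpL := L2_bessel_m pL.
apply: le_trans (trace_lambda_add_cell c s n (ls_gt0 m) tl) _; rewrite lee_fin.
pose d := 2 * ls m * L2dot leb (xmul (phi n 0)) (xmul p).
have B1 : bessel_lambda (ls m) (phi n 0) p = flux_form n (f_ m) + d.
  rewrite /bessel_lambda (bessel_phi0 n pD) (integral_bessel_m phL pL) /d.
  rewrite (@flux_form_node n (f_ m) p); last by move=> k k0; exact: trace_lift_atom tl k0.
  by congr (_ + _); rewrite mulrCA mulrA.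
have B2 : bessel_lambda (ls m) (phi n 0) (phi n 0) = flux_form n (chi n) + 2 * ls m * X.
  rewrite /bessel_lambda (bessel_phi0 n fD) (integral_bessel_m phL phL).
  rewrite (@flux_form_node n (phi n 0) (chi n)); last by move=> k k0; exact: phi_cell.
  by congr (_ + _); rewrite mulrCA mulrA.
rewrite B1 B2; apply: (@quad_bound _ _ _ _ _ _ _ _ _ (ls m) _ T) => //.
- by near: m.
- have H1 : d ^+ 2 <= 2 * ls m * X * (e + d1).
    have := L2dot_CS xphL xpL; rewrite -/X => CS.
    have l2 : 0 <= 2 * ls m by rewrite mulr_ge0// ltW.
    have pp : 2 * ls m * L2dot leb (xmul p) (xmul p) <= e + d1.
      apply: le_trans pB; rewrite /bessel_lambda (integral_bessel_m pL pL).
      rewrite [ls m * _]mulrCA mulrA lerDr; exact: bessel_ge0.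
    rewrite /d exprMn; apply: (@le_trans _ _ ((2 * ls m) ^+ 2 * (X * L2dot leb (xmul p) (xmul p)))).
      by rewrite ler_wpM2l ?sqr_ge0.
    rewrite (_ : _ * (X * _) = 2 * ls m * X * (2 * ls m * L2dot leb (xmul p) (xmul p))); last by ring.
    by rewrite ler_wpM2l// mulr_ge0.
  rewrite -ler_sqr ?nnegrE ?(ltW d20)// real_normK ?num_real//.
  apply: le_trans H1 _.
  have : ls m <= d2 ^+ 2 / D by near: m.
  rewrite ler_pdivlMr// => /(le_trans _); apply.
  rewrite (_ : 2 * ls m * X * (e + d1) = ls m * (2 * X * (e + d1))); last by ring.
  by rewrite ler_wpM2l ?(ltW (ls_gt0 m))// lerDl.
- have : ls m <= eta / 4 / D' by near: m.
  rewrite ler_pdivlMr// => /(le_trans _); apply.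
  rewrite (_ : s ^+ 2 * _ = ls m * (2 * s ^+ 2 * X)); last by ring.
  by rewrite ler_wpM2l ?(ltW (ls_gt0 m))// lerDl.
Unshelve. all: by end_near. Qed.

Lemma form_dom0 : form_dom mu E 0.
Proof.
split; first exact: L2_0.
have [M1 _] := HE ls_gt0 ls_cvg.
have z0 : L2 mu (0 : R -> R) by exact: L2_0.
have wc : weak_cvg mu (fun _ => 0 : R -> R) 0 by move=> g gL; exact: cvg_cst.
apply: le_lt_trans (M1 (fun=> 0) 0 (fun=> z0) z0 wc) _.
apply: (@le_lt_trans _ _ 0%E); last exact: ltry.
apply: limn_einf_le; apply: nearW => m.
have zD : bessel_dom (0 : R -> R).
  by rewrite -(scale0r (phi 0 (0 : R))); apply: bessel_domZ; exact: phi_dom.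
have z v : bessel_dom v -> bessel_lambda (ls m) (0 : R -> R) v = 0.
  move=> vD; have -> : (0 : R -> R) = 0 *: v by rewrite scale0r.
  by rewrite (bessel_lambdaZl _ 0 vD vD) mul0r.
have J0 : trace_J (0 : R -> R) = 0.
  by apply/funext => x; rewrite /trace_J patchE; case: ifP.
have tl : trace_lift a (ls m) 0 0 0.
  split; first by split => //; rewrite J0.
    by rewrite J0; exact: ae_eq_refl.
  split; first by split => // v [vD _ _]; exact: z.
  by move=> v [vD _]; rewrite subrr; exact: z.
by apply: le_trans (trace_lambda_le tl) _; rewrite z.
Qed.

Lemma form_dom_add_cell n c s u : form_dom mu E u -> form_dom mu E (c *: u + s *: chi n).
Proof.
move=> uD; have [uL _] := uD; have [e _ uE] := form_domE uD.
split; first by apply: L2_lin => //; apply: L2_Z; exact: L2_cell.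
by apply: le_lt_trans (form_add_cell_le n c s uD uE) _; rewrite ltry.
Qed.

Lemma form_dom_cell n : form_dom mu E (chi n).
Proof.
have := form_dom_add_cell n 1 1 form_dom0.
by rewrite !scale1r add0r.
Qed.

Let flux_lin n c s u v : flux_form n (c *: u + s *: v) = c * flux_form n u + s * flux_form n v.
Proof.
rewrite /flux_form.
have E1 x : (c *: u + s *: v) x = c * u x + s * v x by [].
by rewrite !E1; ring.
Qed.

(** The inequality of [form_add_cell_le] can be inverted, so it is an equality:
    the form is quadratic in the direction of a cell. *)
Lemma form_add_cell n c s u : c ^+ 2 = 1 -> form_dom mu E u ->
  fine (E (c *: u + s *: chi n)) =
  fine (E u) + 2 * c * s * flux_form n u + s ^+ 2 * flux_form n (chi n).
Proof.
move=> c2 uD; have [e e0 uE] := form_domE uD.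
have vD := form_dom_add_cell n c s uD; have [e' _ vE] := form_domE vD.
have le1 := form_add_cell_le n c s uD uE.
have le2 := form_add_cell_le n c (- (c * s)) vD vE.
have uv : c *: (c *: u + s *: chi n) + - (c * s) *: chi n = u.
  by rewrite scalerDr !scalerA -expr2 c2 scale1r scaleNr addrK.
move: le1 le2; rewrite uv uE vE !lee_fin c2 !mul1r flux_lin /=.
set q := flux_form n u; set r := flux_form n (chi n) => le1 le2.
apply/eqP; rewrite eq_le le1 /=.
have -> : e + 2 * c * s * q + s ^+ 2 * r = e + (2 * c * s * q + s ^+ 2 * r) by ring.
have E1 : 2 * c * - (c * s) * (c * q + s * r) + (- (c * s)) ^+ 2 * r =
    - (2 * c ^+ 2 * (c * s * q)) - c ^+ 2 * s ^+ 2 * r by ring.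
by move: le2; rewrite -addrA E1 c2; lra.
Qed.

(** Since [flux_form n] is bounded on [L^2], the indicators of the cells belong to
    the domain of the generator. *)
Lemma form_bilin_cell n u : form_dom mu E u -> form_bilin E (chi n) u = flux_form n u.
Proof.
move=> uD; rewrite /form_bilin.
have -> : chi n + u = 1 *: u + 1 *: chi n by rewrite !scale1r addrC.
have -> : chi n - u = -1 *: u + 1 *: chi n by rewrite scaleN1r scale1r addrC.
rewrite !form_add_cell// ?sqrrN ?expr1n//; lra.
Qed.

End mosco.

(** * Transience *)

Section chebyshev.
Context {d : measure_display} {T : measurableType d} {R : realType}.
Variable mu : {measure set T -> \bar R}.
Implicit Types (f u : T -> R) (B : set T).

Lemma L2_chebyshev f B dl : L2 mu f -> measurable B -> 0 <= dl ->
  {ae mu, forall x, B x -> dl <= `|f x|} -> ((dl ^+ 2)%:E * mu B <= (L2dot mu f f)%:E)%E.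
Proof.
move=> fL mB dl0 H; have mf := L2_measurable fL; rewrite -L2dot_sqrE//.
have -> : ((dl ^+ 2)%:E * mu B = \int[mu]_x ((dl ^+ 2)%:E * (\1_B x)%:E))%E.
  rewrite ge0_integralZl ?integral_indic ?setIT//.
  + by apply/measurable_EFinP; exact: measurable_indic.
  + by rewrite lee_fin sqr_ge0.
apply: ae_ge0_le_integral => //.
- by move=> x _; rewrite -EFinM lee_fin mulr_ge0// sqr_ge0.
- by apply: measurable_funeM; apply/measurable_EFinP; exact: measurable_indic.
- by move=> x _; rewrite lee_fin sqr_ge0.
- by apply/measurable_EFinP; exact: measurable_funX.
apply: ae_imply H => x Hx _; rewrite -EFinM lee_fin indicE.
have [xB|_] := boolP (x \in B); last by rewrite mulr0 sqr_ge0.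
rewrite mulr1 -[leRHS]real_normK ?num_real// ler_sqr ?nnegrE//.
by apply: Hx; rewrite -in_setE.
Qed.

(** Chebyshev's inequality. It transfers pointwise information on the approximating
    functions to their strong limit, and conversely. *)
Lemma strong_cvg_not_away (f_ : nat -> T -> R) u B dl : (forall n, L2 mu (f_ n)) ->
  L2 mu u -> strong_cvg mu f_ u -> measurable B -> 0 < dl -> (0 < mu B)%E ->
  \forall n \near \oo, ~ {ae mu, forall x, B x -> dl <= `|f_ n x - u x|}.
Proof.
move=> fL uL /(strong_cvgP fL uL) fu mB dl0 B0.
have [e e0 eB] : exists2 e : R, 0 < e & (e%:E < mu B)%E.
  case: (mu B) B0 => [r| |//]; last by exists 1 => //; exact: ltry.
  rewrite lte_fin => r0; exists (r / 2); first by rewrite divr_gt0.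
  by rewrite lte_fin; lra.
have dl2 : 0 < dl ^+ 2 by rewrite exprn_gt0.
have /cvgrPdist_le/(_ _ (mulr_gt0 dl2 e0)) := fu.
apply: filterS => n; rewrite sub0r normrN ger0_norm ?L2dot_ge0// => le2 Hn.
have := L2_chebyshev (L2_B (fL n) uL) mB (ltW dl0) Hn.
have le2E : ((L2dot mu (f_ n - u) (f_ n - u))%:E <= (dl ^+ 2 * e)%:E)%E by rewrite lee_fin.
move=> /le_trans/(_ le2E).
by rewrite (EFinM _ e) lee_pmul2l// ?lte_fin// leNgt eB.
Qed.

Lemma strong_cvg_null (f_ : nat -> T -> R) u B dl : (forall n, L2 mu (f_ n)) ->
  L2 mu u -> strong_cvg mu f_ u -> measurable B -> 0 < dl ->
  (\forall n \near \oo, {ae mu, forall x, B x -> dl <= `|f_ n x - u x|}) -> mu B = 0%E.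
Proof.
move=> fL uL fu mB dl0 H; apply/eqP; rewrite eq_le measure_ge0 andbT leNgt.
apply/negP => B0; have H' := strong_cvg_not_away fL uL fu mB dl0 B0.
by have [n [Hn]] := @filter_ex _ _ _ _ (filterI H H').
Qed.

End chebyshev.

Section transience.
Variable R : realType.
Implicit Types (x y l e : R) (u v g p w f : R -> R).
Variable a : nat -> {posnum R}.
Notation mu := (trace_mu a).
Variable E : (R -> R) -> \bar R.
Hypothesis HE : is_trace_form a E.

Let measurable_sqrtr : measurable_fun setT (Num.sqrt : R -> R).
Proof. by apply: continuous_measurable_fun => x; exact: sqrt_continuous. Qed.

(** [bessel_decay] for a recovery sequence and Chebyshev's inequality, with a margin
    [d] that tends to 0. The factor [sqrt x] makes the margin uniform near 0. *)
Lemma form_decay u : form_dom mu E u ->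
  {ae mu, forall x, node x /\ `|u x| * Num.sqrt x <= Num.sqrt (fine (E u))}.
Proof.
move=> uD; have [uL _] := uD; have [e e0 uE] := form_domE HE uD; rewrite uE /=.
have [f_ [fL fu rec]] := form_recovery HE uD uE; have mu_ := L2_measurable uL.
have key (d : R) : 0 < d -> {ae mu, forall x,
    node x -> `|u x| * Num.sqrt x < Num.sqrt e + d * (1 + Num.sqrt x)}.
  move=> d0.
  pose B := [set x | node x] `&`
    [set x | Num.sqrt e + d * (1 + Num.sqrt x) <= `|u x| * Num.sqrt x].
  have mB : measurable B.
    apply: measurable_fun_le => //; first exact: measurable_node.
      apply: measurable_funD => //; apply: measurable_funM => //.
      apply: measurable_funD => //; exact: measurable_funTS.
    apply: measurable_funM; last exact: measurable_funTS.
    by apply: measurableT_comp => //; exact: measurable_funTS.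
  have B0 : mu B = 0%E.
    apply: (strong_cvg_null fL uL fu mB d0).
    apply: filterS (rec _ (exprn_gt0 2 d0)) => n [w [p [tl pe]]].
    have n0 : 0 < n.+1%:R^-1 :> R by rewrite invr_gt0.
    apply: ae_imply (trace_lift_ae n0 tl) => x.
    move=> [nx ->] [_ /= hB]; have x0 := node_gt0 nx; have pD := trace_lift_dom tl.
    have s0 : 0 < Num.sqrt x by rewrite sqrtr_gt0.
    have hp : `|p x| * Num.sqrt x <= Num.sqrt e + d.
      rewrite -ler_sqr ?nnegrE ?mulr_ge0 ?addr_ge0 ?sqrtr_ge0 ?(ltW d0)//.
      rewrite exprMn real_normK ?num_real// sqr_sqrtr ?(ltW x0)//.
      apply: (@le_trans _ _ (e + d ^+ 2)).
        rewrite -ler_pdivlMr//; apply: le_trans (bessel_decay pD x0) _.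
        rewrite ler_wpM2r ?invr_ge0 ?(ltW x0)//; apply: le_trans pe.
        by apply: bessel_le_lambda => //; rewrite invr_ge0.
      rewrite sqrrD sqr_sqrtr// lerD2r lerDl mulrn_wge0// mulr_ge0 ?sqrtr_ge0//.
      exact: ltW.
    rewrite -(ler_pM2r s0); apply: (@le_trans _ _ ((`|u x| - `|p x|) * Num.sqrt x)).
      by rewrite mulrBl; lra.
    by rewrite ler_wpM2r ?(ltW s0)// distrC lerB_dist.
  exists B; split => // x /=; apply: contra_notP => nB nx.
  by rewrite ltNge; apply/negP => h; apply: nB; split.
have kall : {ae mu, forall x, forall n : nat,
    node x -> `|u x| * Num.sqrt x < Num.sqrt e + n.+1%:R^-1 * (1 + Num.sqrt x)}.
  by apply: ae_foralln => n; apply: key; rewrite invr_gt0.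
apply: ae_imply2 kall (ae_node a) => x H nx; split=> //.
apply/ler_addgt0Pr => d d0; have s0 : 0 < 1 + Num.sqrt x by rewrite ltr_wpDr ?sqrtr_ge0.
have [n] := @filter_ex _ _ _ _ (harmonic_near (divr_gt0 d0 s0)).
rewrite ler_pdivlMr// => hn; apply/ltW/(lt_le_trans (H n nx)).
by rewrite lerD2l.
Qed.

End transience.

Section transient.
Variable R : realType.
Implicit Types (x y l e : R) (u v g p w f : R -> R).
Variable a : nat -> {posnum R}.
Notation mu := (trace_mu a).

Lemma trace_mu_cell_fin n : (mu (@cell R n) < +oo)%E.
Proof.
case: n => [|n]; first exact: trace_mu_unit_fin.
by rewrite [cell _]/= (@trace_mu_atom R a n.+2)// ltry.
Qed.

Lemma node_cell x : node x -> exists n, x \in @cell R n.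
Proof.
case=> [x01|[[//|[|k]] _ ->]].
- by exists 0%N; rewrite inE/= in_itv.
- by exists 0%N; rewrite inE/= in_itv/= ltr01 lexx.
- by exists k.+1; rewrite inE.
Qed.

(* The weights are chosen such that both their sum and the sum of the weighted
   masses of the cells are at most 1. *)
Let cw (n : nat) : R := 1 / (2 ^ n.+1)%:R / (1 + fine (mu (@cell R n))).

Let den_gt0 n : 0 < 1 + fine (mu (@cell R n)).
Proof. by rewrite ltr_wpDr// fine_ge0. Qed.

Let pow_gt0 n : 0 < 1 / (2 ^ n.+1)%:R :> R.
Proof. by rewrite divr_gt0// ltr0n expn_gt0. Qed.

Let cw_gt0 n : 0 < cw n. Proof. by rewrite divr_gt0. Qed.

Let cw_le n : cw n <= 1 / (2 ^ n.+1)%:R.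
Proof. by rewrite /cw ler_pdivrMr// ler_peMr ?(ltW (pow_gt0 n))// lerDl; exact: fine_ge0. Qed.

Let cw_cell_le n : ((cw n)%:E * mu (@cell R n) <= (1 / (2 ^ n.+1)%:R)%:E)%E.
Proof.
rewrite -[mu _]fineK ?ge0_fin_numE ?trace_mu_cell_fin// -EFinM lee_fin.
by rewrite /cw mulrAC ler_pdivrMr// ler_wpM2l ?(ltW (pow_gt0 n))// lerDr.
Qed.

Let term (k : nat) x : \bar R := (cw k * \1_(@cell R k) x)%:E.

Let term_ge0 k x : (0 <= term k x)%E.
Proof. by rewrite lee_fin indicE mulr_ge0 ?(ltW (cw_gt0 k)). Qed.

Let m_term k : measurable_fun setT (term k).
Proof.
apply/measurable_EFinP; apply: measurable_funM => //.
by apply: measurable_indic; exact: measurable_cell.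
Qed.

Let W x : \bar R := (\sum_(0 <= k <oo) term k x)%E.

Let W_ge0 x : (0 <= W x)%E. Proof. by apply: nneseries_ge0 => k _ _; exact: term_ge0. Qed.

Let W_le1 x : (W x <= 1)%E.
Proof.
apply: le_trans (@epsilon_trick0 R 1 xpredT ler01).
apply: lee_nneseries => [i _ _|n _]; first exact: term_ge0.
rewrite lee_fin indicE; apply: le_trans (cw_le n).
by case: (_ \in _); rewrite ?mulr1// mulr0 ltW// cw_gt0.
Qed.

Let m_W : measurable_fun setT W.
Proof. by apply: ge0_emeasurable_sum => // k x _ _; exact: term_ge0. Qed.

Let W_fin x : (fine (W x))%:E = W x.
Proof. by rewrite fineK// ge0_fin_numE//; apply: le_lt_trans (W_le1 x) _; rewrite ltry. Qed.

Let int_W : (\int[mu]_x W x <= 1)%E.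
Proof.
rewrite integral_nneseries//.
apply: le_trans (@epsilon_trick0 R 1 xpredT ler01).
apply: lee_nneseries => [i _ _|n _]; first by apply: integral_ge0 => x _; exact: term_ge0.
have -> : (\int[mu]_x term n x = (cw n)%:E * mu (@cell R n))%E; last exact: cw_cell_le.
have mc := @measurable_cell R n.
under eq_integral do rewrite /term EFinM.
rewrite ge0_integralZl ?integral_indic ?setIT//.
- by apply/measurable_EFinP; exact: measurable_indic.
- by rewrite lee_fin ltW.
Qed.

Let W_node x : node x -> (0 < W x)%E.
Proof.
move=> /node_cell[n xn].
apply: (@lt_le_trans _ _ (\sum_(0 <= k < n.+1) term k x)%E); last first.
  by apply: nneseries_lim_ge => k _ _; exact: term_ge0.
rewrite big_nat_recr//=; apply: (@lt_le_trans _ _ (term n x)).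
  by rewrite lte_fin indicE xn mulr1.
by rewrite leeDr//; apply: sume_ge0 => k _; exact: term_ge0.
Qed.

(** The measure is sigma-finite, because the cells have finite mass. *)
Lemma trace_mu_weight : exists w : R -> R,
  [/\ measurable_fun setT w, forall x, 0 <= w x <= 1, forall x, node x -> 0 < w x &
    (\int[mu]_x (w x)%:E <= 1)%E].
Proof.
exists (fine \o W); split.
- by apply: measurableT_comp => //; exact: fine_measurable.
- by move=> x; rewrite -!lee_fin W_fin W_ge0 W_le1.
- by move=> x nx; rewrite -lte_fin W_fin W_node.
- by under eq_integral do rewrite /= W_fin.
Qed.

Lemma measurable_trace_F : measurable (@trace_F R).
Proof.
apply: measurableU => //.
rewrite (_ : [set k%:R | k in _] = \bigcup_k [set k.+1%:R]).
  exact: bigcup_measurable.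
apply/seteqP; split => [x [[//|k] _ <-]|x [k _ /= ->]]; first by exists k.
by exists k.+1.
Qed.

Lemma transient_trace_form (E : (R -> R) -> \bar R) : is_trace_form a E ->
  transient mu (@trace_F R) E.
Proof.
move=> HE; have [w [mw w01 wn iw]] := trace_mu_weight.
have ms : measurable_fun setT (Num.sqrt : R -> R).
  by apply: continuous_measurable_fun => x; exact: sqrt_continuous.
pose g x := w x * Num.min 1 (Num.sqrt x).
have mF := measurable_trace_F.
have w0 x : 0 <= w x by case/andP: (w01 x).
have s0 x : 0 <= Num.min 1 (Num.sqrt x) by rewrite le_min ler01 sqrtr_ge0.
have g0 x : 0 <= g x by rewrite mulr_ge0.
have gw x : g x <= w x by rewrite ler_piMr// ge_min lexx.
have mg : measurable_fun setT g.
  by apply: measurable_funM => //; exact: measurable_minr.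
have iF (h : R -> R) : measurable_fun setT h -> (forall x, 0 <= h x) ->
    (\int[mu]_(x in @trace_F R) (h x)%:E <= \int[mu]_x (h x)%:E)%E.
  move=> mh h0; apply: ge0_subset_integral => //; first exact/measurable_EFinP.
  by move=> x _; rewrite lee_fin.
exists g; split.
- apply/integrableP; split.
    by apply/measurable_EFinP; exact: measurable_funTS.
  apply: (@le_lt_trans _ _ 1%E); last by rewrite ltry.
  under eq_integral do rewrite /= ger0_norm//.
  apply: le_trans (iF _ mg g0) _; apply: le_trans iw.
  apply: ge0_le_integral => //.
  + by move=> x _; rewrite lee_fin.
  + exact/measurable_EFinP.
  + exact/measurable_EFinP.
  + by move=> x _; rewrite lee_fin.
- exists 1 => x _; rewrite ger0_norm//; apply: le_trans (gw x) _.
  by case/andP: (w01 x).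
- apply: ae_imply (ae_node a) => x nx _; rewrite mulr_gt0 ?wn// lt_min ltr01 sqrtr_gt0.
  exact: node_gt0.
- move=> u uD; have [uL _] := uD; have mu_ := L2_measurable uL.
  have mug : measurable_fun setT (fun x => `|u x| * g x).
    by apply: measurable_funM => //; exact: measurableT_comp.
  apply: le_trans (iF _ mug _) _; first by move=> x; rewrite mulr_ge0.
  set c := Num.sqrt _; have c0 : 0 <= c by exact: sqrtr_ge0.
  apply: (@le_trans _ _ (\int[mu]_x (c%:E * (w x)%:E))%E).
    apply: ae_ge0_le_integral => //.
    + by move=> x _; rewrite lee_fin mulr_ge0.
    + exact/measurable_EFinP.
    + by move=> x _; rewrite -EFinM lee_fin mulr_ge0.
    + by apply: measurable_funeM; exact/measurable_EFinP.
    apply: ae_imply (form_decay HE uD) => x [nx hx] _; rewrite -EFinM lee_fin /g.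
    rewrite mulrCA (mulrC c) ler_wpM2l//; apply: le_trans hx.
    by rewrite ler_wpM2l// ge_min lexx orbT.
  rewrite ge0_integralZl//; last 2 first.
  + exact/measurable_EFinP.
  + by move=> x _; rewrite lee_fin.
  by rewrite -[leRHS]mule1 lee_wpmul2l// lee_fin.
Qed.

End transient.

(** * Two-valued functions in the domain of the trace form *)

Section two_valued.
Variable R : realType.
Implicit Types (x y l e t : R) (u v g p w f : R -> R).
Variable a : nat -> {posnum R}.
Notation mu := (trace_mu a).
Variable E : (R -> R) -> \bar R.
Hypothesis HE : is_trace_form a E.

Let osc p x t (B : R) : bessel_dom p -> 0 < t -> t <= x -> bessel p p <= B -> 0 < B ->
  t^-1 - x^-1 <= (64 * B)^-1 -> `|p t - p x| <= 8^-1.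
Proof.
move=> pD t0 tx pB B0 h; have b0 := bessel_ge0 pD.
have tx0 : 0 <= t^-1 - x^-1 by rewrite subr_ge0 lef_pV2// posrE; lra.
have H : (p x - p t) ^+ 2 <= 8^-1 ^+ 2.
  apply: le_trans (bessel_holder pD t0 tx) _.
  apply: (@le_trans _ _ (B * (64 * B)^-1)); first exact: ler_pM.
  have -> : B * (64 * B)^-1 = 64^-1 by field; rewrite gt_eqF.
  by rewrite exprVn lef_pV2 ?posrE//; lra.
by rewrite distrC -ler_sqr ?nnegrE// real_normK ?num_real.
Qed.

(** A two-valued function cannot jump: its approximations of bounded energy are
    uniformly Hoelder continuous away from the origin, so by Chebyshev's inequality
    they cannot stay close to one value and then to the other one.  The points
    1 / (1 + i rho) lead from 1 to 0 by steps of small oscillation. *)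
Lemma form_dom_two_valued u : form_dom mu E u ->
  (forall x, 0 < x <= 1 -> u x = 0 \/ u x = 1) ->
  {ae mu, forall x, 0 < x <= 1 -> u x = u 1}.
Proof.
move=> uD u01; have [uL _] := uD; have [e e0 uE] := form_domE HE uD.
have [f_ [fL fu rec]] := form_recovery HE uD uE; have mu_ := L2_measurable uL.
pose B := e + 1; have B0 : 0 < B by rewrite ltr_wpDl.
pose rho := (64 * B)^-1; have rho0 : 0 < rho by rewrite invr_gt0 mulr_gt0.
pose xx (i : nat) := (1 + i%:R * rho)^-1.
have d0 (i : nat) : 0 < 1 + i%:R * rho by rewrite ltr_wpDr// mulr_ge0// ltW.
have xx0 i : 0 < xx i by rewrite invr_gt0.
have xxS i : xx i.+1 < xx i.
  by rewrite /xx ltf_pV2 ?posrE// ltrD2l ltr_pM2r// ltr_nat.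
have xx1 i : xx i <= 1.
  by rewrite /xx invf_le1// lerDl mulr_ge0// ltW.
have xxV i t : xx i.+1 <= t -> t^-1 - (xx i)^-1 <= (64 * B)^-1.
  move=> h; have t0 : 0 < t by apply: lt_le_trans h.
  have : t^-1 <= (xx i.+1)^-1 by rewrite lef_pV2 ?posrE.
  rewrite /xx !invrK -/rho -natr1 mulrDl mul1r; lra.
pose good n x := exists w p, [/\ trace_lift a n.+1%:R^-1 (f_ n) w p,
  bessel p p <= B & `|p x - u 1| <= 4^-1].
have nV n : 0 < n.+1%:R^-1 :> R by rewrite invr_gt0.
have bB n w p : trace_lift a n.+1%:R^-1 (f_ n) w p -> bessel_lambda n.+1%:R^-1 p p <= B ->
    bessel p p <= B.
  move=> tl; apply: le_trans; apply: bessel_le_lambda (ltW (nV n)) _.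
  exact: trace_lift_dom tl.
have u1 : u 1 = 0 \/ u 1 = 1 by apply: u01; rewrite ltr01 lexx.
have start : \forall n \near \oo, good n (xx 0%N).
  have -> : xx 0%N = 1 by rewrite /xx mul0r addr0 invr1.
  have := L2dot_cvg fL uL (L2_atom a (ltn0Sn 0)) fu.
  rewrite L2dotC L2dot_atom//.
  under eq_fun do rewrite L2dotC L2dot_atom//.
  have a1 : 0 < (a 1)%:num / 4 by [].
  move=> /cvgrPdist_le/(_ _ a1) H.
  apply: filterS2 H (rec 1 ltr01) => n H [w [p [tl pB]]]; exists w, p; split => //.
    exact: (bB _ _ _ tl pB).
  rewrite -(trace_lift_atom (k := 1) (nV n) tl)// distrC.
  by move: H; rewrite -mulrBr normrM gtr0_norm// ler_pM2l.
have step i : (\forall n \near \oo, good n (xx i)) ->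
    (\forall n \near \oo, good n (xx i.+1)) /\
    {ae mu, forall t, xx i.+1 <= t <= xx i -> u t = u 1}.
  move=> gi; pose x := xx i; pose y := xx i.+1; have yx : y < x := xxS i.
  have D0 : {ae mu, forall t, y <= t <= x -> u t = u 1}.
    pose D := `[y, x]%classic `&` [set t | 1 <= `|u t - u 1|].
    have mD : measurable D.
      apply: measurable_fun_le => //; apply: measurable_funTS.
      by apply: measurableT_comp => //; exact: measurable_funB.
    have Dn : mu D = 0%E.
      apply: (@strong_cvg_null _ _ _ mu f_ u D 2^-1) => //.
      apply: filterS gi => n [w [p [tl pB px]]].
      apply: ae_imply (trace_lift_ae (nV n) tl) => t [nt ->].
      rewrite /D /= in_itv/= => -[/andP[yt tx] ut].
      have /(_ B) := osc (trace_lift_dom tl) (node_gt0 nt) tx.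
      move=> /(_ pB B0 (xxV i t yt)) pt.
      have H1 := ler_distD (p t) (u t) (u 1); have H2 := ler_distD (p x) (p t) (u 1).
      move: H1; rewrite (distrC (u t) (p t)) => H1; move: ut pt px H1 H2; rewrite -/x; lra.
    exists D; split => // t /= ut; apply: contra_notP ut => nD yt.
    have nlt : ~ 1 <= `|u t - u 1| by move=> h; apply: nD; split => //=; rewrite in_itv.
    have t01 : 0 < t <= 1.
      by case/andP: yt => yt tx; rewrite (lt_le_trans (xx0 _) yt) (le_trans tx (xx1 _)).
    apply: contra_notP nlt; case: (u01 t t01) u1 => -> [] -> //.
      by rewrite sub0r normrN normr1.
    by rewrite subr0 normr1.
  split => //.
  have i8 : 0 < 8^-1 :> R by [].
  have := strong_cvg_not_away fL uL fu (measurable_itv `[y, x]) i8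
    (trace_mu_itv_gt0 a (xx0 _) yx (xx1 i)).
  move=> away; apply: filterS2 away gi => n away [w [p [tl pB px]]].
  exists w, p; split => //; rewrite leNgt; apply/negP => py; apply: away.
  apply: ae_imply2 (trace_lift_ae (nV n) tl) D0 => t [nt ->] ut.
  rewrite /= in_itv/= => /[dup] /ut -> /andP[yt tx].
  have tV : y^-1 - t^-1 <= (64 * B)^-1.
    apply: le_trans (xxV i _ (lexx _)); rewrite lerD2l lerN2.
    by rewrite lef_pV2 ?posrE ?(node_gt0 nt).
  have o := osc (trace_lift_dom tl) (xx0 i.+1) yt pB B0 tV.
  by have := ler_distD (p t) (p y) (u 1); move: py o; rewrite -/y; lra.
have gall i : \forall n \near \oo, good n (xx i).
  by elim: i => // i /step[].
have aall : {ae mu, forall t, forall i, xx i <= t <= 1 -> u t = u 1}.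
  apply: ae_foralln; elim=> [|i IH].
    apply: aeW => t; rewrite /xx mul0r addr0 invr1 => t1; congr u.
    by apply/eqP; rewrite eq_le andbC.
  have [_ Hs] := step i (gall i); apply: ae_imply2 IH Hs => t h1 h2 /andP[it t1].
  by have [h|/ltW h] := leP (xx i) t; [apply: h1|apply: h2]; rewrite ?h ?it.
apply: ae_imply aall => t H /andP[t0 t1].
have [i] := @filter_ex _ _ _ _ (harmonic_near (mulr_gt0 rho0 t0)) => hi.
apply: (H i.+1); rewrite t1 andbT /xx -[t]invrK lef_pV2 ?posrE ?invr_gt0//.
move: hi; rewrite -[_ * t]invrK lef_pV2 ?posrE ?invr_gt0 ?mulr_gt0//.
rewrite invfM ler_pdivrMl// mulrC => h; apply: le_trans h _; lra.
Qed.

End two_valued.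

(** * Irreducibility *)

Section L2norm_order.
Context {d : measure_display} {T : measurableType d} {R : realType}.
Variable mu : {measure set T -> \bar R}.

Lemma L2norm_le (f g : T -> R) : L2 mu f -> L2 mu g ->
  {ae mu, forall x, `|f x| <= `|g x|} -> (L2norm mu f <= L2norm mu g)%E.
Proof.
move=> fL gL fg; rewrite !L2normE// lee_fin; apply: ler_wsqrtr.
rewrite -lee_fin -!L2dot_sqrE//; have mf := L2_measurable fL; have mg := L2_measurable gL.
apply: ae_ge0_le_integral => //.
- by move=> x _; rewrite lee_fin sqr_ge0.
- by apply/measurable_EFinP; exact: measurable_funX.
- by move=> x _; rewrite lee_fin sqr_ge0.
- by apply/measurable_EFinP; exact: measurable_funX.
apply: ae_imply fg => x h _; rewrite lee_fin -(real_normK (num_real (f x))).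
by rewrite -(real_normK (num_real (g x))) ler_sqr ?nnegrE.
Qed.

End L2norm_order.

Section irreducibility.
Variable R : realType.
Implicit Types (x y l e t : R) (u v g p w f h : R -> R).
Variable a : nat -> {posnum R}.
Notation mu := (trace_mu a).
Variable E : (R -> R) -> \bar R.
Hypothesis HE : is_trace_form a E.
Variable S : R -> (R -> R) -> (R -> R).
Hypothesis SE : semigroup_of_form mu E S.
Notation chi n := (\1_(@cell R n) : R -> R).

Let sgS : L2_semigroup mu S. Proof. by case: SE. Qed.

Let tn (n : nat) : R := n.+1%:R^-1.

Let tn_gt0 n : 0 < tn n. Proof. by rewrite invr_gt0. Qed.

Let tn_cvg : tn n @[n --> \oo] --> (0 : R)^'+.
Proof.
move=> D /= hD; have H : \forall n \near \oo, 0 < tn n -> D (tn n) by exact: (@cvg_harmonic R _ hD).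
by apply: filterS H => n; apply; exact: tn_gt0.
Qed.

(** Strong convergence in [L^2] implies convergence at atoms, so that the generator
    can be evaluated pointwise there along a sequence of times. *)
Lemma generator_atom f h (k : nat) : L2 mu f -> L2 mu h -> generator_at mu S f h ->
  (0 < k)%N -> (tn n)^-1 * (S (tn n) f k%:R - f k%:R) @[n --> \oo] --> h k%:R.
Proof.
move=> fL hL fh k0.
pose q n := (tn n)^-1 *: (S (tn n) f - f).
have qL n : L2 mu (q n).
  by apply: L2_Z; apply: L2_B => //; apply: (sg_L2 sgS) => //; exact: ltW.
have qh : strong_cvg mu q h by exact: (cvg_comp _ _ tn_cvg fh).
have := L2dot_cvg qL hL (L2_atom a k0) qh.
rewrite L2dotC L2dot_atom//.
under eq_fun do rewrite L2dotC L2dot_atom//.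
have ak : (a k)%:num != 0 by [].
move=> /(cvgM (cvg_cst (a k)%:num^-1)); rewrite mulKf//.
apply: cvg_trans; apply: near_eq_cvg; apply: nearW => n.
by rewrite /= mulKf.
Qed.

Lemma generator_cell n : generator_at mu S (chi n) (flux_density a n).
Proof.
have [_ gen] := SE; apply/gen; [exact: L2_cell|exact: L2_flux_density|].
split; first exact: form_dom_cell.
move=> g gD; have [gL _] := gD.
by rewrite (form_bilin_cell HE)// L2dot_flux_density// opprK.
Qed.

Variable A : set R.
Hypothesis mA : measurable A.
Hypothesis invA : invariant_set mu S A.

(** Multiplication by the indicator of an invariant set commutes with the semigroup
    and does not increase the norm, hence it preserves the domain of the generator. *)
Lemma generator_invariant f h : L2 mu f -> L2 mu h -> generator_at mu S f h ->
  generator_at mu S (\1_A * f) (\1_A * h).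
Proof.
move=> fL hL fh; have AL g : L2 mu g -> L2 mu (\1_A * g) by exact: L2_indic.
apply: (squeeze_cvge _ (cvg_cst 0%E) fh).
near=> t; have t0 : 0 < t by near: t; exact: nbhs_right_gt.
have SL g : L2 mu g -> L2 mu (S t g) by move=> gL; apply: (sg_L2 sgS) => //; exact: ltW.
have XL g g' : L2 mu g -> L2 mu g' -> L2 mu (t^-1 *: (S t g - g) - g').
  by move=> gL g'L; apply: L2_B => //; apply: L2_Z; apply: L2_B => //; exact: SL.
have L1 := XL _ _ (AL _ fL) (AL _ hL); have L2' := XL _ _ fL hL.
apply/andP; split; first by rewrite L2normE// lee_fin sqrtr_ge0.
apply: L2norm_le => //; apply: ae_imply (invA fL t0) => x /(_ I) Hx.
have -> : (t^-1 *: (S t (\1_A * f) - \1_A * f) - \1_A * h) x =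
    t^-1 * (S t (\1_A * f) x - \1_A x * f x) - \1_A x * h x by [].
have -> : (t^-1 *: (S t f - f) - h) x = t^-1 * (S t f x - f x) - h x by [].
rewrite Hx; have -> : (\1_A * S t f) x = \1_A x * S t f x by [].
rewrite -!mulrBr mulrCA -mulrBr indicE normrM.
by case: (x \in A); rewrite ?normr1 ?mul1r ?normr0 ?mul0r.
Unshelve. all: by end_near. Qed.

(** If the cell [n] lies in the invariant set, then the semigroup applied to its
    indicator stays 0 at an atom outside of that set, and so does its derivative. *)
Lemma flux_density_invariant n (k : nat) : (0 < k)%N -> ~ A k%:R -> k%:R \notin @cell R n ->
  {ae mu, forall x, x \in @cell R n -> A x} -> flux_density a n k%:R = 0.
Proof.
move=> k0 nAk nck cA; have cL := L2_cell a n; have ALc := L2_indic mA cL.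
have ck : chi n k%:R = 0 by rewrite indicE (negbTE nck).
have cAE : \1_A * chi n = chi n %[ae mu].
  apply: ae_imply cA => x h _; change (\1_A x * \1_(cell n) x = \1_(cell n) x :> R).
  rewrite !indicE; case: (boolP (x \in cell n)) => [/h xA|_]; last by rewrite mulr0.
  by rewrite mem_set// mul1r.
have z m : S (tn m) (chi n) k%:R = 0.
  have H1 := ae_trace_mu_atom k0 (invA cL (tn_gt0 m)).
  have H2 := ae_trace_mu_atom k0 (sg_ae sgS (ltW (tn_gt0 m)) ALc cL cAE).
  rewrite -(H2 I) (H1 I); change ((\1_A k%:R : R) * S (tn m) (chi n) k%:R = 0).
  by rewrite indicE memNset// mul0r.
have := generator_atom cL (L2_flux_density a n) (generator_cell n) k0.
under eq_fun do rewrite z ck subrr mulr0.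
by move/cvg_lim => <- //; rewrite lim_cst.
Qed.

(** By [generator_invariant] the indicator of the part of [A] in [(0, 1]] belongs to
    the domain of the form, where two-valued functions are constant. *)
Lemma invariant_unit : {ae mu, forall x, 0 < x <= 1 -> (x \in A) = (1 \in A)}.
Proof.
have cL := L2_cell a 0; have hL := L2_flux_density a 0.
have [_ gen] := SE.
have /(gen _ _ (L2_indic mA cL) (L2_indic mA hL))[uD _] :=
  generator_invariant cL hL (generator_cell 0).
have uE x : 0 < x <= 1 -> (\1_A * chi 0) x = (x \in A)%:R.
  move=> x01; change (\1_A x * \1_(cell 0) x = (x \in A)%:R :> R).
  by rewrite !indicE [x \in cell 0]mem_set/= ?in_itv// mulr1.
have u01 x : 0 < x <= 1 -> (\1_A * chi 0) x = 0 \/ (\1_A * chi 0) x = 1.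
  by move=> x01; rewrite uE//; case: (x \in A); [right|left].
apply: ae_imply (form_dom_two_valued HE uD u01) => x H x01.
move: (H x01); rewrite uE// uE ?ltr01 ?lexx//.
by case: (x \in A); case: (1 \in A) => // /eqP; rewrite ?oner_eq0// eq_sym oner_eq0.
Qed.

Let cell_natS (n k : nat) : (0 < k)%N -> (k != n.+1)%N -> k%:R \notin @cell R n.
Proof.
move=> k0 kn; rewrite cell_node; last by right; exists k.
by rewrite ltr_nat ler_nat andbC -eqn_leq.
Qed.

(* The flux from a cell to a neighbouring atom is nonzero. Going up from 1 needs the
   whole cell [(0, 1]] to lie in [A], which [invariant_unit] provides; going down
   only involves cells that are atoms. *)
Let natS n : A n.+1%:R <-> A n.+2%:R.
Proof.
split=> [An|An]; apply: contrapT => nA.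
- have := @flux_density_invariant n n.+2 isT nA.
  rewrite flux_density_next => H; have : n.+1%:R * n.+2%:R / (a n.+2)%:num = 0 :> R.
    apply: H; first by rewrite cell_natS// neq_ltn ltnSn ?orbT.
    case: n An {nA} => [|n] An.
      apply: ae_imply invariant_unit => x h; rewrite inE/= in_itv/= => /h.
      by rewrite [1 \in A]mem_set// => /set_mem.
    by apply: aeW => x; rewrite inE/= => ->.
  by apply/eqP; rewrite mulf_neq0// ?mulf_neq0// pnatr_eq0.
- have := @flux_density_invariant n.+1 n.+1 isT nA.
  rewrite flux_density_prev => H; have : n.+1%:R * n.+2%:R / (a n.+1)%:num = 0 :> R.
    apply: H; first by rewrite cell_natS// neq_ltn ltnSn ?orbT.
    by apply: aeW => x; rewrite inE/= => ->.
  by apply/eqP; rewrite mulf_neq0// ?mulf_neq0// pnatr_eq0.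
Qed.

Let nat1 n : A n.+1%:R <-> A 1.
Proof. by elim: n => // n IH; rewrite -natS. Qed.

Lemma invariant_trivial : mu A = 0%E \/ mu (~` A) = 0%E.
Proof.
have H : {ae mu, forall x, (x \in A) = (1 \in A)}.
  apply: ae_imply2 (ae_node a) invariant_unit => x [x01|[[//|k] _ ->] _]; first exact.
  by apply/idP/idP; rewrite !inE nat1.
have null (D : set R) : measurable D -> {ae mu, forall x, ~ D x} -> mu D = 0%E.
  move=> mD [N [mN N0 DN]]; apply/eqP; rewrite eq_le measure_ge0 andbT -N0.
  by apply: le_measure; rewrite ?inE// => x Dx; apply: DN => /=; exact.
have [A1|A1] := boolP (1 \in A); [right|left]; apply: null => //.
- exact: measurableC.
- by apply: ae_imply H => x; rewrite A1 => /set_mem Ax; exact.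
- by apply: ae_imply H => x; rewrite (negbTE A1) => h Ax; move: h; rewrite mem_set.
Qed.

End irreducibility.

Theorem theorem4p4 (R : realType) (a : nat -> {posnum R})
    (E : (R -> R) -> \bar R) (HE : is_trace_form a E) :
  transient (trace_mu a) (@trace_F R) E /\
  irreducible (trace_mu a) (@trace_F R) E.
Proof.
split; first exact: transient_trace_form.
move=> S SE A mA AF invA.
have [|AC0] := invariant_trivial HE SE mA invA; [by left|right].
apply/eqP; rewrite eq_le measure_ge0 andbT -AC0.
apply: le_measure; rewrite ?inE.
- by apply: measurableD => //; exact: measurable_trace_F.
- exact: measurableC.
- by move=> x [].
Qed.
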